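(* Let $(K_+,K_-)$ be a simple Kantor pair over a commutative ring $k$ such that $2,3\in k^\times$. Then $(K_+,K_-)$ is non-degenerate, i.e. it has no nonzero absolute zero divisors.
   Context: Kantor pairs. A Kantor pair over $k$ is a pair of finite-dimensional (i.e. finitely generated) $k$-modules $(K_+,K_-)$ with trilinear products $\{\cdot,\cdot,\cdot\}:K_\sigma\times K_{-\sigma}\times K_\sigma\to K_\sigma$, $\sigma=\pm1$ (also written $\pm$), satisfying, with $V_{x,y}z=\{x,y,z\}$ and $K_{a,b}z=\{a,z,b\}-\{b,z,a\}$, the identities (KP1) $[V_{x,y},V_{z,w}]=V_{\{x,y,z\},w}-V_{z,\{y,x,w\}}$; (KP2) $K_{a,b}V_{x,y}+V_{y,x}K_{a,b}=K_{K_{a,b}x,\,y}$, whenever the expressions make sense. An ideal is a pair of submodules $I_\sigma\subseteq K_\sigma$ with $\{I_\sigma,K_{-\sigma},K_\sigma\}+\{K_\sigma,I_{-\sigma},K_\sigma\}+\{K_\sigma,K_{-\sigma},I_\sigma\}\subseteq I_\sigma$ for $\sigma=\pm1$. A Kantor pair with non-zero product is simple if it has no non-trivial ideals. An element $x\in K_\sigma$ is an absolute zero divisor if $\{x,K_{-\sigma},x\}=0$; the pair is non-degenerate if, for $\sigma=\pm1$, the only absolute zero divisor in $K_\sigma$ is $0$. *)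

(* Defs.v *)
From HB Require Import structures.
From mathcomp Require Import all_boot all_order all_algebra.
From mathcomp Require Import boolp classical_sets.

Set Implicit Arguments.
Unset Strict Implicit.
Unset Printing Implicit Defensive.

Import GRing.Theory.
Local Open Scope ring_scope.
Local Open Scope classical_set_scope.

(* The sign sigma is not an index: each condition is stated for a product     *)
(* f : U -> W -> U -> U standing for K_sigma x K_-sigma x K_sigma -> K_sigma, *)
(* together with the opposite product g : W -> U -> W -> W where needed, and  *)
(* it is then required for (f, g) and for (g, f).                             *)

Definition fin_generated (k : comUnitRingType) (U : lmodType k) : Prop :=
  exists (n : nat) (e : 'I_n -> U),
    forall u, exists c : 'I_n -> k, u = \sum_(i < n) c i *: e i.

Definition trilinear (k : comUnitRingType) (U W : lmodType k)
    (f : U -> W -> U -> U) : Prop :=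
  [/\ forall y z, linear (fun x => f x y z),
      forall x z, linear (fun y => f x y z) &
      forall x y, linear (fun z => f x y z)].

Definition Vop (k : comUnitRingType) (U W : lmodType k)
    (f : U -> W -> U -> U) (x : U) (y : W) (z : U) : U := f x y z.

Definition Kop (k : comUnitRingType) (U W : lmodType k)
    (f : U -> W -> U -> U) (a b : U) (z : W) : U := f a z b - f b z a.

Section Conditions.
Variables (k : comUnitRingType) (U W : lmodType k).

Definition KP1 (f : U -> W -> U -> U) (g : W -> U -> W -> W) : Prop :=
  forall (x z : U) (y w : W) (u : U),
    Vop f x y (Vop f z w u) - Vop f z w (Vop f x y u)
    = Vop f (f x y z) w u - Vop f z (g y x w) u.

Definition KP2 (f : U -> W -> U -> U) (g : W -> U -> W -> W) : Prop :=
  forall (a b : U) (x : W) (y : U) (w : W),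
    Kop f a b (Vop g x y w) + Vop f y x (Kop f a b w)
    = Kop f (Kop f a b x) y w.

Definition ideal_condition (f : U -> W -> U -> U) (I : set U) (J : set W) :
    Prop :=
  [/\ forall x y z, I x -> I (f x y z),
      forall x y z, J y -> I (f x y z) &
      forall x y z, I z -> I (f x y z)].

Definition absolute_zero_divisor (f : U -> W -> U -> U) (x : U) : Prop :=
  forall y : W, f x y x = 0.

End Conditions.

Record kantor_pair (k : comUnitRingType) := KantorPair {
  Kpos : lmodType k;
  Kneg : lmodType k;
  prodpos : Kpos -> Kneg -> Kpos -> Kpos;
  prodneg : Kneg -> Kpos -> Kneg -> Kneg;
  Kpos_fin_generated : fin_generated Kpos;
  Kneg_fin_generated : fin_generated Kneg;
  prodpos_trilinear : trilinear prodpos;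
  prodneg_trilinear : trilinear prodneg;
  KP1_pos : KP1 prodpos prodneg;
  KP1_neg : KP1 prodneg prodpos;
  KP2_pos : KP2 prodpos prodneg;
  KP2_neg : KP2 prodneg prodpos
}.

Section KantorPairs.
Variables (k : comUnitRingType) (K : kantor_pair k).

Definition kantor_ideal (Ipos : set (Kpos K)) (Ineg : set (Kneg K)) : Prop :=
  [/\ submod_closed (mem Ipos), submod_closed (mem Ineg),
      ideal_condition (@prodpos k K) Ipos Ineg &
      ideal_condition (@prodneg k K) Ineg Ipos].

Definition kantor_nonzero_product : Prop :=
  (exists x y z, @prodpos k K x y z <> 0) \/
  (exists x y z, @prodneg k K x y z <> 0).

Definition kantor_simple : Prop :=
  kantor_nonzero_product /\
  forall (Ipos : set (Kpos K)) (Ineg : set (Kneg K)),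
    kantor_ideal Ipos Ineg ->
    (Ipos = [set 0] /\ Ineg = [set 0]) \/ (Ipos = setT /\ Ineg = setT).

Definition kantor_nondegenerate : Prop :=
  (forall x, absolute_zero_divisor (@prodpos k K) x -> x = 0) /\
  (forall x, absolute_zero_divisor (@prodneg k K) x -> x = 0).

End KantorPairs.

Lemma submod_closedE (k : comUnitRingType) (U : lmodType k) (I : set U) :
  submod_closed (mem I) <->
  I 0 /\ forall (a : k) u v, I u -> I v -> I (a *: u + v).
Proof.
split=> -[I0 IP]; split.
- by move: I0; rewrite inE.
- by move=> a u v Iu Iv; have := IP a u v; rewrite !inE; apply.
- by rewrite inE.
- by move=> a u v; rewrite !inE; apply: IP.
Qed.

(* Main.v *)
From HB Require Import structures.
Require Import Defs.
From mathcomp Require Import all_boot all_order all_algebra.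
From mathcomp Require Import boolp classical_sets functions.
From mathcomp Require Import zify ring.

(** The obstacle is that in the general case z itself is no sandwich: ad(z)^2 kills degree -1, but
    on degree -2 only ad(z)^3 vanishes. Hence the detour through degree 2, where ad(c)^2 = 0 on
    degree -2 is a much stronger condition. The parts of degree 2 and -2 form a Jordan pair acting
    on K, but K need not be irreducible under them, and a maximal proper submodule need not be
    stable under degree 0. So sandwiches are taken in the normalizer of that submodule, and the
    stability of the kernel under degree 0 cannot be inherited from anything: it has to be computed.
    The computation shows that derivatives of kernel elements are nilpotent modulo the kernel in a
    Jordan sense, and the absence of degenerate elements then removes them. Denominators are avoided
    throughout: identities are proved after multiplication by 2, 3 or a product of them, which is
    then cancelled. *)

(* K is the part of degree 1 and -1 of a 5-graded Lie algebra L, in which an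
   absolute zero divisor is an element z of degree 1 with ad(z)^2 K_- = 0.
   Simplicity makes k act through a field, and L is finitely generated.

   The main tool are sandwich elements, c with ad(c)^2 = 0 and ad(c) g ad(c) = 0:
   they are closed under brackets, hence act nilpotently by Jacobson's theorem on
   weakly closed sets, and their span is stable under ad(v) when ad(v)^3 = 0, by
   conjugation with exp(v) and exp(-v).
   - If the parts of degree 2 and -2 vanish, z is a sandwich; sandwiches span an
     ideal, so all of K acts nilpotently, which is absurd.
   - If only one of them vanishes, then for x in K_+ and a of degree -2 the
     elements [x,[x,[x,a]]] are sandwiches spanning K_+: again absurd.
   - Otherwise take a maximal proper submodule of K under the parts of degree 2
     and -2. By the sandwich argument the quotient admits no degenerate elements
     of degree 2, and an explicit computation shows that the elements of degree 2
     killing the quotient are stable under degree 0. The degree 2 part being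
     irreducible, none but 0 kills the quotient, so ad(c)^2 = 0 on degree -2
     forces c = 0 in degree 2. Applied to elements built from z this gives z = 0. *)


Set Implicit Arguments.
Unset Strict Implicit.
Unset Printing Implicit Defensive.

Import GRing.Theory.
Local Open Scope ring_scope.

(** * Linear identities in abelian groups *)

(** Syntax for the reflective tactic [zmod]. Brackets and scalar multiples are opaque atoms, so
    bilinearity and the Jacobi identity have to be expanded by rewriting before it is called. *)
Inductive zexpr : Type :=
| ZVar of nat | ZZero | ZAdd of zexpr & zexpr | ZOpp of zexpr
| ZMuln of zexpr & nat.

Fixpoint zeval (V : zmodType) (env : seq V) (e : zexpr) : V :=
  match e with
  | ZVar i => env`_i
  | ZZero => 0
  | ZAdd e1 e2 => zeval env e1 + zeval env e2
  | ZOpp e1 => - zeval env e1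
  | ZMuln e1 n => zeval env e1 *+ n
  end.

(* The multiplicity of the variable [i], as a formal difference. *)
Fixpoint zcoef (e : zexpr) (i : nat) : nat * nat :=
  match e with
  | ZVar j => if i == j then (1, 0)%N else (0, 0)%N
  | ZZero => (0, 0)%N
  | ZAdd e1 e2 => let p := zcoef e1 i in let q := zcoef e2 i in
                  (p.1 + q.1, p.2 + q.2)%N
  | ZOpp e1 => let p := zcoef e1 i in (p.2, p.1)
  | ZMuln e1 n => let p := zcoef e1 i in (p.1 * n, p.2 * n)%N
  end.

Fixpoint zcheck (n : nat) (e1 e2 : zexpr) : bool :=
  if n is m.+1 then
    let p := zcoef e1 m in let q := zcoef e2 m in
    (p.1 + q.2 == q.1 + p.2)%N && zcheck m e1 e2
  else true.

Lemma zeval_sum (V : zmodType) (env : seq V) (e : zexpr) :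
  zeval env e = \sum_(i < size env)
     (env`_i *+ (zcoef e i).1 - env`_i *+ (zcoef e i).2).
Proof.
elim: e => [j||e1 IH1 e2 IH2|e1 IH1|e1 IH1 n] /=.
- have [ltj|lej] := ltnP j (size env).
    rewrite (bigD1 (Ordinal ltj)) //= eqxx mulr1n mulr0n subr0.
    rewrite big1 ?addr0 // => i; rewrite -val_eqE /= => /negPf ->.
    by rewrite !mulr0n subrr.
  (* A variable beyond the environment has value 0, so testing the indices below [size env] in
     [zcheck] is enough. *)
  rewrite nth_default // big1 // => i _.
  by rewrite (ltn_eqF (leq_trans (ltn_ord i) lej)) !mulr0n subrr.
- by rewrite big1 // => i _; rewrite !mulr0n subrr.
- rewrite IH1 IH2 -big_split; apply: eq_bigr => i _ /=.
  by rewrite !mulrnDr opprD addrACA.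
- rewrite IH1 -sumrN; apply: eq_bigr => i _; by rewrite opprB.
- rewrite IH1 -sumrMnl; apply: eq_bigr => i _; by rewrite mulrnBl -!mulrnA.
Qed.

Lemma zeval_eq (V : zmodType) (env : seq V) (e1 e2 : zexpr) :
  zcheck (size env) e1 e2 -> zeval env e1 = zeval env e2.
Proof.
move=> chk; rewrite !zeval_sum; apply: eq_bigr => -[i lti] _ /=.
have /eqP h: ((zcoef e1 i).1 + (zcoef e2 i).2 == (zcoef e2 i).1 + (zcoef e1 i).2)%N.
  elim: (size env) chk lti => //= n IHn /andP[h /IHn {}IHn].
  by rewrite ltnS leq_eqVlt => /orP[/eqP -> //|/IHn].
apply/eqP.
by rewrite subr_eq addrAC eq_sym subr_eq -!mulrnDr h.
Qed.

(* Scalar multiples may carry different but convertible structures. *)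
Ltac zsame x t :=
  lazymatch t with
  | GRing.scale _ _ => unify x t
  | _ => constr_eq x t
  end.

Ltac zmem t env :=
  lazymatch env with
  | nil => constr:(false)
  | ?x :: ?r => match constr:(tt) with
     | _ => let _ := match constr:(tt) with _ => zsame x t end in
            constr:(true)
     | _ => zmem t r end
  end.

Ltac zindex t env :=
  match env with
  | ?x :: ?r => match constr:(tt) with
     | _ => let _ := match constr:(tt) with _ => zsame x t end in
            constr:(0%N)
     | _ => let n := zindex t r in constr:(S n) end
  end.

Ltac zatoms t env :=
  lazymatch t with
  | GRing.add ?a ?b => let env := zatoms a env in zatoms b env
  | GRing.opp ?a => zatoms a env
  | GRing.natmul ?a ?n => zatoms a env
  | GRing.zero => env
  | _ => match zmem t env with true => env | false => constr:(t :: env) end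
  end.

Ltac zreify t env :=
  lazymatch t with
  | GRing.add ?a ?b => let x := zreify a env in let y := zreify b env in
                       constr:(ZAdd x y)
  | GRing.opp ?a => let x := zreify a env in constr:(ZOpp x)
  | GRing.natmul ?a ?n => let x := zreify a env in constr:(ZMuln x n)
  | GRing.zero => constr:(ZZero)
  | _ => let n := zindex t env in constr:(ZVar n)
  end.

Ltac zmod :=
  lazymatch goal with |- @eq ?T0 ?a ?b =>
    let T := eval hnf in T0 in
    let env := zatoms a (@nil T) in let env := zatoms b env in
    let x := zreify a env in let y := zreify b env in
    exact: (@zeval_eq _ env x y isT)
  end.

(** * Submodules and the exchange lemma *)

Section Submodules.
Variables (k : comUnitRingType) (L : lmodType k).
Implicit Types (N A : L -> Prop) (u v : L) (s : seq L).

Definition subm N : Prop :=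
  N 0 /\ forall (a : k) u v, N u -> N v -> N (a *: u + v).

Lemma subm0 N : subm N -> N 0. Proof. by case. Qed.

Lemma submD N u v : subm N -> N u -> N v -> N (u + v).
Proof. by case=> _ sN Nu Nv; rewrite -[u]scale1r; apply: sN. Qed.

Lemma submZ N a u : subm N -> N u -> N (a *: u).
Proof. by case=> N0 sN Nu; rewrite -[_ *: _]addr0; apply: sN. Qed.

Lemma submN N u : subm N -> N u -> N (- u).
Proof. by move=> sN Nu; rewrite -scaleN1r; apply: submZ. Qed.

Lemma submB N u v : subm N -> N u -> N v -> N (u - v).
Proof. by move=> sN Nu Nv; apply: submD => //; apply: submN. Qed.

Lemma submMn N u n : subm N -> N u -> N (u *+ n).
Proof. by move=> sN Nu; rewrite -scaler_nat; apply: submZ. Qed.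

Lemma submDr N u v : subm N -> N u -> N (u + v) -> N v.
Proof. by move=> sN Nu Nuv; rewrite -[v](addKr u); apply: submD => //; apply: submN. Qed.

Lemma submMnK N u n : (n%:R : k) \is a GRing.unit -> subm N -> N (u *+ n) -> N u.
Proof.
move=> Un sN; rewrite -scaler_nat => /(submZ n%:R^-1 sN).
by rewrite scalerA mulVr // scale1r.
Qed.

Lemma mulrnK0 u n : (n%:R : k) \is a GRing.unit -> u *+ n = 0 -> u = 0.
Proof.
move=> Un; apply: (@submMnK (fun v => v = 0)) => //.
by split=> // a _ _ -> ->; rewrite scaler0 addr0.
Qed.

Lemma mulrn_injU u v n : (n%:R : k) \is a GRing.unit -> u *+ n = v *+ n -> u = v.
Proof.
move=> Un uv; apply/eqP; rewrite -subr_eq0; apply/eqP/(mulrnK0 Un).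
by rewrite mulrnBl uv subrr.
Qed.

Lemma subm_zero : subm (fun v => v = 0).
Proof. by split=> // a _ _ -> ->; rewrite scaler0 addr0. Qed.

Lemma subm_and N N' : subm N -> subm N' -> subm (fun v => N v /\ N' v).
Proof.
move=> [N0 sN] [N'0 sN']; split=> // a u v [Nu N'u] [Nv N'v].
by split; [apply: sN | apply: sN'].
Qed.

Inductive span A : L -> Prop :=
| mem_span u of A u : span A u
| span_zero : span A 0
| span_lin a u v of span A u & span A v : span A (a *: u + v).

Lemma span_subm A : subm (span A).
Proof. by split; [exact: span_zero | exact: span_lin]. Qed.

Lemma span_min A N v : subm N -> (forall u, A u -> N u) -> span A v -> N v.
Proof.
by move=> [N0 sN] AN; elim=> [u /AN //||a u w _ Nu _ Nw] //; apply: sN.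
Qed.

(** Carrying a base [N] lets a vector be moved from the list into the base, which drives the
    induction in [indep_size]. *)
Fixpoint lspan N s : L -> Prop :=
  if s is e :: s' then fun v => exists c : k, lspan N s' (v - c *: e) else N.

Lemma lspan_subm N s : subm N -> subm (lspan N s).
Proof.
move=> sN; elim: s => //= e s [IH0 IHs]; split.
  by exists 0; rewrite scale0r subr0.
move=> a u v [c Nu] [d Nv]; exists (a * c + d).
suff -> : a *: u + v - (a * c + d) *: e = a *: (u - c *: e) + (v - d *: e).
  exact: IHs.
by rewrite scalerDl -scalerA scalerBr; zmod.
Qed.

Lemma lspan_tl N s e v : lspan N s v -> lspan N (e :: s) v.
Proof. by exists 0; rewrite scale0r subr0. Qed.

Lemma lspan_hd N s e : subm N -> lspan N (e :: s) e.
Proof. by exists 1; rewrite scale1r subrr; apply: subm0 (lspan_subm s _). Qed.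

Lemma lspan_base N s v : N v -> lspan N s v.
Proof. by move=> Nv; elim: s => //= e s IHs; apply: lspan_tl. Qed.

Lemma lspan_min N N' s v : subm N' -> (forall u, N u -> N' u) ->
  (forall e, e \in s -> N' e) -> lspan N s v -> N' v.
Proof.
move=> sN' NN'; elim: s v => [|e s IHs] v /= sN; first exact: NN'.
case=> c /IHs Nv; rewrite -[v](subrK (c *: e)) addrC.
apply: sN'.2; first by apply: sN; rewrite mem_head.
by apply: Nv => e' se'; apply: sN; rewrite in_cons se' orbT.
Qed.

Lemma lspan_mem N s e : subm N -> e \in s -> lspan N s e.
Proof.
move=> sN; elim: s => // e' s IHs; rewrite in_cons => /orP[/eqP ->|/IHs].
  exact: lspan_hd.
exact: lspan_tl.
Qed.

Lemma lspan_mono N N' s s' v : subm N' -> (forall u, N u -> N' u) ->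
  {subset s <= s'} -> lspan N s v -> lspan N' s' v.
Proof.
move=> sN' NN' ss'; apply: lspan_min; first exact: lspan_subm.
  by move=> u /NN'; apply: lspan_base.
by move=> e /ss'; apply: lspan_mem.
Qed.

Lemma lspan_rcons N s e : lspan N (rcons s e) = lspan (lspan N [:: e]) s.
Proof. by elim: s => //= e' s ->. Qed.

(* Stands in for "[k] acts on [L] through a field". *)
Definition field_like : Prop :=
  forall a : k, (forall v, a *: v = 0) \/ exists b : k, forall v, (a * b) *: v = v.

Hypothesis fL : field_like.

(** Steinitz exchange. Coefficients that act as 0 are dropped; the first one that does not is
    invertible on [L], and its generator is solved for. *)
Lemma lspan_exchange N s v : subm N -> lspan N s v -> ~ N v ->
  exists s1 e s2, s = s1 ++ e :: s2 /\
                  lspan (lspan N [:: v]) (s1 ++ s2) e.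
Proof.
move=> sN; have sNv := lspan_subm [:: v] sN.
elim: s v sNv => [|e s IHs] v sNv //= [c Nv] nNv.
case: (fL c) => [c0|[b cb1]].
  have /IHs[//|//|s1 [e' [s2 [-> se']]]] : lspan N s v by rewrite -[v]subr0 -(c0 e).
  by exists (e :: s1), e', s2; split=> //; apply: lspan_tl.
exists [::], e, s; split=> //=.
rewrite (_ : e = b *: (v - (v - c *: e))); last first.
  by rewrite opprB addrC subrK scalerA mulrC cb1.
apply: submZ; first exact: lspan_subm.
apply: submB; first exact: lspan_subm.
  exact: lspan_base (lspan_hd [::] v sN).
by apply: lspan_mono Nv => // u; exact: (@lspan_tl N [::]).
Qed.

Fixpoint indep N s : Prop :=
  if s is v :: s' then ~ lspan N s' v /\ indep N s' else True.

Lemma indep_rcons N s v :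
  indep N (rcons s v) <-> ~ N v /\ indep (lspan N [:: v]) s.
Proof.
elim: s => [|e s IHs] /=; first by split=> -[].
by rewrite lspan_rcons; split=> [[? /IHs[]]|[? [? ?]]] //; split=> //; apply/IHs.
Qed.

(** The last entry of [t] lies outside [N] itself. It joins the base, while the generator exchanged
    for it leaves [s]. *)
Lemma indep_size N s t : subm N -> indep N t ->
  (forall v, v \in t -> lspan N s v) -> (size t <= size s)%N.
Proof.
elim/last_ind: t N s => // t v IHt N s sN /indep_rcons[nNv it] ts.
have sv: lspan N s v by apply: ts; rewrite mem_rcons mem_head.
have [s1 [e [s2 [def_s se]]]] := lspan_exchange sN sv nNv.
rewrite size_rcons def_s size_cat /= addnS ltnS -size_cat.
apply: (IHt (lspan N [:: v])) => // [|u tu]; first exact: (lspan_subm [:: v] sN).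
have := ts u; rewrite mem_rcons in_cons tu orbT => /(_ isT).
apply: lspan_min => [|w|w]; first exact: lspan_subm (lspan_subm [:: v] sN).
  by move=> Nw; apply: lspan_base; exact: (lspan_base [:: v] Nw).
rewrite def_s mem_cat in_cons => sw; case: (eqVneq w e) sw => [-> //|we].
by move=> /= sw; apply: lspan_mem; [exact: (lspan_subm [:: v] sN) | rewrite mem_cat].
Qed.

(** Stands in for the ascending chain condition: it supplies the maximal choices in [jacobson] and
    [maximal_pair_exists]. *)
Lemma indep_bounded N (Q : seq L -> Prop) es : subm N ->
  (forall v, lspan (fun u => u = 0) es v) ->
  Q [::] -> (forall s, Q s -> exists v, ~ lspan N s v /\ Q (v :: s)) -> False.
Proof.
move=> sN gen Q0 Qs.
have [s [Qes ins ss]] : exists s, [/\ Q s, indep N s & size s = (size es).+1].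
  elim: (size es).+1 => [|n [s [/Qs[v [nv Qv]] ins ss]]]; first by exists [::].
  by exists (v :: s); split=> //=; rewrite ss.
suff: (size s <= size es)%N by rewrite ss ltnn.
apply: (indep_size sN ins) => v _.
by apply: lspan_mono (gen v) => // u ->; apply: subm0.
Qed.

End Submodules.

(** * Lie algebras and sandwich elements *)

Record lieAlg (k : comUnitRingType) := LieAlg {
  lie_sort :> lmodType k;
  lbr : lie_sort -> lie_sort -> lie_sort;
  lbr_linearl : forall a u v w, lbr (a *: u + v) w = a *: lbr u w + lbr v w;
  lbr_linearr : forall a u v w, lbr u (a *: v + w) = a *: lbr u v + lbr u w;
  lbr_alt : forall u, lbr u u = 0;
  lbr_jacobi : forall u v w,
    lbr (lbr u v) w = lbr u (lbr v w) - lbr v (lbr u w)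
}.

Notation "u ∙ v" := (lbr u v) (at level 30, right associativity).

Section LieTheory.
Variables (k : comUnitRingType) (L : lieAlg k).
Implicit Types (u v w : L) (N A : L -> Prop).

Lemma brDl u v w : (u + v) ∙ w = u ∙ w + v ∙ w.
Proof. by rewrite -[u]scale1r lbr_linearl !scale1r. Qed.

Lemma brDr u v w : u ∙ (v + w) = u ∙ v + u ∙ w.
Proof. by rewrite -[v]scale1r lbr_linearr !scale1r. Qed.

Lemma br0l u : 0 ∙ u = 0.
Proof. by apply: (addrI (0 ∙ u)); rewrite -brDl !addr0. Qed.

Lemma br0r u : u ∙ 0 = 0.
Proof. by apply: (addrI (u ∙ 0)); rewrite -brDr !addr0. Qed.

Lemma brZl a u v : (a *: u) ∙ v = a *: (u ∙ v).
Proof. by rewrite -[a *: u]addr0 lbr_linearl br0l addr0. Qed.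

Lemma brZr a u v : u ∙ (a *: v) = a *: (u ∙ v).
Proof. by rewrite -[a *: v]addr0 lbr_linearr br0r addr0. Qed.

Lemma brNl u v : (- u) ∙ v = - (u ∙ v).
Proof. by rewrite -scaleN1r brZl scaleN1r. Qed.

Lemma brNr u v : u ∙ (- v) = - (u ∙ v).
Proof. by rewrite -scaleN1r brZr scaleN1r. Qed.

Lemma brMnl u v n : (u *+ n) ∙ v = (u ∙ v) *+ n.
Proof. by rewrite -scaler_nat brZl scaler_nat. Qed.

Lemma brMnr u v n : u ∙ (v *+ n) = (u ∙ v) *+ n.
Proof. by rewrite -scaler_nat brZr scaler_nat. Qed.

Lemma brC u v : u ∙ v = - (v ∙ u).
Proof.
apply/eqP; rewrite -addr_eq0; apply/eqP.
by have := lbr_alt (u + v); rewrite brDl !brDr !lbr_alt add0r addr0 addrC.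
Qed.

Definition lieE :=
  (@lbr_jacobi k L, (brDl, brDr, brNl, brNr, brMnl, brMnr, br0l, br0r)).

Lemma brA u v w : u ∙ v ∙ w = (u ∙ v) ∙ w + v ∙ u ∙ w.
Proof. by rewrite lieE subrK. Qed.

Lemma subm_brl N v : subm N -> subm (fun u => N (u ∙ v)).
Proof.
move=> sN; split=> [|a u w Nu Nw]; first by rewrite br0l; apply: subm0.
by rewrite lbr_linearl; apply: sN.2.
Qed.

Lemma subm_brr N u : subm N -> subm (fun v => N (u ∙ v)).
Proof.
move=> sN; split=> [|a v w Nv Nw]; first by rewrite br0r; apply: subm0.
by rewrite lbr_linearr; apply: sN.2.
Qed.

Lemma subm_all (T : Type) (P : T -> L -> Prop) :
  (forall t, subm (P t)) -> subm (fun u => forall t, P t u).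
Proof.
move=> sP; split=> [t|a u v Pu Pv t]; first exact: subm0.
by apply: (sP t).2.
Qed.

Lemma subm_impl N (Q : Prop) : subm N -> subm (fun u => Q -> N u).
Proof.
move=> sN; split=> [_|a u v Nu Nv q]; first exact: subm0.
by apply: sN.2; [apply: Nu | apply: Nv].
Qed.

Section Sandwich.
Variables (g M M' : L -> Prop).
Hypotheses (sg : subm g) (sM : subm M) (sM' : subm M').
Hypotheses (gg : forall u v, g u -> g v -> g (u ∙ v))
  (gM : forall u v, g u -> M v -> M (u ∙ v))
  (gM' : forall u v, g u -> M' v -> M' (u ∙ v))
  (M'M : forall u, M' u -> M u).

(* [c] acts on the quotient M/M' as an operator with [c * g * c = 0]. *)
Definition sandwich c : Prop :=
  [/\ g c, forall m, M m -> M' (c ∙ c ∙ m) &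
      forall v m, g v -> M m -> M' (c ∙ v ∙ c ∙ m)].

(** In the expansion of the second condition only the words b c v b c and c b v c b have no visible
    sandwich factor. Moving the letter next to v across it produces factors b (c ∙ v) b and c b c,
    respectively c (b ∙ v) c and b c b. *)
Lemma sandwich_br b c : sandwich b -> sandwich c -> sandwich (b ∙ c).
Proof.
move=> [gb bb bvb] [gc cc cvc].
have bcb m : M m -> M' (b ∙ c ∙ b ∙ m) by apply: bvb.
have cbc m : M m -> M' (c ∙ b ∙ c ∙ m) by apply: cvc.
split; first exact: gg.
- by move=> m Mm; rewrite !lieE; do ?[apply: submB => //]; auto.
- move=> v m gv Mm; have gcv := gg gc gv; have gbv := gg gb gv.
  have h1 : M' (b ∙ c ∙ v ∙ b ∙ c ∙ m).
    have -> : b ∙ c ∙ v ∙ b ∙ c ∙ m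
        = b ∙ v ∙ (c ∙ b ∙ c ∙ m) + b ∙ (c ∙ v) ∙ b ∙ (c ∙ m).
      by rewrite [c ∙ v ∙ b ∙ c ∙ m]brA brDr addrC.
    by apply: submD => //; auto.
  have h2 : M' (c ∙ b ∙ v ∙ c ∙ b ∙ m).
    have -> : c ∙ b ∙ v ∙ c ∙ b ∙ m
        = c ∙ v ∙ (b ∙ c ∙ b ∙ m) + c ∙ (b ∙ v) ∙ c ∙ (b ∙ m).
      by rewrite [b ∙ v ∙ c ∙ b ∙ m]brA brDr addrC.
    by apply: submD => //; auto.
  by rewrite !lieE; do ?[apply: submB => //]; auto.
Qed.

(* Truncated conjugation by exp v. *)
Definition lexp v u : L := u *+ 2 + (v ∙ u) *+ 2 + v ∙ v ∙ u.

(** Conjugation by exp v is an automorphism. As [lexp] is twice the exponential, [lexp (- v)]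
    inverts it only up to the factor 4, so arguments are multiplied by 4 to become values of
    [lexp v]. *)
Lemma sandwich_exp v c : (2%:R : k) \is a GRing.unit ->
  (3%:R : k) \is a GRing.unit -> g v ->
  (forall u, g u -> v ∙ v ∙ v ∙ u = 0) -> (forall u, M u -> v ∙ v ∙ v ∙ u = 0) ->
  sandwich c -> sandwich (lexp v c).
Proof.
move=> U2 U3 gv vg vM [gc cc cvc].
have expM (N : L -> Prop) w u : subm N -> (forall z, N z -> N (w ∙ z)) ->
    N u -> N (lexp w u).
  by move=> sN wN Nu; do ?[apply: submD => // | apply: submMn => //]; auto.
have expK w u : w ∙ w ∙ w ∙ u = 0 -> lexp w (lexp (- w) u) = u *+ 4.
  move=> w3; rewrite /lexp !lieE w3 !lieE; zmod.
(* The components of degree 3 and 4 in [v] of [lexp v a, lexp v b] vanish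
   because those of ad(v)^3 [a, b] and ad(v)^4 [a, b] do. *)
have expJ a b : g a -> v ∙ v ∙ v ∙ a = 0 -> v ∙ v ∙ v ∙ b = 0 ->
    v ∙ v ∙ v ∙ (a ∙ b) = 0 -> lexp v a ∙ lexp v b = lexp v (a ∙ b) *+ 2.
  move=> ga; rewrite /lexp; set a1 := v ∙ a; set a2 := v ∙ a1.
  set b1 := v ∙ b; set b2 := v ∙ b1 => va vb vab.
  have d x y x' y' : v ∙ x = x' -> v ∙ y = y' -> v ∙ (x ∙ y) = x' ∙ y + x ∙ y'.
    by move=> <- <-; rewrite brA.
  have f1 : v ∙ (a ∙ b) = a1 ∙ b + a ∙ b1 by apply: d.
  have f2 : v ∙ v ∙ (a ∙ b) = a2 ∙ b + (a1 ∙ b1) *+ 2 + a ∙ b2.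
    by rewrite f1 brDr (d a1 b a2 b1) // (d a b1 a1 b2) //; zmod.
  have e3 : a2 ∙ b1 + a1 ∙ b2 = 0.
    apply: (mulrnK0 U3); rewrite -[RHS]vab f2 !brDr.
    rewrite (d a2 b 0 b1) // (d a1 b1 a2 b2) // (d a b2 a1 0) //.
    by rewrite br0l br0r; zmod.
  have e4 : a2 ∙ b2 = 0.
    apply: (mulrnK0 U2); have := congr1 (lbr v) e3.
    rewrite br0r brDr (d a2 b1 0 b2) // (d a1 b2 a2 0) // br0l br0r => <-; zmod.
  rewrite f2 f1 ?(brDl, brDr, brMnl, brMnr) e4.
  rewrite -[RHS]addr0 -[X in _ = _ + X](mul0rn _ 2) -[X in _ = _ + X *+ 2]e3; zmod.
have gw : g (lexp v c) by apply: expM => // z; apply: gg.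
have key m : M m -> exists2 m0, M m0 & m *+ 4 = lexp v m0.
  move=> Mm; exists (lexp (- v) m); last by rewrite expK ?vM.
  by apply: expM => // z Mz; rewrite brNl; apply: submN => //; apply: gM.
have U4 : ((4%:R : k)) \is a GRing.unit by rewrite (natrM _ 2 2) unitrM U2.
have expJM a m : g a -> M m -> lexp v a ∙ lexp v m = lexp v (a ∙ m) *+ 2.
  by move=> ga Mm; apply: expJ => //; [apply: vg | apply: vM | apply/vM/gM].
have expM' u : M' u -> M' (lexp v u) by apply: expM => // z; apply: gM'.
split=> // [m /key[m0 Mm0 dm]|w m gw' /key[m0 Mm0 dm]].
  apply: (submMnK U4) => //; rewrite -!brMnr dm expJM // brMnr expJM //; last exact: gM.
  by do 2!apply: submMn => //; apply/expM'/cc.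
have [w0 gw0 dw] : exists2 w0, g w0 & w *+ 4 = lexp v w0.
  exists (lexp (- v) w); last by rewrite expK ?vg.
  by apply: expM => // z gz; rewrite brNl; apply: submN => //; apply: gg.
apply: (submMnK U4) => //; apply: (submMnK U4) => //.
have -> : (lexp v c ∙ w ∙ lexp v c ∙ m) *+ 4 *+ 4
    = lexp v c ∙ (w *+ 4) ∙ lexp v c ∙ (m *+ 4).
  by rewrite brMnl !brMnr.
rewrite dw dm expJM // brMnr expJM //; last exact: gM.
rewrite !brMnr expJM //; last by do 2!apply: gM => //.
by do 3!apply: submMn => //; apply/expM'/cvc.
Qed.

Lemma sandwich_ad v c : (2%:R : k) \is a GRing.unit ->
  (3%:R : k) \is a GRing.unit -> g v ->
  (forall u, g u -> v ∙ v ∙ v ∙ u = 0) -> (forall u, M u -> v ∙ v ∙ v ∙ u = 0) ->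
  sandwich c -> span sandwich (v ∙ c).
Proof.
move=> U2 U3 gv vg vM sc; have sS := span_subm sandwich.
suff h : span sandwich ((v ∙ c) *+ 2 *+ 2) by do 2!apply: (submMnK U2 sS).
(* Only the odd part of the exponential survives in the difference. *)
rewrite (_ : _ *+ 2 = lexp v c - lexp (- v) c); last first.
  by rewrite /lexp !lieE; zmod.
apply: (submB sS); apply: mem_span; apply: sandwich_exp => //.
- exact: submN.
- by move=> u gu; rewrite !lieE vg ?oppr0.
- by move=> u Mu; rewrite !lieE vM ?oppr0.
Qed.

(** ** Weakly closed sets of nilpotent operators *)

(* The upper central series of [M] modulo [M'] with respect to [S]. *)
Fixpoint upper (S : L -> Prop) (i : nat) : L -> Prop :=
  if i is j.+1 then fun m => M m /\ forall c, S c -> upper S j (c ∙ m) else M'.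

Lemma upper_subm S i : subm (upper S i).
Proof.
elim: i => [|i IHi] //=; apply: subm_and => //.
by do 2!apply: subm_all => // ?; apply: subm_brr.
Qed.

Lemma upperS S i : (forall c, S c -> g c) ->
  forall m, upper S i m -> upper S i.+1 m.
Proof.
move=> Sg; elim: i => [|i IHi] m /=.
  by move=> M'm; split=> [|c Sc]; [apply: M'M | apply: gM' => //; apply: Sg].
by move=> [Mm Sm]; split=> // c Sc; apply: IHi; apply: Sm.
Qed.

Lemma upper_leq S i j m : (forall c, S c -> g c) -> (i <= j)%N ->
  upper S i m -> upper S j m.
Proof.
move=> Sg; elim: j => [|j IHj]; first by rewrite leqn0 => /eqP ->.
rewrite leq_eqVlt => /orP[/eqP -> //|/IHj h /h]; exact: upperS.
Qed.

Lemma upper_sub S i m : upper S i m -> M m.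
Proof. by case: i => [/M'M|i []]. Qed.

Let N0 c := forall m, M m -> M' (c ∙ m).

Lemma N0_subm : subm N0.
Proof. by do 2!apply: subm_all => // ?; apply: subm_brl. Qed.

(** A list [s] in [S] is enlarged as long as [Om s], the part of [S] in its span modulo trivially
    acting elements, acts nilpotently. If [Om s] is not all of [S], some [c] in [S] outside of it
    normalizes it, and since [c] squares to 0 it can be added to [s]. *)
Lemma jacobson S (es : seq L) :
  field_like L -> (forall v, lspan (fun u => u = 0) es v) ->
  (forall c, S c -> g c) -> (forall b c, S b -> S c -> S (b ∙ c)) ->
  (forall c m, S c -> M m -> M' (c ∙ c ∙ m)) ->
  exists n, forall m, M m -> upper S n m.
Proof.
move=> fL gen Sg SS Scc; apply: contrapT => nilS.
pose Om s c := S c /\ lspan N0 s c.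
have Omg s c : Om s c -> g c by case=> /Sg.
pose Q s := (forall e, e \in s -> S e) /\
            exists n, forall m, M m -> upper (Om s) n m.
apply: (indep_bounded fL N0_subm gen (Q := Q)) => [|s [sS [n nilp]]].
  split=> //; exists 1%N => m Mm; split=> // c [_ /= c0]; exact: c0.
pose K := upper (Om s).
have sK i : subm (K i) by exact: upper_subm.
have Kle i j m : (i <= j)%N -> K i m -> K j m by apply: upper_leq => c /Omg.
have [c [Sc nc cOm]] : exists c, [/\ S c, ~ lspan N0 s c &
    forall t, Om s t -> Om s (c ∙ t)].
  apply: contrapT => noc; apply: nilS; exists n => m /nilp; move: m.
  suff OmS c : S c -> Om s c.
    elim: (n) => //= i IHi m [Mm Km]; split=> // c Sc; apply: IHi.
    by apply: Km; apply: OmS.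
  move=> Sc; split=> //; apply: contrapT => nc.
  (* Bracketing with elements of [Om s] raises the degree of an element of
     [S] outside of [Om s] with respect to the filtration [K]. *)
  pose deg d c := forall i x, (0 < i)%N -> K i x -> K (i + n.+1 - d)%N (c ∙ x).
  have [c' [Sc' nc' dc']] : exists c',
      [/\ S c', ~ lspan N0 s c' & deg (n.+1 + n.+1)%N c'].
    elim: (_ + _)%N => [|d [b [Sb nb db]]].
      exists c; split=> // i x _ /upper_sub Mx.
      apply: (@Kle n); first by rewrite subn0; lia.
      by apply: nilp; apply: gM => //; apply: Sg.
    have [t [Omt nt]] : exists t, Om s t /\ ~ Om s (b ∙ t).
      apply: contrapT => h; apply: noc; exists b; split=> // t Omt.
      by apply: contrapT => h'; apply: h; exists t.
    exists (b ∙ t); split=> [||[//|i] x _ Kx]; first by apply: SS => //; case: Omt.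
      by move=> l; apply: nt; split=> //; apply: SS => //; case: Omt.
    rewrite !lieE; apply: submB => //.
      have := Kx.2 t Omt; case: i Kx => [|i] Kx Ktx; last first.
        by rewrite (_ : _ - _ = i.+1 + n.+1 - d)%N; [apply: db | lia].
      apply: (@Kle 0%N); first by lia.
      by apply: gM' => //; apply: Sg.
    have := db _ _ (ltn0Sn i) Kx.
    rewrite (_ : i.+1 + n.+1 - d.+1 = (i.+1 + n.+1 - d).-1)%N; last by lia.
    case: (_ - _)%N => [|j] /= h; last by apply: h.2.
    by apply: gM' => //; apply: Omg Omt.
  (* For [i = n.+1] and a loss of 2n + 2 the target layer is [K 0], so [c'] sends all of [M] into
     [M'] and lies in the base [N0]. *)
  apply: nc'; apply: lspan_base => m Mm.
  have /dc' : K n.+1 m by apply: upperS; [move=> ? /Omg | apply: nilp].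
  by rewrite subnn; apply.
have cK i x : K i x -> K i (c ∙ x).
  elim: i x => [|i IHi] x /=; first by apply: gM'; apply: Sg.
  move=> [Mx Kx]; split=> [|t Omt]; first by apply: gM => //; apply: Sg.
  have -> : t ∙ c ∙ x = c ∙ t ∙ x - (c ∙ t) ∙ x by rewrite !lieE; zmod.
  by apply: submB => //; [apply/IHi/Kx | apply/Kx/cOm].
have spK w i x : lspan N0 s w -> K i.+1 x -> K i (w ∙ x).
  move=> sw Kx; refine (lspan_min (N' := fun w => K i (w ∙ x)) _ _ _ sw).
  - exact: subm_brl.
  - by move=> u N0u; apply: (@Kle 0%N) => //; apply: N0u; case: Kx.
  - move=> e se; apply: Kx.2; split; first exact: sS.
    exact: lspan_mem N0_subm se.
exists c; split=> //; split.
  by move=> e; rewrite in_cons => /orP[/eqP -> //|]; apply: sS.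
have sg' e : Om (c :: s) e -> g e by apply: Omg.
have sK' i : subm (upper (Om (c :: s)) i) by apply: upper_subm.
(* Each layer of [K] costs two steps: modulo the layer below, an element of [Om (c :: s)] acts as a
   multiple of [c], and [c] squares to 0. *)
exists (n + n)%N => m /nilp; rewrite -/K; move: m.
elim: (n) => // i IHi m Km; rewrite addSn addnS.
have Mm := upper_sub Km.
split=> // e [_ /= [d sd]]; have -> : e ∙ m = (e - d *: c) ∙ m + d *: (c ∙ m).
  by rewrite -brZl -brDl subrK.
apply: (submD (sK' (i + i).+1)); first by apply: upperS => //; apply/IHi/spK.
apply: (submZ _ (sK' (i + i).+1)); split=> [|f [_ /= [b sb]]]; first by apply: gM => //; apply: Sg.
have -> : f ∙ c ∙ m = (f - b *: c) ∙ c ∙ m + b *: (c ∙ c ∙ m).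
  by rewrite -brZl -brDl subrK.
apply: (submD (sK' (i + i)%N)); first by apply/IHi/spK => //; apply: cK.
by apply: (submZ _ (sK' (i + i)%N)); apply: (@upper_leq _ 0) => //; apply: Scc.
Qed.

End Sandwich.
End LieTheory.

(** * Five-graded Lie algebras of Kantor pairs *)

Section Graded.
Variables (k : comUnitRingType) (L : lieAlg k).
Implicit Types (Tp Tm X Y N Ip Im : L -> Prop) (u v w b c d : L).

Definition brspan X Y : L -> Prop :=
  span (fun v => exists x y, [/\ X x, Y y & v = x ∙ y]).

Lemma brspan_subm X Y : subm (brspan X Y). Proof. exact: span_subm. Qed.

Lemma mem_brspan X Y x y : X x -> Y y -> brspan X Y (x ∙ y).
Proof. by move=> Xx Yy; apply: mem_span; exists x, y. Qed.

Lemma brspan_ind X Y N d : subm N -> (forall x y, X x -> Y y -> N (x ∙ y)) ->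
  brspan X Y d -> N d.
Proof.
by move=> sN XYN; apply: span_min => // _ [x [y [Xx Yy ->]]]; apply: XYN.
Qed.

Lemma brspanC X Y d : brspan X Y d -> brspan Y X d.
Proof.
have sN := brspan_subm Y X.
by apply: (brspan_ind sN) => x y Xx Yy; rewrite brC; apply/(submN sN)/mem_brspan.
Qed.

Definition pair_ideal_cond Tp Tm Ip Im : Prop :=
  [/\ forall i b u, Ip i -> Tm b -> Tp u -> Ip ((i ∙ b) ∙ u),
      forall i b u, Ip i -> Tm b -> Tp u -> Ip ((u ∙ b) ∙ i) &
      forall u j w, Tp u -> Im j -> Tp w -> Ip ((u ∙ j) ∙ w)].

Record kantor_lie Tp Tm : Prop := KantorLie {
  kl_subp : subm Tp;
  kl_subm : subm Tm;
  kl_direct : forall u, Tp u -> Tm u -> u = 0;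
  kl_ppp : forall u v w, Tp u -> Tp v -> Tp w -> (u ∙ v) ∙ w = 0;
  kl_mmm : forall u v w, Tm u -> Tm v -> Tm w -> (u ∙ v) ∙ w = 0;
  kl_ppm : forall u v b, Tp u -> Tp v -> Tm b -> Tp ((u ∙ v) ∙ b);
  kl_mmp : forall u v b, Tm u -> Tm v -> Tp b -> Tm ((u ∙ v) ∙ b);
  kl_pmp : forall u b v, Tp u -> Tm b -> Tp v -> Tp ((u ∙ b) ∙ v);
  kl_mpm : forall u b v, Tm u -> Tp b -> Tm v -> Tm ((u ∙ b) ∙ v);
  kl_faithful : forall X Y d, X = Tp \/ X = Tm -> Y = Tp \/ Y = Tm ->
    brspan X Y d -> (forall u, Tp u -> d ∙ u = 0) ->
    (forall u, Tm u -> d ∙ u = 0) -> d = 0;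
  kl_simple : forall Ip Im, subm Ip -> subm Im ->
    (forall u, Ip u -> Tp u) -> (forall u, Im u -> Tm u) ->
    pair_ideal_cond Tp Tm Ip Im -> pair_ideal_cond Tm Tp Im Ip ->
    ((forall u, Ip u -> u = 0) /\ (forall u, Im u -> u = 0)) \/
    ((forall u, Tp u -> Ip u) /\ (forall u, Tm u -> Im u));
  kl_nonzero : (exists u b v, [/\ Tp u, Tm b, Tp v & (u ∙ b) ∙ v <> 0]) \/
               (exists u b v, [/\ Tm u, Tp b, Tm v & (u ∙ b) ∙ v <> 0])
}.

Lemma kantor_lie_swap Tp Tm : kantor_lie Tp Tm -> kantor_lie Tm Tp.
Proof.
case=> sp sm dir ppp mmm ppm mmp pmp mpm fa si nz; split=> //; [by auto| | |by case: nz; auto].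
- move=> X Y d [] -> [] -> dXY dp dm;
    [apply: (fa Tm Tm)|apply: (fa Tm Tp)|apply: (fa Tp Tm)|apply: (fa Tp Tp)];
  by auto.
- move=> Ip Im sIp sIm Ipm Imp c1 c2.
  by case: (si Im Ip sIm sIp Imp Ipm c2 c1) => -[]; [left | right].
Qed.

Section Basics.
Variables (Tp Tm : L -> Prop).
Hypothesis H : kantor_lie Tp Tm.
Notation D2 := (brspan Tp Tp).
Notation D0 := (brspan Tp Tm).
Notation Dm := (brspan Tm Tm).

Lemma kl2p c u : D2 c -> Tp u -> c ∙ u = 0.
Proof.
move=> c2 Tu; move: c2; apply: (brspan_ind (N := fun c => c ∙ u = 0)).
  exact: (subm_brl _ (subm_zero L)).
by move=> x y Tx Ty; apply: (kl_ppp H).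
Qed.

Lemma klp2 c u : D2 c -> Tp u -> u ∙ c = 0.
Proof. by move=> c2 Tu; rewrite brC kl2p ?oppr0. Qed.

Lemma kl2m c b : D2 c -> Tm b -> Tp (c ∙ b).
Proof.
move=> c2 Tb; move: c2; apply: (brspan_ind (N := fun c => Tp (c ∙ b))).
  exact: (subm_brl _ (kl_subp H)).
by move=> x y Tx Ty; apply: (kl_ppm H).
Qed.

Lemma klm2 c b : D2 c -> Tm b -> Tp (b ∙ c).
Proof. by move=> c2 Tb; rewrite brC; apply: (submN (kl_subp H)); apply: kl2m. Qed.

Lemma kl0p d u : D0 d -> Tp u -> Tp (d ∙ u).
Proof.
move=> d0 Tu; move: d0; apply: (brspan_ind (N := fun d => Tp (d ∙ u))).
  exact: (subm_brl _ (kl_subp H)).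
by move=> x y Tx Ty; apply: (kl_pmp H).
Qed.

Lemma klp0 d u : D0 d -> Tp u -> Tp (u ∙ d).
Proof. by move=> c2 Tb; rewrite brC; apply: (submN (kl_subp H)); apply: kl0p. Qed.

Lemma klpp u v : Tp u -> Tp v -> D2 (u ∙ v). Proof. exact: mem_brspan. Qed.

Lemma klpm u b : Tp u -> Tm b -> D0 (u ∙ b). Proof. exact: mem_brspan. Qed.

Lemma klmp u b : Tp u -> Tm b -> D0 (b ∙ u).
Proof. by move=> Tu Tb; apply: brspanC; apply: mem_brspan. Qed.

Lemma kl02 d c : D0 d -> D2 c -> D2 (d ∙ c).
Proof.
move=> d0; apply: (brspan_ind (N := fun c => D2 (d ∙ c))).
  exact: (subm_brr _ (brspan_subm _ _)).
move=> x y Tx Ty; rewrite brA; apply: submD; first exact: brspan_subm.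
  by apply: klpp => //; apply: kl0p.
by apply: klpp => //; apply: kl0p.
Qed.

Lemma kl20 d c : D0 d -> D2 c -> D2 (c ∙ d).
Proof. by move=> ? ?; rewrite brC; apply: (submN (brspan_subm _ _)); apply: kl02. Qed.

Lemma kl22 c d : D2 c -> D2 d -> c ∙ d = 0.
Proof.
move=> c2; apply: (brspan_ind (N := fun d => c ∙ d = 0)).
  exact: (subm_brr _ (subm_zero L)).
by move=> x y Tx Ty; rewrite brA !(kl2p c2) // br0l br0r addr0.
Qed.

End Basics.

Section Basics2.
Variables (Tp Tm : L -> Prop).
Hypothesis H : kantor_lie Tp Tm.
Let H' := kantor_lie_swap H.
Notation D2 := (brspan Tp Tp).
Notation D0 := (brspan Tp Tm).
Notation Dm := (brspan Tm Tm).

Lemma klmu a b : Dm a -> Tm b -> a ∙ b = 0. Proof. exact: (kl2p H'). Qed.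
Lemma klum a b : Dm a -> Tm b -> b ∙ a = 0. Proof. exact: (klp2 H'). Qed.
Lemma kl_mp a u : Dm a -> Tp u -> Tm (a ∙ u). Proof. exact: (kl2m H'). Qed.
Lemma kl_pm a u : Dm a -> Tp u -> Tm (u ∙ a). Proof. exact: (klm2 H'). Qed.
Lemma kl0m d b : D0 d -> Tm b -> Tm (d ∙ b).
Proof. by move=> /brspanC; exact: (kl0p H'). Qed.
Lemma klm0 d b : D0 d -> Tm b -> Tm (b ∙ d).
Proof. by move=> /brspanC; exact: (klp0 H'). Qed.
Lemma klmm u v : Tm u -> Tm v -> Dm (u ∙ v). Proof. exact: mem_brspan. Qed.
Lemma kl0_ d a : D0 d -> Dm a -> Dm (d ∙ a).
Proof. by move=> /brspanC; exact: (kl02 H'). Qed.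
Lemma kl_0 d a : D0 d -> Dm a -> Dm (a ∙ d).
Proof. by move=> /brspanC; exact: (kl20 H'). Qed.
Lemma kl__ a a' : Dm a -> Dm a' -> a ∙ a' = 0. Proof. exact: (kl22 H'). Qed.

Lemma kl00 d e : D0 d -> D0 e -> D0 (d ∙ e).
Proof.
move=> d0; apply: (brspan_ind (N := fun e => D0 (d ∙ e))).
  exact: (subm_brr _ (brspan_subm _ _)).
move=> x y Tx Ty; rewrite brA; apply: submD; first exact: brspan_subm.
  by apply: mem_brspan => //; apply: (kl0p H).
by apply: mem_brspan => //; apply: kl0m.
Qed.

Lemma kl2_ c a : D2 c -> Dm a -> D0 (c ∙ a).
Proof.
move=> c2; apply: (brspan_ind (N := fun a => D0 (c ∙ a))).
  exact: (subm_brr _ (brspan_subm _ _)).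
move=> x y Tx Ty; rewrite brA; apply: submD; first exact: brspan_subm.
  by apply: mem_brspan => //; apply: (kl2m H).
by apply: brspanC; apply: mem_brspan => //; apply: (kl2m H).
Qed.

Lemma kl_2 c a : D2 c -> Dm a -> D0 (a ∙ c).
Proof. by move=> ? ?; rewrite brC; apply: (submN (brspan_subm _ _)); apply: kl2_. Qed.

(* [I i] sits in degree [n - i] for some [n]; degrees 1 and -1 are [j] and [j.+2]. *)
Lemma chain_ideal (I : nat -> L -> Prop) j :
  (forall i, subm (I i)) ->
  (forall i b v, Tm b -> I i v -> I i.+1 (b ∙ v)) ->
  (forall i u v, Tp u -> I i.+1 v -> I i (u ∙ v)) ->
  (forall i d v, D0 d -> I i v -> I i (d ∙ v)) ->
  (forall u, I j u -> Tp u) -> (forall u, I j.+2 u -> Tm u) ->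
  ((forall u, I j u -> u = 0) /\ (forall u, I j.+2 u -> u = 0)) \/
  ((forall u, Tp u -> I j u) /\ (forall u, Tm u -> I j.+2 u)).
Proof.
move=> sI IM IP I0 Ijp Ijm.
have brCC u v w : (u ∙ v) ∙ w = w ∙ (v ∙ u) :> L by rewrite brC -brNr -brC.
apply: (kl_simple H) => //.
  split=> [i b u Ii Tb Tu|i b u Ii Tb Tu|u i w Tu Ii Tw].
  - by rewrite brCC; apply: IP => //; apply: IM.
  - by apply: I0 => //; apply: mem_brspan.
  - by rewrite brC; apply: submN => //; apply: (IP) => //; apply: IP.
split=> [i b u Ii Tb Tu|i b u Ii Tb Tu|u i w Tu Ii Tw].
- by rewrite brCC; apply: IM => //; apply: IP.
- by apply: I0 => //; apply: klmp.
- by rewrite brC; apply: submN => //; apply: (IM) => //; apply: IM.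
Qed.

(** The ideal generated by [N], degree by degree downwards. When [Tp] kills [N] and [D0] preserves
    it, raising by [Tp] only returns to earlier steps of the chain. *)
Fixpoint chain N (i : nat) : L -> Prop :=
  if i is j.+1 then brspan Tm (chain N j) else N.

Section Chain.
Variable N : L -> Prop.
Hypotheses (sN : subm N) (NTp : forall u v, Tp u -> N v -> u ∙ v = 0)
  (ND0 : forall d v, D0 d -> N v -> N (d ∙ v)).

Lemma chain_subm i : subm (chain N i).
Proof. by case: i => //= i; apply: brspan_subm. Qed.

Lemma chain_m i b v : Tm b -> chain N i v -> chain N i.+1 (b ∙ v).
Proof. exact: mem_brspan. Qed.

Lemma chain_0 i d v : D0 d -> chain N i v -> chain N i (d ∙ v).
Proof.
move=> d0; elim: i v => [|i IHi] v /=; first exact: ND0.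
apply: (@brspan_ind _ _ (fun v => chain N i.+1 (d ∙ v))).
  exact: (subm_brr _ (chain_subm i.+1)).
move=> b w Tb Iw; rewrite brA; apply: (submD (chain_subm i.+1)).
  by apply: mem_brspan => //; apply: kl0m.
by apply: mem_brspan => //; apply: IHi.
Qed.

Lemma chain_p i u v : Tp u -> chain N i.+1 v -> chain N i (u ∙ v).
Proof.
move=> Tu; elim: i v => [|i IHi] v.
  apply: (@brspan_ind _ _ (fun v => N (u ∙ v))).
    exact: (subm_brr _ sN).
  move=> b w Tb Nw; rewrite brA (NTp Tu Nw) br0r addr0.
  by apply: ND0 => //; apply: mem_brspan.
apply: (@brspan_ind _ _ (fun v => chain N i.+1 (u ∙ v))).
  exact: (subm_brr _ (chain_subm i.+1)).
move=> b w Tb Nw; rewrite brA; apply: (submD (chain_subm i.+1)).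
  by apply: chain_0 => //; apply: mem_brspan.
by apply: mem_brspan => //; apply: IHi.
Qed.

Lemma chain_dichotomy j : (forall u, chain N j u -> Tp u) ->
  (forall u, chain N j.+2 u -> Tm u) ->
  (forall u, chain N j u -> u = 0) \/ (forall u, Tp u -> chain N j u).
Proof.
move=> jp jm; have := chain_ideal chain_subm chain_m chain_p chain_0 jp jm.
by case=> -[]; [left | right].
Qed.

End Chain.

(** As [N] sits in degree 2, steps 1 and 3 of its chain have degrees 1 and -1. If step 1 is 0, then
    [N] acts trivially on [Tp] and [Tm], and faithfulness gives 0. *)
Lemma D2_chain N : subm N -> (forall c, N c -> D2 c) ->
  (forall d c, D0 d -> N c -> N (d ∙ c)) ->
  (forall c, N c -> c = 0) \/ (forall u, Tp u -> brspan Tm N u).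
Proof.
move=> sN N2 N0; have NT u v : Tp u -> N v -> u ∙ v = 0.
  by move=> Tu /N2 c2; apply: (klp2 H).
case: (@chain_dichotomy N sN NT N0 1) => [u|u|h|]; last by right.
- apply: brspan_ind; first exact: kl_subp H.
  by move=> b c Tb /N2 c2; apply: (klm2 H).
- apply: brspan_ind; first exact: kl_subm H.
  move=> b v Tb h; apply: klm0 => //; move: v h.
  move=> v; apply: brspan_ind; first exact: brspan_subm.
  move=> b' w Tb' h; apply: klmp => //; move: w h.
  move=> w; apply: brspan_ind; first exact: kl_subp H.
  by move=> b1 c Tb1 /N2 c2; apply: (klm2 H).
left=> c Nc; have c2 := N2 c Nc.
apply: (kl_faithful H _ _ c2); [by left | by left | |] => u Tu.
  exact: (kl2p H).
by rewrite brC (h (u ∙ c)) ?oppr0 //; apply: mem_brspan.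
Qed.

Lemma D2_irreducible N : subm N -> (forall c, N c -> D2 c) ->
  (forall d c, D0 d -> N c -> N (d ∙ c)) ->
  (forall c, N c -> c = 0) \/ (forall c, D2 c -> N c).
Proof.
move=> sN N2 N0; case: (D2_chain sN N2 N0) => [|h]; first by left.
right=> c; apply: brspan_ind => // u v Tu /h.
apply: (@brspan_ind _ _ (fun v => N (u ∙ v))); first exact: (subm_brr _ sN).
move=> b w Tb Nw; rewrite brA (klp2 H (N2 _ Nw) Tu) br0r addr0.
by apply: N0 => //; apply: mem_brspan.
Qed.

Lemma Tp_gen c : D2 c -> c <> 0 -> forall u, Tp u -> brspan D2 Tm u.
Proof.
move=> c2 c0 u Tu; apply: brspanC.
have [h|h] := D2_chain (brspan_subm _ _) (fun c h => h) (kl02 H).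
  by case: c0; apply: h.
exact: h.
Qed.

(** The annihilator of [Tp] in [Tp] generates an ideal from degree 1. Were this ideal everything,
    degree 2 would vanish, against [c]. *)
Lemma Tp_faithful c q : D2 c -> c <> 0 -> Tp q -> (forall u, Tp u -> u ∙ q = 0) ->
  q = 0.
Proof.
move=> c2 c0 Tq q0; pose N q := Tp q /\ forall u, Tp u -> u ∙ q = 0.
have sN : subm N.
  apply: subm_and; first exact: kl_subp H.
  by do 2!apply: subm_all => // ?; apply: (subm_brr _ (subm_zero L)).
have NT u v : Tp u -> N v -> u ∙ v = 0 by move=> Tu [_]; apply.
have N0 d v : D0 d -> N v -> N (d ∙ v).
  move=> d0 [Tv v0]; split=> [|u Tu]; first exact: (kl0p H).
  by rewrite brA !v0 ?br0r ?addr0 //; apply: (klp0 H).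
case: (@chain_dichotomy N sN NT N0 0) => [u []||h|h] //.
- move=> u /=; apply: brspan_ind; first exact: kl_subm H.
  move=> b v Tb h; apply: klm0 => //; move: v h => v.
  apply: brspan_ind; first exact: brspan_subm.
  by move=> b' w Tb' [Tw _]; apply: klmp.
- by apply: h.
case: c0; move: c2; apply: (brspan_ind (subm_zero L)).
by move=> u v Tu /h[_]; apply.
Qed.

Lemma Tp_perfect u : Tp u -> brspan D0 Tp u.
Proof.
move: u; have sIp := brspan_subm D0 Tp; have sIm := brspan_subm D0 Tm.
have Ipp u : brspan D0 Tp u -> Tp u.
  by apply: brspan_ind; [exact: kl_subp H | apply: (kl0p H)].
have Imm u : brspan D0 Tm u -> Tm u.
  by apply: brspan_ind; [exact: kl_subm H | apply: kl0m].
case: (kl_simple H sIp sIm Ipp Imm) => [||[hp hm]|[] //].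
- by split=> [i b u /Ipp ? ? ?|i b u /Ipp ? ? ?|u i w ? /Imm ? ?];
    apply: mem_brspan => //; apply: mem_brspan.
- by split=> [i b u /Imm ? ? ?|i b u /Imm ? ? ?|u i w ? /Ipp ? ?];
    apply: mem_brspan => //; apply: klmp.
case: (kl_nonzero H) => -[u [b [v [Tu Tb Tv []]]]].
  by apply: hp; apply: mem_brspan => //; apply: mem_brspan.
by apply: hm; apply: mem_brspan => //; apply: klmp.
Qed.

(** Such elements form an ideal together with 0 in [Tp]. It cannot be the whole pair, since [Tp = 0]
    would make all products vanish. *)
Lemma Tm_faithful y : Tm y -> (forall u w, Tp u -> Tp w -> (u ∙ y) ∙ w = 0) ->
  y = 0.
Proof.
move=> Ty y0.
pose Y y := Tm y /\ forall u w, Tp u -> Tp w -> (u ∙ y) ∙ w = 0.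
have sY : subm Y.
  apply: subm_and; first exact: kl_subm H.
  apply: subm_all => u; apply: subm_all => w; do 2!apply: subm_impl.
  by apply: (subm_brr _ (subm_brl _ (subm_zero L))).
have sZ := subm_zero L; have sTp := kl_subp H.
have Y0 d v : D0 d -> Y v -> Y (d ∙ v).
  move=> d0 [Tv v0]; split=> [|u w Tu Tw]; first exact: kl0m.
  rewrite brA brDl v0 //; last exact: (klp0 H).
  by rewrite add0r lbr_jacobi !v0 ?br0r ?subr0 //; apply: (kl0p H).
case: (@kl_simple _ _ H (fun u => u = 0) Y) => //.
- by move=> u ->; apply: subm0.
- by move=> u [].
- split=> [i b u ->|i b u ->|u j w Tu [_]] //; first by rewrite br0l br0l.
    by rewrite br0r.
  by move=> h Tw; apply: h.
- split=> [i b u [Ti i0] Tb Tu|i b u Yi Tb Tu|u i w _ -> _].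
  + have E w : Tp w -> (i ∙ b) ∙ w = 0 by move=> Tw; rewrite [i ∙ b]brC brNl i0 ?oppr0.
    split=> [|w w' Tw Tw']; first by apply: kl0m => //; apply: klmp.
    rewrite brA brDl [w ∙ _]brC E // oppr0 br0l br0l add0r lbr_jacobi.
    by rewrite (E w') // br0r subr0 E //; apply: (kl0p H) => //; apply: mem_brspan.
  + by apply: Y0 => //; apply: klmp.
  + by rewrite br0r br0l; apply: subm0.
- by move=> [_ h]; apply: h.
move=> [h _]; case: (kl_nonzero H) => -[u [b [v [Tu Tb Tv []]]]].
  by rewrite (h u) // !br0l.
by rewrite (h b) // br0r br0l.
Qed.

End Basics2.
End Graded.

(** * The Jordan case *)

Section Total.
Variables (k : comUnitRingType) (L : lieAlg k) (Tp Tm : L -> Prop).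
Hypothesis H : kantor_lie Tp Tm.
Let H' := kantor_lie_swap H.
Notation D2 := (brspan Tp Tp).
Notation D0 := (brspan Tp Tm).
Notation Dm := (brspan Tm Tm).

Definition total : L -> Prop :=
  span (fun v => D2 v \/ Tp v \/ D0 v \/ Tm v \/ Dm v).

Lemma total_subm : subm total. Proof. exact: span_subm. Qed.

Lemma total2 v : D2 v -> total v. Proof. by move=> ?; apply: mem_span; left. Qed.
Lemma totalp v : Tp v -> total v. Proof. by move=> ?; apply: mem_span; right; left. Qed.
Lemma total0 v : D0 v -> total v. Proof. by move=> ?; apply: mem_span; do 2!right; left. Qed.
Lemma totalm v : Tm v -> total v. Proof. by move=> ?; apply: mem_span; do 3!right; left. Qed.
Lemma total_ v : Dm v -> total v. Proof. by move=> ?; apply: mem_span; do 4!right. Qed.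

Lemma total_ind N : subm N -> (forall v, D2 v -> N v) -> (forall v, Tp v -> N v) ->
  (forall v, D0 v -> N v) -> (forall v, Tm v -> N v) -> (forall v, Dm v -> N v) ->
  forall v, total v -> N v.
Proof. by move=> sN h2 hp h0 hm h_ v; apply: span_min => // u; intuition. Qed.

Lemma total_br u v : total u -> total v -> total (u ∙ v).
Proof.
have st := total_subm.
have t0 : total 0 by apply: subm0.
move: u; apply: total_ind => [|u hu|u hu|u hu|u hu|u hu].
- by apply: subm_impl; apply: subm_brl.
all: move: v; apply: total_ind; first by apply: subm_brr.
all: move=> v hv.
all: first [ by rewrite (kl22 H) | by rewrite (kl2p H) | by rewrite (klp2 H)
  | by rewrite (kl__ H) | by rewrite (klmu H) | by rewrite (klum H)
  | by apply: total0; first [exact: (kl00 H) | exact: (kl2_ H) | exact: (kl_2 H)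
      | exact: klpm | exact: klmp]
  | by apply: total2; first [exact: (kl02 H) | exact: (kl20 H) | exact: klpp]
  | by apply: total_; first [exact: (kl0_ H) | exact: (kl_0 H) | exact: klmm]
  | by apply: totalp; first [exact: (kl2m H) | exact: (klm2 H) | exact: (kl0p H) | exact: (klp0 H)]
  | by apply: totalm; first [exact: (kl_mp H) | exact: (kl_pm H) | exact: (kl0m H) | exact: (klm0 H)]].
Qed.

Lemma Tp_nonzero : (forall u, Tp u -> u = 0) -> False.
Proof.
move=> h; case: (kl_nonzero H) => -[u [b [v [Tu Tb Tv []]]]].
  by rewrite (h u) // !br0l.
by rewrite (h b) // br0r br0l.
Qed.

(** By [jacobson], [Tp] lies in some layer of the upper series. Since [Tp] is spanned by [D0 ∙ Tp],
    it drops one layer at a time, down to 0. *)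
Lemma not_weakly_nilpotent (C : L -> Prop) (es : seq L) :
  field_like L -> (forall v, lspan (fun u => u = 0) es v) ->
  (forall c, C c -> total c) -> (forall b c, C b -> C c -> C (b ∙ c)) ->
  (forall c v, C c -> total v -> c ∙ c ∙ v = 0) ->
  (forall u, Tp u -> span C u) -> (forall u, Tm u -> span C u) -> False.
Proof.
move=> fL gen Ct CC Ccc Cp Cm; have sz := subm_zero L.
have tz u v : total u -> v = 0 -> u ∙ v = 0 by move=> _ ->; rewrite br0r.
have zt u : u = 0 -> total u by move=> ->; apply: subm0 total_subm.
have [n up] := jacobson total_subm sz total_br tz zt fL gen Ct CC Ccc.
pose K := upper total (fun v => v = 0) C.
have sK i : subm (K i) by apply: upper_subm => //; exact: total_subm.
have step i c v : span C c -> K i.+1 v -> K i (c ∙ v).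
  move=> Sc [_ Kv]; move: Sc; apply: (span_min (N := fun c => K i (c ∙ v))) => //.
  exact: (subm_brl _ (sK i)).
have KS i v : K i v -> K i.+1 v by apply: (upperS tz zt Ct).
apply: Tp_nonzero; change (forall u, Tp u -> K 0%N u).
have : forall u, Tp u -> K n u by move=> u /totalp; apply: up.
elim: n {up} => // i IHi Ki; apply: IHi => u /(Tp_perfect H).
apply: (brspan_ind (sK i)) => d v d0 Tv.
apply: (brspan_ind (N := fun d => K i (d ∙ v)) _ _ d0).
  exact: (subm_brl _ (sK i)).
move=> x b Tx Tb; rewrite lbr_jacobi; apply: (submB (sK i)).
  by apply: (step); [apply: Cp | apply: KS; apply: (step); [apply: Cm | apply: Ki]].
by apply: (step); [apply: Cm | apply: KS; apply: (step); [apply: Cp | apply: Ki]].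
Qed.

(** Expanding ad(ad(c)^2 v) = 0 leaves twice ad(c) ad(v) ad(c), so here the first sandwich condition
    implies the second. *)
Lemma sandwich_total c : (2%:R : k) \is a GRing.unit -> total c ->
  (forall v, total v -> c ∙ c ∙ v = 0) ->
  sandwich total total (fun v => v = 0) c.
Proof.
move=> U2 tc cc; split=> // v w tv tw; apply: (mulrnK0 U2); apply: oppr_inj.
have : (c ∙ c ∙ v) ∙ w = 0 by rewrite cc // br0l.
have t1 : total (v ∙ w) by apply: total_br.
by rewrite !lieE !cc // br0r oppr0 => <-; zmod.
Qed.

End Total.

Section Jordan.
Variables (k : comUnitRingType) (L : lieAlg k) (Tp Tm : L -> Prop).
Hypotheses (U2 : (2%:R : k) \is a GRing.unit) (U3 : (3%:R : k) \is a GRing.unit).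
Hypotheses (H : kantor_lie Tp Tm) (fL : field_like L) (es : seq L).
Hypothesis gen : forall v, lspan (fun u => u = 0) es v.
Let H' := kantor_lie_swap H.
Notation D2 := (brspan Tp Tp).
Notation D0 := (brspan Tp Tm).
Notation Dm := (brspan Tm Tm).
Notation total := (total Tp Tm).

Lemma jordan_zero_divisor z : (forall c, D2 c -> c = 0) ->
  (forall c, Dm c -> c = 0) -> Tp z -> (forall b, Tm b -> z ∙ z ∙ b = 0) -> z = 0.
Proof.
move=> d2 d_ Tz z0; have sz := subm_zero L; have st := total_subm Tp Tm.
have tb := total_br H.
have pp u v : Tp u -> Tp v -> u ∙ v = 0 by move=> ? ?; apply: d2; apply: klpp.
have mm u v : Tm u -> Tm v -> u ∙ v = 0 by move=> ? ?; apply: d_; apply: klmm.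
have ind (N : L -> Prop) : subm N -> (forall v, Tp v -> N v) ->
   (forall v, D0 v -> N v) -> (forall v, Tm v -> N v) -> forall v, total v -> N v.
  move=> sN hp h0 hm; apply: total_ind => // v.
    by move=> /d2 ->; apply: subm0.
  by move=> /d_ ->; apply: subm0.
have zz v : total v -> z ∙ z ∙ v = 0.
  move: v; apply: ind => [|v Tv|v d0|v Tv].
  - exact: (subm_brr z (subm_brr z sz)).
  - by rewrite (pp z v) // br0r.
  - by apply: pp => //; apply: (klp0 H).
  - by rewrite z0.
pose C := sandwich total total (fun v => v = 0).
have Cz : C z by apply: sandwich_total => //; apply: totalp.
have cube v : Tp v \/ Tm v -> forall u, total u -> v ∙ v ∙ v ∙ u = 0.
  move=> hv; apply: ind => [|u Tu|u d0|u Tu].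
  - exact: (subm_brr v (subm_brr v (subm_brr v sz))).
  - case: hv => Tv; first by rewrite (pp v u) // !br0r.
    by rewrite (mm v (_ ∙ _)) ?br0r //; apply: (klm0 H) => //; apply: klmp.
  - case: hv => Tv; first by rewrite (pp v (v ∙ u)) ?br0r //; apply: (klp0 H).
    by rewrite (mm v (v ∙ u)) ?br0r //; apply: (klm0 H).
  - case: hv => Tv; last by rewrite (mm v u) // !br0r.
    by rewrite (pp v (_ ∙ _)) ?br0r //; apply: (klp0 H) => //; apply: klpm.
have tz u v : total u -> v = 0 -> u ∙ v = 0 by move=> _ ->; rewrite br0r.
have zt u : u = 0 -> total u by move=> ->; apply: subm0.
have CC b c : C b -> C c -> C (b ∙ c) by apply: sandwich_br.
have Cad v c : Tp v \/ Tm v -> span C c -> span C (v ∙ c).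
  move=> hv; apply: (span_min (N := fun c => span C (v ∙ c))).
    exact: (subm_brr _ (span_subm _)).
  move=> u Cu; have tv : total v by case: hv; [exact: totalp | exact: totalm].
  have cv := cube v hv; have := @sandwich_ad k L total total (fun v => v = 0).
  by apply; auto.
have Cad0 d c : D0 d -> span C c -> span C (d ∙ c).
  move=> d0 Cc; apply: (brspan_ind (N := fun d => span C (d ∙ c)) _ _ d0).
    exact: (subm_brl _ (span_subm _)).
  move=> x b Tx Tb; rewrite lbr_jacobi; apply: (submB (span_subm _));
    by apply: (Cad); [|apply: (Cad)]; auto.
have CN u v : span C (v ∙ u) -> span C (u ∙ v).
  by move=> h; rewrite brC; apply: submN => //; apply: span_subm.
have sC := span_subm C.
apply: contrapT => nz.
case: (@kl_simple _ _ _ _ H (fun u => Tp u /\ span C u) (fun u => Tm u /\ span C u)).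
- by apply: subm_and => //; exact: kl_subp H.
- by apply: subm_and => //; exact: kl_subm H.
- by move=> u [].
- by move=> u [].
- split=> [i b u [Ti Ci] Tb Tu|i b u [Ti Ci] Tb Tu|u i w Tu [Ti Ci] Tw].
  + by split; [apply: (kl_pmp H) | apply: (CN); apply: (Cad); [left|apply: (CN); apply: (Cad); [right|]]].
  + by split; [apply: (kl_pmp H) | apply: Cad0 => //; apply: klpm].
  + by split; [apply: (kl_pmp H) | apply: (CN); apply: (Cad); [left|apply: (Cad); [left|]]].
- split=> [i b u [Ti Ci] Tb Tu|i b u [Ti Ci] Tb Tu|u i w Tu [Ti Ci] Tw].
  + by split; [apply: (kl_mpm H) | apply: (CN); apply: (Cad); [right|apply: (CN); apply: (Cad); [left|]]].
  + by split; [apply: (kl_mpm H) | apply: Cad0 => //; apply: klmp].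
  + by split; [apply: (kl_mpm H) | apply: (CN); apply: (Cad); [right|apply: (Cad); [right|]]].
- by move=> [h _]; apply: nz; apply: h; split=> //; apply: mem_span.
move=> [hp hm]; apply: (not_weakly_nilpotent (C := C) H fL gen) => //.
- by move=> c [].
- by move=> c v [_ h _]; apply: h.
- by move=> u /hp[].
- by move=> u /hm[].
Qed.

(* If [a] has degree -2 and there is no degree 2, the elements [x ∙ x ∙ x ∙ b]
   are sandwiches spanning [Tp]. *)
Lemma jordan_no_extension a : (forall c, D2 c -> c = 0) -> Dm a -> a <> 0 -> False.
Proof.
move=> d2 da an0; have sz := subm_zero L; have st := total_subm Tp Tm.
have tb := total_br H.
have pp u v : Tp u -> Tp v -> u ∙ v = 0 by move=> ? ?; apply: d2; apply: klpp.
have ind (N : L -> Prop) : subm N -> (forall v, Tp v -> N v) ->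
   (forall v, D0 v -> N v) -> (forall v, Tm v -> N v) -> (forall v, Dm v -> N v) ->
   forall v, total v -> N v.
  by move=> sN hp h0 hm h_; apply: total_ind => // v /d2 ->; apply: subm0.
have sq0 c : subm (fun v => c ∙ c ∙ v = 0) := subm_brr c (subm_brr c sz).
pose C := sandwich total total (fun v => v = 0).
have Ca b : Dm b -> C b.
  move=> db; apply: sandwich_total => //; first exact: total_.
  apply: ind => // v Tv.
  - by rewrite (klmu H) //; apply: (kl_mp H).
  - by rewrite (kl__ H) //; apply: (kl_0 H).
  - by rewrite (klmu H db Tv) br0r.
  - by rewrite (kl__ H db Tv) br0r.
have Cn x b : Tp x -> Dm b -> C (x ∙ x ∙ x ∙ b).
  move=> Tx db.
  set b1 := x ∙ b; set d := x ∙ b1; set n := x ∙ d.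
  have Tb1 : Tm b1 by apply: (kl_pm H).
  have d0 : D0 d by apply: klpm.
  have Tn : Tp n by apply: (klp0 H).
  have xb v : x ∙ b ∙ v = b ∙ x ∙ v + b1 ∙ v by rewrite brA addrC.
  have xb1 v : x ∙ b1 ∙ v = b1 ∙ x ∙ v + d ∙ v by rewrite brA addrC.
  have xd v : x ∙ d ∙ v = d ∙ x ∙ v + n ∙ v by rewrite brA addrC.
  have xn v : x ∙ n ∙ v = n ∙ x ∙ v by rewrite brA (pp x n) // br0l add0r.
  have [xb1E xdE] : x ∙ b1 = d /\ x ∙ d = n by [].
  clearbody n; clearbody d; clearbody b1.
  (* [e1] to [e4] come from [b ∙ b1 = 0] by applying ad(x) again and again; the process stops
     because [x ∙ n], of degree 2, is 0. *)
  have e1 : b ∙ d = 0.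
    by have := congr1 (lbr x) (klmu H db Tb1); rewrite br0r xb xb1E lbr_alt addr0.
  have e2 : b ∙ n = - (b1 ∙ d).
    by have /eqP := congr1 (lbr x) e1; rewrite br0r xb xdE addr_eq0 => /eqP.
  have e3 : b1 ∙ n = 0.
    apply: (mulrnK0 U2); have := congr1 (lbr x) e2.
    rewrite brNr xb xb1 (pp _ _ Tx Tn) br0r xdE lbr_alt add0r addr0 => /eqP.
    by rewrite -subr_eq0 opprK => /eqP <-; zmod.
  have e4 : d ∙ n = 0.
    by have := congr1 (lbr x) e3; rewrite br0r xb1 (pp _ _ Tx Tn) br0r add0r.
  have bd v : b ∙ d ∙ v = d ∙ b ∙ v by rewrite brA e1 br0l add0r.
  have b1n v : b1 ∙ n ∙ v = n ∙ b1 ∙ v by rewrite brA e3 br0l add0r.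
  have dn v : d ∙ n ∙ v = n ∙ d ∙ v by rewrite brA e4 br0l add0r.
  have tx := totalp Tm Tx; have tdb := total_ Tp db; have [_ bb _] := Ca b db.
  have b1b1 r : total r -> b1 ∙ b1 ∙ r = - (b ∙ d ∙ r).
    move=> tr.
    have E v : total v -> b1 ∙ b ∙ v = - (b ∙ b1 ∙ v).
      move=> tv; have := congr1 (lbr x) (bb v tv).
      rewrite br0r (xb (b ∙ v)) (xb v) brDr bb; last exact: tb.
      by rewrite add0r addrC => /eqP; rewrite addr_eq0 => /eqP.
    apply/eqP; rewrite -addr_eq0; apply/eqP/(mulrnK0 U2).
    have /eqP := congr1 (lbr x) (E r tr).
    rewrite brNr (xb (b1 ∙ r)) (xb1 (b ∙ r)) (xb r) (xb1 r) !brDr E; last exact: tb.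
    by rewrite -bd -subr_eq0 => /eqP <-; zmod.
  have dx r : Tp r -> d ∙ r = x ∙ x ∙ b ∙ r.
    move=> Tr; rewrite (xb r) (pp _ _ Tx Tr) br0r add0r (xb1 r).
    by rewrite (pp _ _ Tx Tr) br0r add0r.
  (* The word [x ∙ x ∙ b1 ∙ b1 ∙ r] equals both minus and twice [d ∙ d ∙ r]. *)
  have dd r : Tp r -> d ∙ d ∙ r = 0.
    move=> Tr; have Tdr : Tp (d ∙ r) := kl0p H d0 Tr.
    have b1x : d ∙ r = x ∙ b1 ∙ r by rewrite xb1 (pp x r) // br0r add0r.
    have e5 : d ∙ d ∙ r = - (x ∙ x ∙ b1 ∙ b1 ∙ r).
      by rewrite (dx (d ∙ r)) // -2!(brNr x) b1b1 ?opprK //; apply: totalp.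
    apply: (mulrnK0 U3).
    have e6 : x ∙ x ∙ b1 ∙ b1 ∙ r = (d ∙ d ∙ r) *+ 2.
      rewrite (xb1 (b1 ∙ r)) !brDr (xb1 (x ∙ b1 ∙ r)) (xd (b1 ∙ r)) -b1x.
      by rewrite (pp _ _ Tx Tdr) -b1n (pp _ _ Tn Tr) !br0r; zmod.
    by rewrite [LHS]mulrS -e6 e5 addNr.
  have x3 w : Tm w -> x ∙ x ∙ x ∙ w = 0.
    by move=> Tw; apply: pp => //; apply: (klp0 H) => //; apply: klpm.
  (* Half of ad(x)^4 applied to [b ∙ w = 0], with every ad(x)^3 on [Tm] removed. *)
  have R1 w : Tm w -> (d ∙ x ∙ x ∙ w) *+ 3 + (n ∙ x ∙ w) *+ 2 = 0.
    move=> Tw; apply: (mulrnK0 U2); have : x ∙ x ∙ x ∙ x ∙ b ∙ w = 0 by rewrite (klmu H db Tw) !br0r.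
    rewrite (xb w) !brDr (xb (x ∙ w)) (xb1 w) !brDr.
    rewrite (xb (x ∙ x ∙ w)) (xb1 (x ∙ w)) (xd w) !brDr.
    rewrite (x3 w) // (xb1 (x ∙ x ∙ w)) (xd (x ∙ w)) (xn w) x3 // !br0r.
    by move=> <-; zmod.
  (* Applying [d] to [R1] at [v] gives [n ∙ d ∙ x ∙ v = 0]; then [R1] at [d ∙ v] reduces to twice
     [n ∙ n ∙ v]. *)
  have nn v : Tm v -> n ∙ n ∙ v = 0.
    move=> Tv; have P : n ∙ d ∙ x ∙ v = 0.
      have := congr1 (lbr d) (R1 v Tv); rewrite br0r brDr !brMnr dd ?mul0rn ?add0r.
        by move=> h; rewrite -dn; apply: (mulrnK0 U2).
      by apply: (klp0 H) => //; apply: klpm.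
    apply: (mulrnK0 U2); have Tdv : Tm (d ∙ v) := kl0m H d0 Tv.
    have Txx : Tp (x ∙ x ∙ v) by apply: (klp0 H) => //; apply: klpm.
    have := R1 (d ∙ v) Tdv.
    rewrite (xd v) !brDr (xd (x ∙ v)) (xn v) !brDr (dd (x ∙ x ∙ v)) //.
    by rewrite (dn (x ∙ v)) P => <-; zmod.
  have tn : total n by apply: totalp.
  apply: sandwich_total => //; apply: ind => // [v Tv|v Dv|b' Db'].
  - by rewrite (pp _ _ Tn Tv) br0r.
  - by apply: pp => //; apply: (klp0 H).
  (* [E] has degree 0 and kills [Tp]. Acting as a derivation of the triple product, it kills [Tm] as
     well by [Tm_faithful], hence is 0. *)
  pose E := n ∙ n ∙ b'; have E0 : D0 E by apply: klpm => //; apply: (kl_pm H).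
  have ET u : Tp u -> E ∙ u = 0.
    move=> Tu; rewrite /E !lieE (pp _ _ Tn Tu) !br0r.
    by rewrite nn ?subr0 //; apply: (kl_mp H).
  apply: (kl_faithful H _ _ E0 ET); [by left | by right |] => y Ty.
  apply: (Tm_faithful H); first exact: (kl0m H).
  move=> u w Tu Tw.
  rewrite (brA u E) [u ∙ E]brC ET // oppr0 br0l add0r lbr_jacobi (ET w) // br0r subr0.
  by apply: ET; apply: (kl_pmp H).
have tz u v : total u -> v = 0 -> u ∙ v = 0 by move=> _ ->; rewrite br0r.
have zt u : u = 0 -> total u by move=> ->; apply: subm0.
have CC b c : C b -> C c -> C (b ∙ c) by apply: sandwich_br.
have Tmg := Tp_gen H' da an0.
have sC := span_subm C.
have Cp u : Tp u -> span C u.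
  move=> Tu; have := Tp_perfect H Tu; apply: brspan_ind => // d v d0 Tv.
  apply: (brspan_ind (N := fun d => span C (d ∙ v)) _ _ d0).
    exact: (subm_brl _ sC).
  move=> x b Tx /Tmg; apply: (brspan_ind (N := fun b => span C ((x ∙ b) ∙ v))).
    exact: (subm_brr _ (subm_brl _ sC)).
  move=> c w dc Tw; pose f x y z := x ∙ y ∙ z ∙ c.
  have f1 p q r : Tp p -> Tp q -> f p q r = f q p r.
    by move=> Tp' Tq; rewrite /f (brA p q) (pp p q) // br0l add0r.
  have f2 p q r : Tp q -> Tp r -> f p q r = f p r q.
    by move=> Tq Tr; rewrite /f (brA q r) (pp q r) // br0l add0r.
  have -> : (x ∙ c ∙ w) ∙ v = f v x w.
    by rewrite /f [c ∙ w]brC brNr brNl -brC.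
  have Cf p : Tp p -> span C (f p p p) by move=> ?; apply: mem_span; apply: Cn.
  have TD p q : Tp p -> Tp q -> Tp (p + q) by apply: submD; apply: kl_subp H.
  (* Polarization: [f] is symmetric because [Tp] is abelian, and six times a symmetric trilinear map
     is a signed sum of its diagonal values. *)
  apply: (submMnK U2) => //; apply: (submMnK U3) => //.
  rewrite (_ : _ *+ 3 = f (v + x + w) (v + x + w) (v + x + w) -
    f (v + x) (v + x) (v + x) - f (v + w) (v + w) (v + w) -
    f (x + w) (x + w) (x + w) + f v v v + f x x x + f w w w).
    by do ?[apply: (Cf) | apply: (TD) => // | apply: (submB sC) | apply: (submD sC)].
  have fD1 p q r t : f (p + q) r t = f p r t + f q r t by rewrite /f brDl.
  have fD2 p q r t : f t (p + q) r = f t p r + f t q r by rewrite /f brDl brDr.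
  have fD3 p q r t : f t r (p + q) = f t r p + f t r q by rewrite /f brDl !brDr.
  rewrite !(fD1, fD2, fD3); clearbody f.
  have s1 r : f x v r = f v x r by apply: f1.
  have s2 r : f w v r = f v w r by apply: f1.
  have s3 r : f w x r = f x w r by apply: f1.
  have s4 r : f r x v = f r v x by apply: f2.
  have s5 r : f r w v = f r v w by apply: f2.
  have s6 r : f r w x = f r x w by apply: f2.
  by rewrite !(s1, s2, s3, s4, s5, s6); zmod.
apply: (not_weakly_nilpotent (C := C) H fL gen) => //.
- by move=> c [].
- by move=> c v [_ h _]; apply: h.
move=> u /Tmg; apply: brspan_ind => // b v db /Cp.
apply: (span_min (N := fun v => span C (b ∙ v))); first exact: (subm_brr _ sC).
by move=> c Cc; apply: mem_span; apply: CC => //; apply: Ca.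
Qed.

End Jordan.

(** * Maximal submodules for degrees 2 and -2 *)

Section MaxPair.
Variables (k : comUnitRingType) (L : lieAlg k).
Implicit Types (Tp Tm X Y : L -> Prop).

(* [X + Y] is a submodule of [Tp + Tm] under the parts of degree 2 and -2. *)
Record stable_pair Tp Tm X Y : Prop := StablePair {
  sp_subp : subm X;
  sp_subm : subm Y;
  sp_p : forall u, X u -> Tp u;
  sp_m : forall u, Y u -> Tm u;
  sp_2 : forall c y, brspan Tp Tp c -> Y y -> X (c ∙ y);
  sp__ : forall a x, brspan Tm Tm a -> X x -> Y (a ∙ x)
}.

Record maximal_pair Tp Tm X Y : Prop := MaximalPair {
  mp_stable :> stable_pair Tp Tm X Y;
  mp_properp : exists u, Tp u /\ ~ X u;
  mp_properm : exists u, Tm u /\ ~ Y u;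
  mp_max : forall X' Y', stable_pair Tp Tm X' Y' ->
    (forall u, X u -> X' u) -> (forall u, Y u -> Y' u) ->
    ((forall u, X' u -> X u) /\ (forall u, Y' u -> Y u)) \/
    ((forall u, Tp u -> X' u) /\ (forall u, Tm u -> Y' u))
}.

Lemma stable_pair_swap Tp Tm X Y : stable_pair Tp Tm X Y -> stable_pair Tm Tp Y X.
Proof. by case. Qed.

Lemma maximal_pair_swap Tp Tm X Y : maximal_pair Tp Tm X Y -> maximal_pair Tm Tp Y X.
Proof.
case=> st ep em mx; split=> //; first exact: stable_pair_swap.
move=> X' Y' /stable_pair_swap st' XX YY.
by case: (mx _ _ st' YY XX) => -[]; [left | right].
Qed.

Variables (Tp Tm : L -> Prop) (H : kantor_lie Tp Tm).
Hypotheses (fL : field_like L) (es : seq L).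
Hypothesis gen : forall v, lspan (fun u => u = 0) es v.
Let H' := kantor_lie_swap H.
Notation D2 := (brspan Tp Tp).
Notation D0 := (brspan Tp Tm).
Notation Dm := (brspan Tm Tm).

Section Exists.
Variables (c0 a0 : L).
Hypotheses (c0P : D2 c0) (c0n : c0 <> 0) (a0P : Dm a0) (a0n : a0 <> 0).

(** Only [X] is enlarged. Once it cannot grow, [Y1], the largest partner compatible with [X], makes
    the pair maximal in both components. *)
Lemma maximal_pair_exists : exists X Y, maximal_pair Tp Tm X Y.
Proof.
have Tpg := Tp_gen H c0P c0n; have Tmg := Tp_gen H' a0P a0n.
have pm X Y : stable_pair Tp Tm X Y -> (forall u, Tm u -> Y u) -> forall u, Tp u -> X u.
  move=> st h u /Tpg; apply: brspan_ind; first exact: sp_subp st.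
  by move=> c b Dc /h; apply: (sp_2 st).
have mp X Y : stable_pair Tp Tm X Y -> (forall u, Tp u -> X u) -> forall u, Tm u -> Y u.
  move=> st h u /Tmg; apply: brspan_ind; first exact: sp_subm st.
  by move=> c b Dc /h; apply: (sp__ st).
apply: contrapT => nmax; have sz := subm_zero L.
pose Q (s : seq L) := exists X Y, [/\ stable_pair Tp Tm X Y, exists u, Tp u /\ ~ X u &
  forall e, e \in s -> X e].
apply: (indep_bounded fL sz gen (Q := Q)) => [|s [X [Y [st [u [Tu nX]] sX]]]].
  exists (fun u => u = 0), (fun u => u = 0); split=> //.
    split=> //; try by move=> ? ->; apply: subm0; [exact: kl_subp H].
    - by move=> u ->; apply: subm0; exact: kl_subm H.
    - by move=> c y _ ->; rewrite br0r.
    - by move=> c y _ ->; rewrite br0r.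
  apply: contrapT => h; apply: (Tp_nonzero H) => u Tu.
  by apply: contrapT => nz; apply: h; exists u.
pose Y1 y := Tm y /\ forall c, D2 c -> X (c ∙ y).
have st1 : stable_pair Tp Tm X Y1.
  split=> //; [exact: sp_subp st| |exact: sp_p st|by move=> y []| |].
  - apply: subm_and; first exact: kl_subm H.
    do 2!apply: subm_all => ?; exact: (subm_brr _ (sp_subp st)).
  - by move=> c y Dc [_]; apply.
  - move=> a x Da Xx; split=> [|c Dc].
      by apply: (kl_mp H) => //; apply: (sp_p st).
    by apply: (sp_2 st) => //; apply: (sp__ st).
apply: contrapT => nv; apply: nmax; exists X, Y1; split=> //.
- by exists u.
- apply: contrapT => h; apply: nX; apply: (pm _ _ st1) => // v Tv.
  by apply: contrapT => nz; apply: h; exists v.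
move=> X' Y' st' XX YY; case: (pselect (forall u, Tp u -> X' u)) => [h|nX'].
  by right; split=> //; apply: mp st' h.
have XX' v : X' v -> X v.
  move=> Xv; apply: contrapT => nXv; apply: nv; exists v; split.
    move=> sv; apply: nXv; apply: (lspan_min (sp_subp st) _ _ sv) => //.
    by move=> ? ->; apply: subm0; apply: sp_subp st.
  exists X', Y'; split=> //; last first.
    by move=> e; rewrite in_cons => /orP[/eqP -> //|/sX/XX].
  apply: contrapT => h; apply: nX' => w Tw.
  by apply: contrapT => nz; apply: h; exists w.
left; split=> // v Yv; split; first exact: (sp_m st').
by move=> c Dc; apply: XX'; apply: (sp_2 st').
Qed.

End Exists.

Section ND.
Variables (X Y : L -> Prop).
Hypotheses (U2 : (2%:R : k) \is a GRing.unit) (U3 : (3%:R : k) \is a GRing.unit).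
Hypothesis mXY : maximal_pair Tp Tm X Y.
Variables (c0 a0 : L).
Hypotheses (c0P : D2 c0) (c0n : c0 <> 0) (a0P : Dm a0) (a0n : a0 <> 0).

(* Such a [c] is a sandwich on [Tp + Tm] modulo [X + Y], for the normalizer of
   [X + Y]. The vectors killed by all sandwiches form a stable pair: by maximality
   it is everything, as it cannot be zero by nilpotency. *)
Lemma maximal_pair_nondegenerate c : D2 c ->
  (forall b t, Dm b -> Tm t -> X (c ∙ b ∙ c ∙ t)) -> forall t, Tm t -> X (c ∙ t).
Proof.
move=> Dc cbc; have sz := subm_zero L.
have Tpg := Tp_gen H c0P c0n; have Tmg := Tp_gen H' a0P a0n.
(* Degree 0 is cut down to the normalizer of [X + Y], so that [g] acts on the quotient; it still
   contains the brackets of degrees 2 and -2. *)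
pose h0 v := [/\ D0 v, forall x, X x -> X (v ∙ x) & forall y, Y y -> Y (v ∙ y)].
pose g : L -> Prop := span (fun v => D2 v \/ h0 v \/ Dm v).
pose M : L -> Prop := span (fun v => Tp v \/ Tm v).
pose M' : L -> Prop := span (fun v => X v \/ Y v).
have sg : subm g := span_subm _; have sM : subm M := span_subm _.
have sM' : subm M' := span_subm _.
have [sX sY] := (sp_subp mXY, sp_subm mXY).
have gI N : subm N -> (forall v, D2 v -> N v) -> (forall v, h0 v -> N v) ->
    (forall v, Dm v -> N v) -> forall v, g v -> N v.
  by move=> sN h2 hh h_ v; apply: span_min => // u; intuition.
have MI N : subm N -> (forall v, Tp v -> N v) -> (forall v, Tm v -> N v) ->
    forall v, M v -> N v.
  by move=> sN h2 hh v; apply: span_min => // u; intuition.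
have M'I N : subm N -> (forall v, X v -> N v) -> (forall v, Y v -> N v) ->
    forall v, M' v -> N v.
  by move=> sN h2 hh v; apply: span_min => // u; intuition.
have g2 v : D2 v -> g v by move=> ?; apply: mem_span; left.
have gh v : h0 v -> g v by move=> ?; apply: mem_span; right; left.
have g_ v : Dm v -> g v by move=> ?; apply: mem_span; do 2!right.
have Mp v : Tp v -> M v by move=> ?; apply: mem_span; left.
have Mm v : Tm v -> M v by move=> ?; apply: mem_span; right.
have M'p v : X v -> M' v by move=> ?; apply: mem_span; left.
have M'm v : Y v -> M' v by move=> ?; apply: mem_span; right.
have h2_ d a : D2 d -> Dm a -> h0 (d ∙ a).
  move=> Dd Da; split; first exact: (kl2_ H).
    move=> x Xx; rewrite lbr_jacobi (kl2p H Dd (sp_p mXY Xx)) br0r subr0.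
    by apply: (sp_2 mXY) => //; apply: (sp__ mXY).
  move=> y Yy; rewrite lbr_jacobi (klmu H Da (sp_m mXY Yy)) br0r add0r.
  by apply: submN => //; apply: (sp__ mXY) => //; apply: (sp_2 mXY).
have gg u v : g u -> g v -> g (u ∙ v).
  move=> gu; move: v; apply: (gI) => [|v Dv|v hv|v Dv]; first exact: subm_brr.
  - move: u gu; apply: (gI) => [|u Du|u [d0 _ _]|u Du]; first exact: subm_brl.
    + by rewrite (kl22 H) //; apply: subm0.
    + by apply: g2; apply: (kl02 H).
    + by rewrite brC; apply: submN => //; apply/gh/h2_.
  - have [d0 vX vY] := hv.
    move: u gu; apply: (gI) => [|u Du|u [e0 uX uY]|u Du]; first exact: subm_brl.
    + by apply: g2; apply: (kl20 H).
    + apply: gh; split=> [|x Xx|y Yy]; first exact: (kl00 H).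
        by rewrite lbr_jacobi; apply: submB; auto.
      by rewrite lbr_jacobi; apply: submB; auto.
    + by apply: g_; apply: (kl_0 H).
  - move: u gu; apply: (gI) => [|u Du|u [d0 _ _]|u Du]; first exact: subm_brl.
    + by apply/gh/h2_.
    + by apply: g_; apply: (kl0_ H).
    + by rewrite (kl__ H) //; apply: subm0.
have gM u v : g u -> M v -> M (u ∙ v).
  move=> gu; move: v; apply: (MI) => [|v Tv|v Tv]; first exact: subm_brr.
  - move: u gu; apply: (gI) => [|u Du|u [d0 _ _]|u Du]; first exact: subm_brl.
    + by rewrite (kl2p H) //; apply: subm0.
    + by apply: Mp; apply: (kl0p H).
    + by apply: Mm; apply: (kl_mp H).
  - move: u gu; apply: (gI) => [|u Du|u [d0 _ _]|u Du]; first exact: subm_brl.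
    + by apply: Mp; apply: (kl2m H).
    + by apply: Mm; apply: (kl0m H).
    + by rewrite (klmu H) //; apply: subm0.
have gM' u v : g u -> M' v -> M' (u ∙ v).
  move=> gu; move: v; apply: (M'I) => [|v Tv|v Tv]; first exact: subm_brr.
  - move: u gu; apply: (gI) => [|u Du|u [_ h _]|u Du]; first exact: subm_brl.
    + by rewrite (kl2p H) //; [apply: subm0 | apply: (sp_p mXY)].
    + by apply/M'p/h.
    + by apply: M'm; apply: (sp__ mXY).
  - move: u gu; apply: (gI) => [|u Du|u [_ _ h]|u Du]; first exact: subm_brl.
    + by apply: M'p; apply: (sp_2 mXY).
    + by apply/M'm/h.
    + by rewrite (klmu H) //; [apply: subm0 | apply: (sp_m mXY)].
have M'M u : M' u -> M u.
  by apply: (M'I) => // v; [move=> /(sp_p mXY)/Mp | move=> /(sp_m mXY)/Mm].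
have M'X v : M' v -> Tp v -> X v.
  move=> M'v Tv; have [x [y [Xx Yy e]]] : exists x y, [/\ X x, Y y & v = x + y].
    move: v M'v {Tv}; apply: (M'I) => [|v Tv|v Tv].
    - split=> [|a _ _ [p [b [Tp' Tb ->]]] [p' [b' [Tp1 Tb' ->]]]].
        by exists 0, 0; rewrite addr0; split=> //; apply: subm0.
      exists (a *: p + p'), (a *: b + b').
      by split; [apply: sX.2 | apply: sY.2|rewrite scalerDr; zmod].
    - by exists v, 0; rewrite addr0; split=> //; apply: subm0.
    - by exists 0, v; rewrite add0r; split=> //; apply: subm0.
  have y0 : y = 0.
    apply: (kl_direct H); last exact: (sp_m mXY).
    have -> : y = v - x by rewrite e; zmod.
    by apply: submB; [exact: kl_subp H | | exact: (sp_p mXY)].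
  by rewrite e y0 addr0.
pose C := sandwich g M M'.
have Cc : C c.
  have cg : g c by apply: g2.
  split=> // [|v m gv].
    apply: (MI) => [|v Tv|v Tv]; first exact: (subm_brr _ (subm_brr _ sM')).
      by rewrite (kl2p H Dc Tv) br0r; apply: subm0.
    by rewrite (kl2p H Dc (kl2m H Dc Tv)); apply: subm0.
  move: m; apply: (MI) => [|m Tm'|m Tm'].
  - exact: (subm_brr _ (subm_brr _ (subm_brr _ sM'))).
  - by rewrite (kl2p H Dc Tm') !br0r; apply: subm0.
  have Tcm := kl2m H Dc Tm'.
  move: v gv; apply: (gI) => [|v Dv|v [d0 _ _]|v Dv].
  - exact: (subm_brl _ (subm_brr _ sM')).
  - by rewrite (kl2p H Dv Tcm) br0r; apply: subm0.
  - by rewrite (kl2p H Dc (kl0p H d0 Tcm)); apply: subm0.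
  - by apply/M'p/cbc.
have cube v : D2 v \/ Dm v -> (forall u, g u -> v ∙ v ∙ v ∙ u = 0) /\
    (forall u, M u -> v ∙ v ∙ v ∙ u = 0).
  have s3 := subm_brr v (subm_brr v (subm_brr v sz)).
  case=> Dv; split.
  - apply: (gI) => // u; first by move=> Du; rewrite (kl22 H Dv Du) !br0r.
      by case=> d0 _ _; rewrite (kl22 H Dv (kl20 H d0 Dv)) br0r.
    by move=> Du; apply: (kl22 H) => //; apply: (kl20 H) => //; apply: (kl2_ H).
  - apply: (MI) => // u Tu; first by rewrite (kl2p H Dv Tu) !br0r.
    by rewrite (kl2p H Dv (kl2m H Dv Tu)) br0r.
  - apply: (gI) => // u; last by move=> Du; rewrite (kl__ H Dv Du) !br0r.
      by move=> Du; apply: (kl__ H) => //; apply: (kl_0 H) => //; apply: (kl_2 H).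
    by case=> d0 _ _; rewrite (kl__ H Dv (kl_0 H d0 Dv)) br0r.
  - apply: (MI) => // u Tu; last by rewrite (klmu H Dv Tu) !br0r.
    by rewrite (klmu H Dv (kl_mp H Dv Tu)) br0r.
have Cad v d : D2 v \/ Dm v -> C d -> span C (v ∙ d).
  move=> hv Cd; have gv : g v by case: hv; auto.
  by have [c1 c2] := cube v hv; apply: sandwich_ad.
have CC a b : C a -> C b -> C (a ∙ b) by apply: sandwich_br.
pose K := upper M M' C.
have [n up] : exists n, forall m, M m -> K n m.
  apply: (@jacobson _ _ g M M' sM sM' gM gM' M'M C es fL gen) => //.
  - by move=> ? [].
  - by move=> d m [_ h _]; apply: h.
have sK : subm (K 1%N) by apply: upper_subm.
have KV v m : D2 v \/ Dm v -> K 1%N m -> K 1%N (v ∙ m).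
  move=> hv [Mm' Km]; have gv : g v by case: hv; auto.
  split=> [|d Cd]; first exact: gM.
  have -> : d ∙ v ∙ m = v ∙ d ∙ m - (v ∙ d) ∙ m by rewrite lbr_jacobi; zmod.
  apply: submB => //; first by apply: gM' => //; apply: Km.
  have := Cad v d hv Cd; apply: (span_min (N := fun e => M' (e ∙ m))) => //.
  exact: subm_brl.
(* The projections of [K 1] to degrees 1 and -1. They are stable because an element of degree 2 or
   -2 kills one of the two components. *)
pose X' p := Tp p /\ exists b, Tm b /\ K 1%N (p + b).
pose Y' b := Tm b /\ exists p, Tp p /\ K 1%N (p + b).
have [sTp sTm] := (kl_subp H, kl_subm H).
have cpb d p b : D2 d -> Tp p -> d ∙ (p + b) = d ∙ b.
  by move=> Dd Tp'; rewrite brDr (kl2p H Dd Tp') add0r.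
have apb d p b : Dm d -> Tm b -> d ∙ (p + b) = d ∙ p.
  by move=> Dd Tp'; rewrite brDr (klmu H Dd Tp') addr0.
have comb (a : k) (p p' b b' : L) :
    a *: p + p' + (a *: b + b') = a *: (p + b) + (p' + b').
  by rewrite scalerDr; zmod.
have st : stable_pair Tp Tm X' Y'.
  split; [| |by move=> ? []|by move=> ? []| |].
  - split=> [|a p p' [Tp' [b [Tb Kb]]] [Tp1 [b' [Tb' Kb']]]].
      by split; [apply: subm0|exists 0; rewrite addr0; split; apply: subm0].
    split; first by apply: sTp.2.
    by exists (a *: b + b'); split; [apply: sTm.2 | rewrite comb; apply: sK.2].
  - split=> [|a b b' [Tp' [p [Tb Kb]]] [Tp1 [p' [Tb' Kb']]]].
      by split; [apply: subm0|exists 0; rewrite addr0; split; apply: subm0].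
    split; first by apply: sTm.2.
    by exists (a *: p + p'); split; [apply: sTp.2 | rewrite comb; apply: sK.2].
  - move=> d b Dd [Tb [p [Tp' Kp]]]; split; first exact: (kl2m H).
    exists 0; split; first exact: subm0.
    by rewrite addr0 -(cpb d p) //; apply: KV; auto.
  - move=> d p Dd [Tp' [b [Tb Kb]]]; split; first exact: (kl_mp H).
    exists 0; split; first exact: subm0.
    by rewrite add0r -(apb d p b) //; apply: KV; auto.
have M'K m : M' m -> K 1%N m.
  by move=> h; split=> [|d [gd _ _]]; [apply: M'M | apply: gM'].
case: (mp_max mXY st).
- move=> u Xu; split; first exact: (sp_p mXY).
  by exists 0; rewrite addr0; split; [apply: subm0 | apply/M'K/M'p].
- move=> u Xu; split; first exact: (sp_m mXY).
  by exists 0; rewrite add0r; split; [apply: subm0 | apply/M'K/M'm].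
(* Here [K 1] is no larger than [M'], so the upper series never leaves [M'], and nilpotency
   contradicts properness. *)
- move=> [hX hY]; have M1 m : K 1%N m -> M' m.
    move=> Km; have [p [b [Tp' Tb e]]] : exists p b, [/\ Tp p, Tm b & m = p + b].
      have := upper_sub M'M Km; apply: (MI (fun m => exists p b, [/\ Tp p, Tm b & m = p + b])).
      + split=> [|a _ _ [p [b [Tp' Tb ->]]] [p' [b' [Tp1 Tb' ->]]]].
          by exists 0, 0; rewrite addr0; split=> //; apply: subm0.
        exists (a *: p + p'), (a *: b + b').
        by rewrite comb; split; [apply: sTp.2 | apply: sTm.2|].
      + by move=> v Tv; exists v, 0; rewrite addr0; split=> //; apply: subm0.
      + by move=> v Tv; exists 0, v; rewrite add0r; split=> //; apply: subm0.
    rewrite e in Km *; apply: submD => //.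
      by apply/M'p/hX; split=> //; exists b.
    by apply/M'm/hY; split=> //; exists p.
  have MM' m : M m -> M' m.
    move=> /up; elim: (n) m => // i IHi m [Mm' h]; apply: M1; split=> // d Cd.
    by apply: IHi; apply: h.
  by have [u [Tu []]] := mp_properp mXY; apply: (M'X) => //; apply: MM'; apply: Mp.
(* Here [Tm] is spanned by elements [a ∙ p], each equal to [a ∙ (p + b)] with [p + b] in [K 1]; so
   all of [Tm] lies in [K 1]. *)
- move=> [hX hY] t Tt.
  have [_ h] : K 1%N t.
    move: t Tt => t /Tmg; apply: brspan_ind => // a p Da /hX[Tp' [b [Tb Kb]]].
    by rewrite -(apb a p b) //; apply: KV; auto.
  by apply: (M'X); [exact: h | exact: (kl2m H)].
Qed.

End ND.
End MaxPair.

(** * Elements of degree 2 acting trivially on a simple quotient *)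

Section Words.
Variables (k : comUnitRingType) (L : lieAlg k) (Tp Tm : L -> Prop).
Hypothesis H : kantor_lie Tp Tm.
Notation D2 := (brspan Tp Tp).
Notation D0 := (brspan Tp Tm).
Notation Dm := (brspan Tm Tm).

Lemma kl_tripleC c b d : D2 c -> D2 d -> c ∙ b ∙ d = d ∙ b ∙ c.
Proof.
move=> Dc Dd; rewrite brA (kl22 H Dc Dd) br0r addr0.
by rewrite brC -brNr -brC.
Qed.

(** [c ∙ b ∙ d] is the Jordan triple product of the pair of degrees 2 and -2. Of the four words of
    the double commutator, one contains [b ∙ t = 0] and one applies two elements of degree 2 in a
    row. *)
Lemma kl_word c b d t : D2 c -> Dm b -> D2 d -> Tm t ->
  (c ∙ b ∙ d) ∙ t = c ∙ b ∙ d ∙ t + d ∙ b ∙ c ∙ t.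
Proof.
move=> Dc Db Dd Tt; rewrite !lieE (klmu H Db Tt) !br0r.
by rewrite (kl2p H Dd (kl2m H Dc Tt)) br0r; zmod.
Qed.

Lemma kl_der (d c b e : L) :
  d ∙ c ∙ b ∙ e = (d ∙ c) ∙ b ∙ e + c ∙ (d ∙ b) ∙ e + c ∙ b ∙ d ∙ e.
Proof. by rewrite (brA d c) (brA d b) brDr addrA. Qed.

Lemma kl_square c b e : D2 c -> Tm b -> Tm e ->
  ((c ∙ b) ∙ (c ∙ e)) *+ 2 = c ∙ c ∙ (b ∙ e).
Proof.
move=> Dc Tb Te; rewrite (brA c b e) brDr (brA c (c ∙ b) e).
rewrite (kl2p H Dc (kl2m H Dc Tb)) br0l add0r.
by rewrite (brA c b (c ∙ e)) (kl2p H Dc (kl2m H Dc Te)) br0r; zmod.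
Qed.

End Words.

Section Stabilizer.
Variables (k : comUnitRingType) (L : lieAlg k) (Tp Tm X Y : L -> Prop).
Hypothesis H : kantor_lie Tp Tm.
Hypothesis st : stable_pair Tp Tm X Y.
Notation D2 := (brspan Tp Tp).
Notation D0 := (brspan Tp Tm).
Notation Dm := (brspan Tm Tm).

Definition inner_part c := D2 c /\ forall t, Tm t -> X (c ∙ t).
Notation G := inner_part.

Lemma inner_subm : subm G.
Proof.
apply: subm_and; first exact: brspan_subm.
by do 2!apply: subm_all => ?; apply: (subm_brl _ (sp_subp st)).
Qed.

Lemma inner_triple c b f : D2 c -> Dm b -> G f -> G (c ∙ b ∙ f).
Proof.
move=> Dc Db [Df Xf]; split=> [|t Tt].
  by apply: (kl20 H) => //; apply: (kl_2 H).
rewrite (kl_word H) //; apply: (submD (sp_subp st)).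
  by apply: (sp_2 st) => //; apply: (sp__ st) => //; apply: Xf.
by apply: Xf; apply: (kl_mp H) => //; apply: (kl2m H).
Qed.

Lemma inner_tripler c b f : D2 c -> Dm b -> G f -> G (f ∙ b ∙ c).
Proof. by move=> Dc Db Gf; rewrite (kl_tripleC H) //; [apply: inner_triple | case: Gf]. Qed.

(** Each term of the Leibniz rule keeps an undifferentiated [f]. Products with two factors in [G]
    may thus be differentiated; for single elements of [G] this is the goal, [inner_stable]. *)
Lemma inner_der d f b : D0 d -> G f -> Dm b -> G (d ∙ f ∙ b ∙ f).
Proof.
move=> d0 Gf Db; have [Df _] := Gf; rewrite kl_der.
have sG := inner_subm; apply: (submD sG); first apply: (submD sG).
- by apply: inner_triple => //; apply: (kl02 H).
- by apply: inner_triple => //; apply: (kl0_ H).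
- by apply: inner_tripler => //; apply: (kl02 H).
Qed.

(** * The cube of [l ∙ f] in the Jordan homotope at [a], for [l = x ∙ a ∙ x] *)

Section Computation.
Hypotheses (U2 : (2%:R : k) \is a GRing.unit) (U3 : (3%:R : k) \is a GRing.unit).
Variables (x a y l : L).
Hypotheses (Tx : Tp x) (Da : Dm a) (yE : y = a ∙ x) (lE : l = x ∙ y).

Let Ty : Tm y. Proof. by rewrite yE; apply: (kl_mp H). Qed.
Let l0 : D0 l. Proof. by rewrite lE; apply: klpm. Qed.
Let sX := sp_subp st.
Let sG := inner_subm.

Let x2 c v : D2 c -> x ∙ c ∙ v = c ∙ x ∙ v.
Proof. by move=> Dc; rewrite brA (klp2 H Dc Tx) br0l add0r. Qed.

Let x2y c : D2 c -> x ∙ c ∙ y = - (l ∙ c).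
Proof. by move=> Dc; rewrite x2 // -lE brC. Qed.

Let ad_x_ad_a c : D2 c -> x ∙ a ∙ c ∙ y = (c ∙ y) ∙ y - a ∙ l ∙ c.
Proof.
move=> Dc; rewrite brA x2y // brNr [x ∙ a]brC -yE brNl.
by rewrite [y ∙ _]brC opprK.
Qed.

(* [gam (l ∙ f) f], for [l = x ∙ a ∙ x], is computed in two ways below. *)
Definition gam c f := (f ∙ y) ∙ (c ∙ y).
Let Dg f := (f ∙ y) ∙ y.

Let gamN c f : gam c f = - gam f c. Proof. exact: brC. Qed.

Let gamE c f : D2 c -> D2 f -> gam c f = c ∙ (f ∙ y) ∙ y.
Proof. by move=> Dc Df; rewrite brA (kl2p H Dc (kl2m H Df Ty)) br0l add0r. Qed.

Let gamD c f : D2 c -> D2 f -> gam c f = - (Dg f ∙ c).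
Proof. by move=> Dc Df; rewrite gamE // brC. Qed.

Let gam_shift c f : D2 c -> D2 f -> x ∙ c ∙ a ∙ f ∙ y = gam c f - c ∙ a ∙ l ∙ f.
Proof. by move=> Dc Df; rewrite x2 // ad_x_ad_a // brDr brNr gamE. Qed.

Let gam_inner_triple v b f : D2 v -> Dm b -> G f -> G (gam (v ∙ b ∙ f) f).
Proof.
move=> Dv Db Gf; have [Df _] := Gf.
have D0g : D0 (Dg f) by apply: klpm => //; apply: (kl2m H).
have Dvb : D2 (v ∙ b ∙ f) by apply: (kl20 H) => //; apply: (kl_2 H).
rewrite gamD //; apply: (submN sG); rewrite kl_der.
have -> : Dg f ∙ f = 0.
  by apply: oppr_inj; rewrite -gamD // /gam lbr_alt oppr0.
rewrite !br0r addr0; apply: (submD sG); apply: inner_triple => //.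
  exact: (kl02 H).
exact: (kl0_ H).
Qed.

(** With [z = f ∙ y], the element [x ∙ (z ∙ y) ∙ z] is congruent modulo [G] to three times [T3] by
    the Leibniz rule, and to minus three times [T3] when [z ∙ y] is first rewritten by
    [ad_x_ad_a]. *)
Lemma inner_gam f : G f -> G (gam (l ∙ f) f).
Proof.
move=> Gf; have [Df Xf] := Gf.
have [g gE] : exists g, g = l ∙ f by eexists.
rewrite -gE; have Dg2 : D2 g by rewrite gE; apply: (kl02 H).
set z := f ∙ y; have Tz : Tp z by apply: (kl2m H).
set z2 := a ∙ z; have Tz2 : Tm z2 by apply: (kl_mp H).
set w := l ∙ y; have Tw : Tm w by apply: (kl0m H).
set F := f ∙ a ∙ f; have DF : D2 F by apply: (kl20 H) => //; apply: (kl_2 H).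
set T3 := gam g f.
have xz : x ∙ z = - g by rewrite /z x2y // -gE.
have way1 : G (x ∙ (z ∙ y) ∙ z - T3 *+ 3).
  have e2 : x ∙ (z ∙ y) = - (g ∙ y) - l ∙ z.
    by rewrite brA xz -lE brNl [z ∙ l]brC.
  have e3 : (z ∙ y) ∙ g = - T3 by rewrite brC -gamE // opprK.
  rewrite brA e2 xz brNr e3.
  have e4 : l ∙ z = g ∙ y + f ∙ w by rewrite /z brA -gE.
  rewrite e4 !(brDl, brNl) -/T3.
  have e5 : (g ∙ y) ∙ z = - T3 by exact: brC.
  rewrite e5 [(f ∙ w) ∙ z]brC (_ : _ - _ = z ∙ (f ∙ w)); last by zmod.
  apply: (submMnK U2 sG); rewrite (kl_square H) //.
  rewrite [f ∙ y ∙ w]brC brNr; apply: (submN sG).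
  by apply: inner_triple => //; exact: klmm.
have way2 : G (x ∙ (z ∙ y) ∙ z + T3 *+ 3).
  set h := y ∙ z2; have Dh : Dm h by apply: klmm.
  have Ga : a ∙ g ∙ y = (a ∙ g) ∙ y by rewrite lbr_jacobi (klmu H Da Ty) br0r subr0.
  have hx : h ∙ x = a ∙ g ∙ y.
    have h2 : h *+ 2 = - (a ∙ a ∙ g).
      by rewrite /h yE (kl_square (kantor_lie_swap H)) // xz !brNr.
    apply: (mulrn_injU U2); rewrite -brMnl h2 brNl (lbr_jacobi a (a ∙ g)).
    rewrite (lbr_jacobi a g) (kl2p H Dg2 Tx) br0r -yE sub0r brNr -Ga; zmod.
  have e1 : z ∙ y = x ∙ z2 + a ∙ g.
    by rewrite /z2 /z ad_x_ad_a // -gE subrK.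
  have e2 : (z ∙ y) ∙ z = x ∙ z2 ∙ z - (g ∙ z2) *+ 2.
    rewrite e1 brDl (lbr_jacobi x) (lbr_jacobi a) xz (kl2p H Dg2 Tz) br0r brNr [z2 ∙ g]brC -/z2.
    zmod.
  have e3 : F ∙ y = (f ∙ z2) *+ 2.
    by rewrite /F (kl_word H) //; zmod.
  have e4 : (z2 ∙ z) *+ 2 = y ∙ F ∙ y - (f ∙ h) *+ 2.
    rewrite {1}/z brA [z2 ∙ y]brC [z2 ∙ f]brC -/h brNl brNr.
    by rewrite [y ∙ F ∙ y]brC e3 brMnl; zmod.
  have e5 : x ∙ y ∙ F ∙ y = ((l ∙ F) ∙ y) *+ 2 + F ∙ w.
    rewrite brA -lE x2y // brNr [y ∙ _ ∙ _]brC opprK (brA l F y) -/w; zmod.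
  have lF : l ∙ F = (f ∙ a ∙ g) *+ 2 + f ∙ (l ∙ a) ∙ f.
    by rewrite /F kl_der -gE (kl_tripleC H a Dg2 Df); zmod.
  have e6 : ((z ∙ y) ∙ z) *+ 2 = (f ∙ a ∙ g ∙ y) *+ 6
      + ((f ∙ (l ∙ a) ∙ f) ∙ y) *+ 2 + F ∙ w.
    rewrite e2 mulrnBl -(brMnr x) e4 brDr brNr brMnr e5 lF brDl brMnl (x2 h Df).
    rewrite [x ∙ h]brC hx brNr (kl_word H Df Da Dg2 Ty) -/z -/z2; zmod.
  set F1 := f ∙ (l ∙ a) ∙ f.
  have Dla : Dm (l ∙ a) by apply: (kl0_ H).
  have DF1 : D2 F1 by apply: (kl20 H) => //; apply: (kl_2 H).
  apply: (submMnK U2 sG).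
  have xlin A B C n m : x ∙ (A *+ n + B *+ m + C) = (x ∙ A) *+ n + (x ∙ B) *+ m + x ∙ C.
    by rewrite !brDr !brMnr.
  rewrite mulrnDl -(brMnr x) e6 xlin (x2y DF1) (gam_shift Df Dg2) (x2 w DF).
  rewrite (gamN f g) -/T3 [F ∙ _]brC.
  rewrite (_ : _ + _ = - ((f ∙ a ∙ l ∙ g) *+ 6 + (l ∙ F1) *+ 2 + (x ∙ w) ∙ F)); last by zmod.
  apply: (submN sG); apply: (submD sG); first apply: (submD sG).
  - by apply: (submMn _ sG); apply: inner_tripler => //; apply: (kl02 H).
  - by apply: (submMn _ sG); apply: inner_der.
  - by apply: inner_der => //; apply: klpm.
suff : G (T3 *+ 2 *+ 3) by move/(submMnK U3 sG)/(submMnK U2 sG).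
rewrite (_ : _ *+ 3 = (x ∙ (z ∙ y) ∙ z + T3 *+ 3) - (x ∙ (z ∙ y) ∙ z - T3 *+ 3)).
  exact: submB.
by zmod.
Qed.

(** Linearization of [inner_gam] at [f] and [f' = (l ∙ f) ∙ a ∙ f]. In the Leibniz expansion of
    [l ∙ f'], the two terms with an undifferentiated [f] are covered by [gam_inner_triple]. *)
Lemma inner_gam_cubic f : G f -> G (gam ((l ∙ f) ∙ a ∙ l ∙ f) f).
Proof.
move=> Gf; have [Df Xf] := Gf; have Dg2 := kl02 H l0 Df.
have Gf' : G ((l ∙ f) ∙ a ∙ f) by apply: inner_triple.
have T3 := inner_gam Gf; have T3' := inner_gam Gf'.
have := inner_gam (submD sG Gf Gf'); rewrite /gam brDr !(brDl, brDr).
rewrite -!/(gam _ _) => h.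
set f' := (l ∙ f) ∙ a ∙ f in Gf' T3' h *; have [Df' _] := Gf'.
have h1 : G (gam (l ∙ f) f' + gam (l ∙ f') f).
  rewrite (_ : _ + _ = gam (l ∙ f) f + gam (l ∙ f') f +
    (gam (l ∙ f) f' + gam (l ∙ f') f') - gam (l ∙ f) f - gam (l ∙ f') f'); last by zmod.
  by do 2!apply: (submB sG) => //.
have h2 : G (gam (l ∙ f) f').
  rewrite gamN gamD // opprK /f' kl_der.
  have Dgg : D0 (Dg (l ∙ f)) by apply: klpm => //; apply: (kl2m H).
  apply: (submD sG); first apply: (submD sG).
  - by apply: inner_triple => //; apply: (kl02 H).
  - by apply: inner_triple => //; apply: (kl0_ H).
  - by apply: inner_triple => //; rewrite -[_ ∙ f]opprK -gamD // -gamN.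
have := submB sG h1 h2; rewrite [_ + _ - _]addrC addKr /f' kl_der.
rewrite /gam !(brDl, brDr) -!/(gam _ _) => h3.
have -> : gam ((l ∙ f) ∙ a ∙ l ∙ f) f = (gam ((l ∙ l ∙ f) ∙ a ∙ f) f +
    gam ((l ∙ f) ∙ (l ∙ a) ∙ f) f + gam ((l ∙ f) ∙ a ∙ l ∙ f) f)
    - gam ((l ∙ l ∙ f) ∙ a ∙ f) f - gam ((l ∙ f) ∙ (l ∙ a) ∙ f) f by zmod.
apply: (submB sG); first apply: (submB sG) => //.
  by apply: gam_inner_triple => //; apply: (kl02 H).
by apply: gam_inner_triple => //; apply: (kl0_ H).
Qed.

(** Up to a scalar this is the cube of [g = l ∙ f] for the Jordan product [c ∙ a ∙ d]. It equals
    four times [g ∙ a ∙ T] minus twice [Q], where [T] and [Q] lie in [G] by the two preceding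
    lemmas. *)
Lemma inner_pentad f : G f -> G ((l ∙ f) ∙ a ∙ (l ∙ f) ∙ a ∙ l ∙ f).
Proof.
move=> Gf; have [Df Xf] := Gf; have T3 := inner_gam Gf; have Gs2 := inner_gam_cubic Gf.
move: T3 Gs2; have [g gE] : exists g, g = l ∙ f by eexists.
rewrite -gE; have Dg2 : D2 g by rewrite gE; apply: (kl02 H).
have xz : x ∙ f ∙ y = - g by rewrite x2y // -gE.
have e1 : (f ∙ y) ∙ y = x ∙ a ∙ f ∙ y + a ∙ g by rewrite ad_x_ad_a // -gE subrK.
have [z zE] : exists z, z = f ∙ y by eexists.
have [p pE] : exists p, p = a ∙ g ∙ y by eexists.
have [q qE] : exists q, q = g ∙ a ∙ z by eexists.
have [s2 sE] : exists s2, s2 = g ∙ a ∙ g by eexists.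
have [Q QE] : exists Q, Q = gam s2 f by eexists.
have [T TE] : exists T, T = gam g f by eexists.
rewrite -sE -QE -TE => GT GQ.
have Tz : Tp z by rewrite zE; apply: (kl2m H).
have Tp' : Tm p by rewrite pE; apply: (kl_mp H) => //; apply: (kl2m H).
have Taz : Tm (a ∙ z) by apply: (kl_mp H).
have Tq : Tp q by rewrite qE; apply: (kl2m H).
have Ds : D2 s2 by rewrite sE; apply: (kl20 H) => //; apply: (kl_2 H).
have g2z u v : Tp u -> u ∙ g ∙ v = g ∙ u ∙ v.
  by move=> Tu; rewrite brA (klp2 H Dg2 Tu) br0l add0r.
have f1 : Q = (g ∙ z ∙ p) *+ 2.
  rewrite QE /gam -zE sE (kl_word H) // -pE !brDr g2z //; zmod.
have Tgy : Tp (g ∙ y) by apply: (kl2m H).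
have zT : z ∙ (g ∙ y) = T by rewrite TE /gam zE.
have gzy : g ∙ z ∙ y = T by rewrite TE gamE // zE.
have DT : D2 T by case: GT.
have f2 : g ∙ z ∙ p = - (q ∙ (g ∙ y)) + g ∙ a ∙ T.
  rewrite {1}pE (brA z) zT brDr [z ∙ a]brC brNl brNr (brA g (a ∙ z)) -qE.
  by rewrite (kl2p H Dg2 Tgy) br0r addr0.
have f3 : q ∙ x = s2 - T.
  rewrite qE lbr_jacobi (kl2p H Dg2 Tx) br0r subr0 [_ ∙ x]brC.
  have -> : x ∙ a ∙ z = z ∙ y - a ∙ g by rewrite zE e1 addrK.
  by rewrite brNr brDr brNr gzy -sE; zmod.
have f4 : g ∙ y = (g ∙ a) ∙ x.
  by rewrite lbr_jacobi (kl2p H Dg2 Tx) br0r subr0 -yE.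
have f5 : q ∙ (g ∙ y) = g ∙ x ∙ a ∙ q + g ∙ a ∙ s2 - g ∙ a ∙ T.
  rewrite f4 (brA q) f3 brDr brNr (lbr_jacobi g a s2) (lbr_jacobi g a T).
  rewrite (kl22 H Dg2 Ds) (kl22 H Dg2 DT) br0r [q ∙ g ∙ a]brC brNl.
  rewrite (lbr_jacobi g a q) (kl2p H Dg2 Tq) br0r subr0 (lbr_jacobi g _ x).
  by rewrite (kl2p H Dg2 Tx) br0r [(a ∙ q) ∙ x]brC brNr; zmod.
have f6 : (g ∙ x ∙ a ∙ q) *+ 2 = Q - g ∙ (a ∙ g ∙ a) ∙ g.
  have w u : Tp u -> (a ∙ g ∙ a) ∙ u = (a ∙ g ∙ a ∙ u) *+ 2.
    by move=> Tu; rewrite (kl_word (kantor_lie_swap H)) //; zmod.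
  rewrite -(brMnr g) -(brMnr x) {1}qE -w // (brA x) zE xz [x ∙ _ ∙ _ ∙ _]brC w // -yE -pE -zE.
  by rewrite brNl brMnl [p ∙ z]brC brDr !brNr brMnr brNr f1; zmod.
have f7 : g ∙ (a ∙ g ∙ a) ∙ g = g ∙ a ∙ s2.
  congr (_ ∙ _); rewrite lbr_jacobi [a ∙ g]brC brNr lbr_alt !oppr0 addr0 sE.
  by rewrite [(g ∙ a) ∙ g]brC [a ∙ g]brC !brNr.
have -> : g ∙ a ∙ s2 = (g ∙ a ∙ T) *+ 4 - Q *+ 2.
  have E : Q = - ((g ∙ x ∙ a ∙ q) *+ 2) - (g ∙ a ∙ s2) *+ 2 + (g ∙ a ∙ T) *+ 4.
    by rewrite f1 f2 f5; zmod.
  by rewrite f6 f7 in E; rewrite mulr2n {1}E; zmod.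
apply: (submB sG); apply: (submMn _ sG) => //; exact: inner_triple.
Qed.

End Computation.

(** * From nilpotency modulo the kernel to stability under degree 0 *)

Section Descent.
Hypotheses (U2 : (2%:R : k) \is a GRing.unit) (U3 : (3%:R : k) \is a GRing.unit).
Hypothesis ndX : forall c, D2 c ->
  (forall b t, Dm b -> Tm t -> X (c ∙ b ∙ c ∙ t)) -> forall t, Tm t -> X (c ∙ t).
Hypothesis ndY : forall a, Dm a ->
  (forall c u, D2 c -> Tp u -> Y (a ∙ c ∙ a ∙ u)) -> forall u, Tp u -> Y (a ∙ u).
Let sX := sp_subp st.
Let sY := sp_subm st.
Let sG := inner_subm.
Let word_m a c b u : Dm a -> D2 c -> Dm b -> Tp u ->
  (a ∙ c ∙ b) ∙ u = a ∙ c ∙ b ∙ u + b ∙ c ∙ a ∙ u.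
Proof. by move=> *; apply: (kl_word (kantor_lie_swap H)). Qed.

Section Quintic.
Variables (x a : L).
Hypotheses (Tx : Tp x) (Da : Dm a).
Notation l := (x ∙ a ∙ x).

(** The submodule [G + l ∙ G]. It absorbs triple products, as the Leibniz rule leaves errors in [G]
    only. *)
Let N s := D2 s /\ exists f, G f /\ G (s - l ∙ f).

Let l0 : D0 l. Proof. by apply: klpm => //; apply: (kl_mp H). Qed.

Let sN : subm N.
Proof.
split=> [|b u v [Du [f [Gf Gu]]] [Dv [f' [Gf' Gv]]]].
  split; first by apply: subm0; apply: brspan_subm.
  by exists 0; split; [apply: subm0 | rewrite br0r subr0; apply: subm0].
split; first by apply: (brspan_subm _ _).2.
exists (b *: f + f'); split; first by apply: sG.2.
rewrite lbr_linearr (_ : _ - _ = b *: (u - l ∙ f) + (v - l ∙ f')); first exact: sG.2.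
by rewrite scalerBr; zmod.
Qed.

Let N2 s : N s -> D2 s. Proof. by case. Qed.

Let N_triple s b c : N s -> Dm b -> D2 c -> N (s ∙ b ∙ c).
Proof.
move=> [Ds [f [Gf Gs]]] Db Dc; split.
  by apply: (kl20 H) => //; apply: (kl_2 H).
exists (f ∙ b ∙ c); split; first exact: inner_tripler.
rewrite kl_der (_ : _ - _ = (s - l ∙ f) ∙ b ∙ c - f ∙ (l ∙ b) ∙ c - f ∙ b ∙ l ∙ c).
  apply: (submB sG); first apply: (submB sG).
  - exact: inner_tripler.
  - by apply: inner_tripler => //; apply: (kl0_ H).
  - by apply: inner_tripler => //; apply: (kl02 H).
by rewrite brDl brNl; zmod.
Qed.

Let wX c b u : D2 c -> Dm b -> X u -> X (c ∙ b ∙ u).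
Proof. by move=> Dc Db Xu; apply: (sp_2 st) => //; apply: (sp__ st). Qed.

Let wT c b t : D2 c -> Dm b -> Tm t -> Tm (b ∙ c ∙ t).
Proof. by move=> Dc Db Xu; apply: (kl_mp H) => //; apply: (kl2m H). Qed.

(* From here on, iterated brackets such as [s ∙ a ∙ s ∙ t] are words in operators
   on [Tp + Tm] modulo [X + Y]; a word with a factor in [G] vanishes. *)
Let quintic_word s t : N s -> Tm t -> X (s ∙ a ∙ s ∙ a ∙ s ∙ t).
Proof.
move=> [Ds [f [Gf Gs]]] Tt.
have := inner_pentad U2 U3 Tx Da (erefl _) (erefl _) Gf.
have : D2 (l ∙ f) by apply: (kl02 H) => //; case: Gf.
move: (l ∙ f) Gs => g Gs Dg Gg.
have D3 c : D2 c -> D2 (c ∙ a ∙ c).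
  by move=> Dc; apply: (kl20 H) => //; apply: (kl_2 H).
have [_ h] : G (s ∙ a ∙ s ∙ a ∙ s).
  rewrite (_ : _ ∙ _ = (s - g) ∙ a ∙ s ∙ a ∙ s + g ∙ a ∙ (s - g) ∙ a ∙ s
     + g ∙ a ∙ g ∙ a ∙ (s - g) + g ∙ a ∙ g ∙ a ∙ g); last first.
    by rewrite !(brDr, brNr, brDl, brNl); zmod.
  apply: (submD sG) => //; apply: (submD sG); first apply: (submD sG).
  - by apply: inner_tripler => //; apply: D3.
  - by apply: inner_triple => //; apply: inner_tripler.
  - by do 2!apply: inner_triple => //.
do 2!apply: (submMnK U2 sX); have := h t Tt.
have e u : Tm u -> (s ∙ a ∙ s) ∙ u = (s ∙ a ∙ s ∙ u) *+ 2.
  by move=> Tu; rewrite (kl_word H) //; zmod.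
rewrite (kl_word H Ds Da (D3 s Ds) Tt) (e t Tt) (e _ (wT Ds Da Tt)).
by congr X; rewrite !brMnr; zmod.
Qed.

Let quintic_word_polar s r t : N s -> N r -> Tm t ->
  X (r ∙ a ∙ s ∙ a ∙ s ∙ t + s ∙ a ∙ r ∙ a ∙ s ∙ t + s ∙ a ∙ s ∙ a ∙ r ∙ t).
Proof.
move=> Ns Nr Tt; apply: (submMnK U2 sX).
have h1 := quintic_word (submD sN Ns Nr) Tt; have h2 := quintic_word (submB sN Ns Nr) Tt.
have h3 := submMn 2 sX (quintic_word Nr Tt).
move: (submB sX (submB sX h1 h2) h3); congr X.
by rewrite !(brDr, brDl, brNl, brNr); zmod.
Qed.

(** Take [r = s ∙ b ∙ s] in the polarized quintic: the outer terms vanish by [quintic_word], and the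
    middle one, the word s a s b s a s, is what [ndX] tests on [s ∙ a ∙ s]. *)
Let cubic_word s t : N s -> Tm t -> X (s ∙ a ∙ s ∙ t).
Proof.
move=> Ns Tt; have Ds := N2 Ns.
have Dc : D2 (s ∙ a ∙ s) by case: (N_triple Ns Da Ds).
have e u : Tm u -> (s ∙ a ∙ s) ∙ u = (s ∙ a ∙ s ∙ u) *+ 2.
  by move=> Tu; rewrite (kl_word H) //; zmod.
apply: (submMnK U2 sX); rewrite -e //; apply: ndX => // {Tt}b {}t Db Tt.
have Nr := N_triple Ns Db Ds.
have er u : Tm u -> (s ∙ b ∙ s) ∙ u = (s ∙ b ∙ s ∙ u) *+ 2.
  by move=> Tu; rewrite (kl_word H) //; zmod.
have Tst : Tm (a ∙ s ∙ t) := wT Ds Da Tt.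
have Tsst : Tm (a ∙ s ∙ a ∙ s ∙ t) := wT Ds Da Tst.
have Tbst : Tm (b ∙ s ∙ t) := wT Ds Db Tt.
have h1 : X ((s ∙ b ∙ s ∙ a ∙ s ∙ a ∙ s ∙ t) *+ 2).
  by apply: (submMn 2 sX); apply: (wX) => //; apply: (quintic_word).
have h2 := submMn 2 sX (quintic_word Ns Tbst).
have := quintic_word_polar Ns Nr Tt; rewrite !er // !brMnr => h3.
have := submB sX (submB sX h3 h1) h2.
rewrite (e t Tt) !brMnr (e _ (wT Ds Db Tst)).
by move=> /(submMn 2 sX); congr X; zmod.
Qed.

Let cubic_word_polar s r t : N s -> N r -> Tm t -> X (s ∙ a ∙ r ∙ t + r ∙ a ∙ s ∙ t).
Proof.
move=> Ns Nr Tt; have := cubic_word (submD sN Ns Nr) Tt => h.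
move: (submB sX (submB sX h (cubic_word Ns Tt)) (cubic_word Nr Tt)); congr X.
by rewrite !(brDr, brDl); zmod.
Qed.

(** Polarized [cubic_word] at [s] and [s ∙ b ∙ c]: of the four resulting words, two contain s a s
    and vanish. *)
Let mixed_word s c b t : N s -> D2 c -> Dm b -> Tm t ->
  X (s ∙ a ∙ c ∙ b ∙ s ∙ t + s ∙ b ∙ c ∙ a ∙ s ∙ t).
Proof.
move=> Ns Dc Db Tt; have Ds := N2 Ns; have := cubic_word_polar Ns (N_triple Ns Db Dc) Tt.
rewrite (kl_word H Ds Db Dc Tt) (kl_word H Ds Db Dc (wT Ds Da Tt)) !brDr => h.
have h1 := cubic_word Ns (wT Dc Db Tt).
have h2 := wX Dc Db (cubic_word Ns Tt).
by move: (submB sX (submB sX h h1) h2); congr X; zmod.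
Qed.

Let middle_word s c t : N s -> D2 c -> Tm t -> X (s ∙ a ∙ c ∙ a ∙ s ∙ t).
Proof.
by move=> Ns Dc Tt; apply: (submMnK U2 sX); have := mixed_word Ns Dc Da Tt; rewrite mulr2n.
Qed.

(** For [a ∙ r ∙ a] the test word of [ndY] contains r a c a r, which is handled by [middle_word]. *)
Let middle_word_dual r u : N r -> Tp u -> Y (a ∙ r ∙ a ∙ u).
Proof.
move=> Nr Tu; have Dr := N2 Nr; apply: (submMnK U2 sY).
have e v : Tp v -> (a ∙ r ∙ a) ∙ v = (a ∙ r ∙ a ∙ v) *+ 2.
  by move=> Tv; rewrite word_m //; zmod.
rewrite -e //; apply: ndY => // [|c {Tu}u Dc Tu].
  by apply: (kl_0 H) => //; apply: (kl2_ H).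
rewrite (e u Tu) !brMnr (e _ (kl2m H Dc (kl_mp H Da (kl2m H Dr (kl_mp H Da Tu))))).
 do 2!apply: (submMn _ sY).
by apply: (sp__ st) => //; apply: middle_word => //; apply: (kl_mp H).
Qed.

(** [p ∙ a ∙ s] acts as the sum of the words p a s and s a p, so its test word for [ndX] splits into
    [X1] to [X4]. Each reduces to [middle_word] or its dual, for [X1] and [X4] after an exchange of
    [a] and [b] by [mixed_word]. *)
Lemma inner_triple_ad p f : D2 p -> G f -> G (p ∙ a ∙ l ∙ f).
Proof.
move=> Dp Gf; set s := l ∙ f; have Ds : D2 s by apply: (kl02 H) => //; case: Gf.
have Ns : N s by split=> //; exists f; rewrite subrr; split=> //; apply: subm0.
have Dm' : D2 (p ∙ a ∙ s) by apply: (kl20 H) => //; apply: (kl_2 H).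
split=> // t Tt; apply: (ndX) => // {Tt}b {}t Db Tt.
have Tps : Tp (p ∙ t) by apply: (kl2m H).
have DP : D2 (p ∙ b ∙ p) by apply: (kl20 H) => //; apply: (kl_2 H).
have Ns' : N (s ∙ b ∙ s) by apply: N_triple.
have dbl c v : D2 c -> Tm v -> (c ∙ b ∙ c) ∙ v = (c ∙ b ∙ c ∙ v) *+ 2.
  by move=> Dc Tv; rewrite (kl_word H) //; zmod.
have X1 : X (p ∙ a ∙ s ∙ b ∙ p ∙ a ∙ s ∙ t).
  apply: (submDr (u := p ∙ a ∙ s ∙ a ∙ p ∙ b ∙ s ∙ t) sX).
    apply: (sp_2 st) => //; apply: middle_word_dual => //.
    by apply: (kl2m H) => //; apply: wT.
  by rewrite -(brDr p) -(brDr a); apply: (wX) => //; apply: mixed_word.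
have X2 : X (p ∙ a ∙ s ∙ b ∙ s ∙ a ∙ p ∙ t).
  apply: (submMnK U2 sX); rewrite -(brMnr p) -(brMnr a) -dbl //; last exact: wT.
  by apply: (sp_2 st) => //; apply: middle_word_dual.
have X3 : X (s ∙ a ∙ p ∙ b ∙ p ∙ a ∙ s ∙ t).
  apply: (submMnK U2 sX); rewrite -(brMnr s) -(brMnr a) -dbl //; last exact: wT.
  exact: middle_word.
have X4 : X (s ∙ a ∙ p ∙ b ∙ s ∙ a ∙ p ∙ t).
  apply: (submDr (u := s ∙ b ∙ p ∙ a ∙ s ∙ a ∙ p ∙ t) sX).
    apply: (wX) => //; apply: (sp_2 st) => //; exact: middle_word_dual.
  by rewrite addrC; apply: mixed_word => //; apply: wT.
have Tbm : Tm (b ∙ p ∙ a ∙ s ∙ t) by apply: wT => //; apply: wT.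
have Tbm' : Tm (b ∙ s ∙ a ∙ p ∙ t) by apply: wT => //; apply: wT.
rewrite (kl_word H Dp Da Ds Tt) !brDr.
rewrite (kl_word H Dp Da Ds Tbm) (kl_word H Dp Da Ds Tbm').
by do 2!apply: (submD sX) => //; apply: (submD sX).
Qed.

End Quintic.

(** Linearizing [inner_triple_ad] in [a] trades [s a ∙ b ∙ s a] for [s a ∙ a ∙ s b], which by
    symmetry of the triple product is in [G]; then [ndX] applies to [s a]. *)
Lemma inner_ad_square x a f : Tp x -> Dm a -> G f -> G ((x ∙ a ∙ x) ∙ f).
Proof.
move=> Tx Da Gf; have Df : D2 f by case: Gf.
pose s b := (x ∙ b ∙ x) ∙ f.
have Dsb b : Dm b -> D2 (s b).
  by move=> Db; apply: (kl02 H) => //; apply: klpm => //; apply: (kl_mp H).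
have pol p b : D2 p -> Dm b -> G (p ∙ b ∙ s a + p ∙ a ∙ s b).
  move=> Dp Db; have h := inner_triple_ad Tx (submD (brspan_subm _ _) Da Db) Dp Gf.
  have h1 := inner_triple_ad Tx Da Dp Gf; have h2 := inner_triple_ad Tx Db Dp Gf.
  move: (submB sG (submB sG h h1) h2); congr G.
  by rewrite /s !(brDl, brDr); zmod.
split=> [|t Tt]; first exact: Dsb.
apply: ndX => // [|b {Tt}t Db Tt]; first exact: Dsb.
have [_ h] : G (s a ∙ b ∙ s a).
  apply: (submDr (u := s a ∙ a ∙ s b) sG).
    have Ds := Dsb b Db; rewrite (kl_tripleC H a (Dsb a Da) Ds).
    exact: inner_triple_ad.
  by rewrite addrC; apply: pol => //; apply: Dsb.
apply: (submMnK U2 sX); have := h t Tt; rewrite (kl_word H) ?mulr2n //; exact: Dsb.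
Qed.

(** Since [Dm ∙ Tp] spans [Tm], degree 0 is spanned by the [u ∙ a ∙ v]. The part symmetric in [u]
    and [v] polarizes [inner_ad_square]; the skew part is [(u ∙ v) ∙ a], a case of
    [inner_triple]. *)
Lemma inner_stable d f : (forall b, Tm b -> brspan Dm Tp b) -> D0 d -> G f ->
  G (d ∙ f).
Proof.
move=> Tmg d0 Gf; have [Df _] := Gf.
apply: (brspan_ind (N := fun d => G (d ∙ f)) _ _ d0); first exact: (subm_brl _ sG).
move=> u b Tu /Tmg; apply: (brspan_ind (N := fun b => G ((u ∙ b) ∙ f))).
  exact: (subm_brr _ (subm_brl _ sG)).
move=> a v Da Tv.
have TD := submD (kl_subp H) Tu Tv.
have h := inner_ad_square TD Da Gf; have h1 := inner_ad_square Tu Da Gf.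
have h2 := inner_ad_square Tv Da Gf.
have h3 : G ((u ∙ v) ∙ a ∙ f) by apply: inner_triple => //; apply: klpp.
have e : (v ∙ a ∙ u) ∙ f = (u ∙ a ∙ v) ∙ f + (u ∙ v) ∙ a ∙ f.
  rewrite (brA (u ∙ v)) (kl22 H (klpp Tu Tv) Df) br0r addr0 -brDl.
  congr (_ ∙ f); rewrite lbr_jacobi [v ∙ a]brC [u ∙ a]brC !brNr; zmod.
apply: (submMnK U2 sG).
move: (submB sG (submB sG (submB sG h h1) h2) h3); congr G.
by rewrite !(brDl, brDr) e; zmod.
Qed.
End Descent.

End Stabilizer.

(** * Absolute zero divisors *)

Section Extremal.
Variables (k : comUnitRingType) (L : lieAlg k) (Tp Tm : L -> Prop).
Hypotheses (U2 : (2%:R : k) \is a GRing.unit) (U3 : (3%:R : k) \is a GRing.unit).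
Hypotheses (H : kantor_lie Tp Tm) (fL : field_like L) (es : seq L).
Hypothesis gen : forall v, lspan (fun u => u = 0) es v.
Let H' := kantor_lie_swap H.
Notation D2 := (brspan Tp Tp).
Notation D0 := (brspan Tp Tm).
Notation Dm := (brspan Tm Tm).
Variables (c0 a0 : L).
Hypotheses (c0P : D2 c0) (c0n : c0 <> 0) (a0P : Dm a0) (a0n : a0 <> 0).

(* [inner_part] is a module over degree 0, hence zero since [D2] is irreducible. *)
Lemma extremal_zero c : D2 c -> (forall a, Dm a -> c ∙ c ∙ a = 0) -> c = 0.
Proof.
move=> Dc cc; have [X [Y mXY]] := maximal_pair_exists H fL gen c0P c0n a0P a0n.
have ndX := maximal_pair_nondegenerate H fL gen U2 U3 mXY c0P c0n a0P a0n.
have ndY := maximal_pair_nondegenerate H' fL gen U2 U3 (maximal_pair_swap mXY)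
  a0P a0n c0P c0n.
have Tpg := Tp_gen H c0P c0n; have Tmg := Tp_gen H' a0P a0n.
case: (@D2_irreducible _ _ _ _ H (inner_part Tp Tm X)) => //.
- exact: inner_subm mXY.
- by move=> d [].
- by move=> d f d0 Gf; apply: (inner_stable H mXY U2 U3 ndX ndY).
- move=> G0; apply: G0; split=> // t Tt; apply: ndX => // b {Tt}t Db Tt.
  have : (c ∙ b ∙ c) ∙ t = 0 by rewrite [b ∙ c]brC brNr cc // oppr0 br0l.
  rewrite (kl_word H) // -mulr2n => /(mulrnK0 U2) ->.
  exact: subm0 (sp_subp mXY).
move=> hG; have [u [Tu []]] := mp_properp mXY.
move: (Tpg u Tu); apply: brspan_ind; first exact: sp_subp mXY.
by move=> d b /hG[_]; apply.
Qed.

(* With Z = ad z: for [d] of degree 0, Z^2 d is extremal, hence 0; for [a] of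
   degree -2 and [y = Z^2 a] this gives ad(y)^2 = 0, so [u ∙ u ∙ y] is extremal for
   each [u] in [Tp], hence 0; then [u ∙ z] is extremal, hence 0. *)
Lemma kantor_zero_divisor z : Tp z -> (forall b, Tm b -> z ∙ z ∙ b = 0) -> z = 0.
Proof.
move=> Tz zm; have sz := subm_zero L.
have z2 c : D2 c -> z ∙ c = 0 by move=> Dc; apply: (klp2 H).
have zzp u : Tp u -> z ∙ z ∙ u = 0 by move=> Tu; apply/z2/klpp.
have z3 v : total Tp Tm v -> z ∙ z ∙ z ∙ v = 0.
  move: v; apply: total_ind => [|v Dv|v Tv|v Dv|v Tv|v Dv].
  - exact: (subm_brr z (subm_brr z (subm_brr z sz))).
  - by rewrite (z2 v) // !br0r.
  - by rewrite (zzp v) // br0r.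
  - by apply/zzp/(klp0 H).
  - by rewrite (zm v) // br0r.
  - apply: (brspan_ind (N := fun v => z ∙ z ∙ z ∙ v = 0) _ _ Dv).
      exact: (subm_brr z (subm_brr z (subm_brr z sz))).
    move=> b b' Tb Tb'.
    have e2 : z ∙ z ∙ (b ∙ b') = ((z ∙ b) ∙ (z ∙ b')) *+ 2.
      by rewrite (brA z b) brDr (brA z (z ∙ b)) (brA z b) !zm // br0l br0r; zmod.
    by rewrite e2 brMnr (brA z) !zm // br0l br0r addr0 mul0rn.
(* Expansion of ad(ad(z)^3 w) = 0: as ad(z)^3 = 0, only three times the difference of the two sides
   remains. *)
have swap w v : total Tp Tm w -> total Tp Tm v ->
    z ∙ z ∙ w ∙ z ∙ v = z ∙ w ∙ z ∙ z ∙ v.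
  move=> tw tv; apply: (mulrn_injU U3).
  have tz := totalp Tm Tz; have twv := total_br H tw tv.
  have := z3 _ tw => /(congr1 (fun w => w ∙ v)); rewrite br0l !lieE z3 // z3 //.
  rewrite br0r => /eqP h; apply/eqP; rewrite -subr_eq0 -oppr_eq0; apply/eqP.
  by move/eqP: h => <-; zmod.
have lin w A B C n : w ∙ (A - B *+ n + C) = w ∙ A - (w ∙ B) *+ n + w ∙ C :> L.
  by rewrite !(brDr, brNr, brMnr).
have zzD0 d : D0 d -> z ∙ z ∙ d = 0.
  move=> d0; have Tzd : Tp (z ∙ d) by apply: (klp0 H).
  have Dc : D2 (z ∙ z ∙ d) by apply: klpp.
  apply: extremal_zero => // a Da.
  set y := z ∙ a; have Ty : Tm y by apply: (kl_pm H).
  have Tdy : Tm (d ∙ y) by apply: (kl0m H).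
  have [td ta ty] := And3 (total0 d0) (total_ Tp Da) (totalm Tp Ty).
  have tbr := total_br H.
  have e1 : z ∙ d ∙ z ∙ y = 0 by rewrite -swap // zm.
  have cE v : (z ∙ z ∙ d) ∙ v = z ∙ z ∙ d ∙ v - (z ∙ d ∙ z ∙ v) *+ 2 + d ∙ z ∙ z ∙ v.
    by rewrite !lieE; zmod.
  have zu : z ∙ (z ∙ z ∙ d) ∙ a = 0.
    by rewrite cE lin -/y e1 (zm (d ∙ y)) // z3 ?mul0rn ?subr0 ?addr0 //; apply: tbr.
  have c2 : (z ∙ z ∙ d) ∙ (z ∙ z ∙ d) ∙ a = z ∙ z ∙ d ∙ d ∙ z ∙ y.
    have tda := tbr _ _ td ta; have tzda := tbr _ _ (totalp Tm Tz) tda.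
    rewrite {1}cE zu !br0r cE -/y !lin (swap d _ td tzda) z3 // !br0r.
    by rewrite (swap d (d ∙ y) td (totalm Tp Tdy)) (zm (d ∙ y)) // !br0r; zmod.
  (* The remaining word is [z ∙ z ∙ kap ∙ y] up to vanishing terms. As [kap] has degree 1,
     ad(ad(z)^2 kap) = 0; evaluated at [y], and at [a] followed by ad(z), this kills three times
     that word. *)
  rewrite c2; have [kap kE] : exists kap, kap = d ∙ d ∙ z by eexists.
  have Tk : Tp kap by rewrite kE; do 2!apply: (kl0p H) => //.
  have kapE v : kap ∙ v = d ∙ d ∙ z ∙ v - (d ∙ z ∙ d ∙ v) *+ 2 + z ∙ d ∙ d ∙ v.
    by rewrite kE !lieE; zmod.
  have zzk v : z ∙ z ∙ kap ∙ v - (z ∙ kap ∙ z ∙ v) *+ 2 + kap ∙ z ∙ z ∙ v = 0.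
    have := zzp _ Tk => /(congr1 (fun w => w ∙ v)); rewrite br0l !lieE => <-.
    by zmod.
  have k1 : z ∙ z ∙ kap ∙ y = 0.
    have := zzk y; have := congr1 (lbr z) (zzk a).
    rewrite br0r lin (z3 a) // -/y (z3 (kap ∙ a)); last first.
      by apply: tbr => //; apply: totalp.
    rewrite br0r addr0 sub0r => /eqP; rewrite addrC subr_eq0 => /eqP -> h.
    apply: (mulrnK0 U3); apply: oppr_inj; rewrite oppr0 -[RHS]h; zmod.
  move: k1; rewrite kapE !lin (swap d (d ∙ y) td (totalm Tp Tdy)) (zm (d ∙ y)) //.
  rewrite z3; first by rewrite !br0r mul0rn subr0 addr0.
  by apply: (tbr) => //; apply: tbr.
have tbr := total_br H; have tz := totalp Tm Tz.
have yy a v : Dm a -> total Tp Tm v -> (z ∙ z ∙ a) ∙ (z ∙ z ∙ a) ∙ v = 0.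
  move=> Da; have ta := total_ Tp Da; have sw v := swap a v ta.
  have yE w : (z ∙ z ∙ a) ∙ w = z ∙ z ∙ a ∙ w - (z ∙ a ∙ z ∙ w) *+ 2 + a ∙ z ∙ z ∙ w.
    by rewrite !lieE; zmod.
  have y0 : D0 (z ∙ z ∙ a) by apply: klpm => //; apply: (kl_pm H).
  have mul0 n : (0 : L) *+ n = 0 by exact: mul0rn.
  move: v; apply: total_ind => [|c Dc|u Tu|d d0|b Tb|a' Da'].
  - exact: (subm_brr _ (subm_brr _ sz)).
  - by rewrite (yE c) (z2 c) // !br0r (zzD0 (a ∙ c)) ?mul0 ?subr0 ?addr0 ?br0r //; apply: (kl_2 H).
  - have yp w : Tp w -> (z ∙ z ∙ a) ∙ w = - ((z ∙ a ∙ z ∙ w) *+ 2).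
      move=> Tw; rewrite yE (zm (a ∙ w)) ?(zzp w) ?br0r ?sub0r ?addr0 //.
      exact: (kl_mp H).
    rewrite (yp _ (kl0p H y0 Tu)) (yp u Tu) !(brNr, brMnr) (zzD0 (a ∙ z ∙ u)) ?br0r ?mul0 ?oppr0 ?mul0 ?oppr0 //.
    by apply: (kl_2 H) => //; apply: klpp.
  - have y00 w : D0 w -> (z ∙ z ∙ a) ∙ w = z ∙ z ∙ a ∙ w - (z ∙ a ∙ z ∙ w) *+ 2.
      by move=> Dw; rewrite yE (zzD0 w) // br0r addr0.
    have Tzd : Tp (z ∙ d) by apply: (klp0 H).
    have zyd : z ∙ (z ∙ z ∙ a) ∙ d = 0.
      rewrite y00 // brDr brNr brMnr (z3 (a ∙ d)) //; last first.
        by apply: tbr => //; apply: total0.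
      by rewrite (sw d (total0 d0)) (zzD0 d) // !br0r mul0 subr0.
    rewrite (y00 _ (kl00 H y0 d0)) zyd !br0r mul0 subr0 (y00 d d0) !(brDr, brNr, brMnr).
    have td := total0 d0; have tad := tbr _ _ ta td.
    rewrite (sw _ (tbr _ _ tz tad)) (z3 _ tad).
    rewrite (sw (a ∙ z ∙ d)); last by do 2!apply: (tbr) => //.
    by rewrite (zm (a ∙ z ∙ d)) ?br0r ?mul0 ?subr0 ?br0r ?mul0 ?subr0 //; apply: (kl_mp H).
  - have ym w : Tm w -> (z ∙ z ∙ a) ∙ w = - ((z ∙ a ∙ z ∙ w) *+ 2).
      by move=> Tw; rewrite yE (klmu H Da Tw) (zm w) // !br0r sub0r addr0.
    rewrite (ym _ (kl0m H y0 Tb)) (ym b Tb) !(brNr, brMnr) -sw.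
      by rewrite (klmu H Da (kl_pm H (kl_0 H (klpm Tz Tb) Da) Tz)) !br0r ?mul0 ?oppr0 ?mul0 ?oppr0.
    by apply: (tbr) => //; apply: (tbr) => //; apply: totalm.
  - have y_ w : Dm w -> (z ∙ z ∙ a) ∙ w = a ∙ z ∙ z ∙ w.
      move=> Dw; rewrite yE (kl__ H Da Dw) (klmu H Da (kl_pm H Dw Tz)).
      by rewrite !br0r mul0 subr0 add0r.
    rewrite (y_ _ (kl0_ H y0 Da')) (y_ a' Da') sw ?z3 ?br0r //.
      exact: total_.
    by apply: totalm; apply: (kl_pm H).
have ee a u : Dm a -> Tp u -> u ∙ u ∙ z ∙ z ∙ a = 0.
  move=> Da Tu; have y0 : D0 (z ∙ z ∙ a) by apply: klpm => //; apply: (kl_pm H).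
  have p0 v := yy a v Da; move: (z ∙ z ∙ a) y0 p0 => y y0 p0.
  have De : D2 (u ∙ u ∙ y) by apply: klpp => //; apply: (klp0 H).
  have tu := totalp Tm Tu.
  have ue := klp2 H De Tu.
  have yu w : u ∙ y ∙ w = (u ∙ y) ∙ w + y ∙ u ∙ w by rewrite brA.
  have y1u w : u ∙ (u ∙ y) ∙ w = (u ∙ u ∙ y) ∙ w + (u ∙ y) ∙ u ∙ w by rewrite brA.
  have eu w : u ∙ (u ∙ u ∙ y) ∙ w = (u ∙ u ∙ y) ∙ u ∙ w.
    by rewrite brA ue br0l add0r.
  apply: extremal_zero => // b Db; have tb := total_ Tp Db.
  move: (u ∙ u ∙ y) De ue y1u eu => e De ue y1u eu; move: (u ∙ y) yu y1u => y1 yu y1u.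
  (* [p1], [p2] and [p3] are the successive derivatives of ad(y)^2 = 0 along [u], where [u ∙ e = 0];
     the fourth derivative is ad(e)^2 = 0. *)
  have p1 v : total Tp Tm v -> y1 ∙ y ∙ v + y ∙ y1 ∙ v = 0.
    move=> tv; have := congr1 (lbr u) (p0 v tv).
    by rewrite (yu (y ∙ v)) (yu v) brDr p0 ?addr0 ?br0r //; apply: tbr.
  have p2 v : total Tp Tm v -> e ∙ y ∙ v + (y1 ∙ y1 ∙ v) *+ 2 + y ∙ e ∙ v = 0.
    move=> tv; have := congr1 (lbr u) (p1 v tv).
    rewrite brDr (yu (y1 ∙ v)) (y1u (y ∙ v)) (yu v) (y1u v) !brDr br0r.
    by have := p1 _ (tbr _ _ tu tv) => h <-; rewrite -[LHS]addr0 -h; zmod.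
  have p3 v : total Tp Tm v -> e ∙ y1 ∙ v + y1 ∙ e ∙ v = 0.
    move=> tv; apply: (mulrnK0 U3); have := congr1 (lbr u) (p2 v tv).
    rewrite (brDr u) (brDr u) (brMnr u) (yu (e ∙ v)) (eu (y ∙ v)) (y1u (y1 ∙ v)).
    rewrite (eu v) (yu v) (y1u v) ?(brDr e, brDr y1) br0r.
    by have := p2 _ (tbr _ _ tu tv) => h <-; rewrite -[LHS]addr0 -h; zmod.
  apply: (mulrnK0 U2); have := congr1 (lbr u) (p3 b tb).
  rewrite (brDr u) (eu (y1 ∙ b)) (y1u (e ∙ b)) (y1u b) (eu b) (brDr e) br0r.
  by have := p3 _ (tbr _ _ tu tb) => h <-; rewrite -[LHS]addr0 -h; zmod.
apply: (Tp_faithful H c0P c0n Tz) => u Tu.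
have Dq : D2 (u ∙ z) by apply: klpp.
apply: extremal_zero => // a Da.
have uq v : u ∙ (u ∙ z) ∙ v = (u ∙ z) ∙ u ∙ v.
  by rewrite brA (klp2 H Dq Tu) br0l add0r.
have uz v : u ∙ z ∙ v = z ∙ u ∙ v + (u ∙ z) ∙ v by rewrite brA addrC.
have zq v : z ∙ (u ∙ z) ∙ v = (u ∙ z) ∙ z ∙ v.
  by rewrite brA (klp2 H Dq Tz) br0l add0r.
have Tua : Tm (u ∙ a) by apply: (kl_pm H).
have hh v : u ∙ z ∙ z ∙ v = z ∙ z ∙ u ∙ v + ((u ∙ z) ∙ z ∙ v) *+ 2.
  by rewrite (uz (z ∙ v)) (uz v) brDr zq; zmod.
have h0 : ((u ∙ z) ∙ z ∙ u ∙ a) *+ 2 = 0.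
  have D0uu : D0 (u ∙ u ∙ a) by apply: klpm.
  by have := hh (u ∙ a); rewrite (zm (u ∙ a)) // br0r (zzD0 _ D0uu) add0r => h; rewrite -h.
apply: (mulrnK0 U2); have := ee a u Da Tu.
rewrite (hh a) zm // add0r brMnr uq (uz a) brDr => h.
by rewrite -[RHS]h mulrnDl h0 add0r.
Qed.

End Extremal.

Section Nondegenerate.
Variables (k : comUnitRingType) (L : lieAlg k) (Tp Tm : L -> Prop).
Hypotheses (U2 : (2%:R : k) \is a GRing.unit) (U3 : (3%:R : k) \is a GRing.unit).
Hypotheses (H : kantor_lie Tp Tm) (fL : field_like L) (es : seq L).
Hypothesis gen : forall v, lspan (fun u => u = 0) es v.

Lemma kantor_lie_nondegenerate z : Tp z -> (forall b, Tm b -> z ∙ z ∙ b = 0) -> z = 0.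
Proof.
have H' := kantor_lie_swap H.
case: (pselect (exists c, brspan Tp Tp c /\ c <> 0)) => [[c [Dc cn]]|n2];
  case: (pselect (exists c, brspan Tm Tm c /\ c <> 0)) => [[a [Da an]]|n_].
- exact: (kantor_zero_divisor U2 U3 H fL gen Dc cn Da an).
- case: (jordan_no_extension U2 U3 H' fL gen _ Dc cn) => d Dd.
  by apply: contrapT => dn; apply: n_; exists d.
- case: (jordan_no_extension U2 U3 H fL gen _ Da an) => d Dd.
  by apply: contrapT => dn; apply: n2; exists d.
apply: (jordan_zero_divisor U2 U3 H fL gen) => d Dd; apply: contrapT => dn.
  by apply: n2; exists d.
by apply: n_; exists d.
Qed.

End Nondegenerate.

(** * The Lie algebra of a Kantor pair *)

Section Half.
Variables (k : comUnitRingType) (U W : lmodType k).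
Variable f : U -> W -> U -> U.
Hypothesis tf : trilinear f.

Lemma trilin_l (a : k) u v y z : f (a *: u + v) y z = a *: f u y z + f v y z.
Proof. by have [h _ _] := tf; apply: h. Qed.

Lemma trilin_m (a : k) x u v z : f x (a *: u + v) z = a *: f x u z + f x v z.
Proof. by have [_ h _] := tf; apply: h. Qed.

Lemma trilin_r (a : k) x y u v : f x y (a *: u + v) = a *: f x y u + f x y v.
Proof. by have [_ _ h] := tf; apply: h. Qed.

Lemma trilinDl u v y z : f (u + v) y z = f u y z + f v y z.
Proof. by rewrite -[u]scale1r trilin_l !scale1r. Qed.
Lemma trilinDm x u v z : f x (u + v) z = f x u z + f x v z.
Proof. by rewrite -[u]scale1r trilin_m !scale1r. Qed.
Lemma trilinDr x y u v : f x y (u + v) = f x y u + f x y v.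
Proof. by rewrite -[u]scale1r trilin_r !scale1r. Qed.

Lemma trilin0l y z : f 0 y z = 0.
Proof. by apply: (addrI (f 0 y z)); rewrite -trilinDl !addr0. Qed.
Lemma trilin0m x z : f x 0 z = 0.
Proof. by apply: (addrI (f x 0 z)); rewrite -trilinDm !addr0. Qed.
Lemma trilin0r x y : f x y 0 = 0.
Proof. by apply: (addrI (f x y 0)); rewrite -trilinDr !addr0. Qed.

Lemma trilinNl u y z : f (- u) y z = - f u y z.
Proof. by apply/eqP; rewrite -addr_eq0 -trilinDl addNr trilin0l. Qed.
Lemma trilinNm x u z : f x (- u) z = - f x u z.
Proof. by apply/eqP; rewrite -addr_eq0 -trilinDm addNr trilin0m. Qed.
Lemma trilinNr x y u : f x y (- u) = - f x y u.
Proof. by apply/eqP; rewrite -addr_eq0 -trilinDr addNr trilin0r. Qed.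

Definition trilinE := (trilinDl, trilinDm, trilinDr, trilinNl, trilinNm, trilinNr,
  trilin0l, trilin0m, trilin0r).
End Half.

Section HalfDerivation.
Variables (k : comUnitRingType) (U W : lmodType k).
Variables (f : U -> W -> U -> U) (g : W -> U -> W -> W).
Hypothesis tf : trilinear f.
Hypotheses (kp1 : KP1 f g) (kp2 : KP2 f g).

(* The component in [U] of the action of [(p, m), (p', m')] on [(q, n)]; the
   component in [W] is the same expression for [g]. *)
Definition Rhalf (p : U) (m : W) (p' : U) (m' : W) (q : U) (n : W) : U :=
  f p m' q - f p' m q + (f p n p' - f p' n p).

Lemma KP1_sub0 x y z w u :
  f x y (f z w u) - f z w (f x y u) - (f (f x y z) w u - f z (g y x w) u) = 0.
Proof. by apply/eqP; rewrite subr_eq0; apply/eqP; apply: kp1. Qed.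

Lemma KP2_sub0 a b x y w : f a (g x y w) b - f b (g x y w) a + f y x (f a w b - f b w a)
   - (f (f a x b - f b x a) w y - f y w (f a x b - f b x a)) = 0.
Proof. by apply/eqP; rewrite subr_eq0; apply/eqP; apply: kp2. Qed.

Lemma KP2_skew a b x w y : f a (g x y w - g w y x) b - f b (g x y w - g w y x) a
   - (f (f a x b - f b x a) w y - f (f a w b - f b w a) x y) = 0.
Proof.
have h1 := KP2_sub0 a b x y w; have h2 := KP2_sub0 a b w y x.
rewrite -[RHS](subrr 0) -{1}h1 -h2 !(trilinE tf); zmod.
Qed.

(* The identity [b, c] = - [c, b] for b of degree -2 and c of degree 2 exchanges
   this with the previous lemma. *)
Lemma KP2_skew_swap x w a b n : f x (g a n b - g b n a) w - f w (g a n b - g b n a) x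
   - (f w (g a x b - g b x a) n - f x (g a w b - g b w a) n) = 0.
Proof.
have h1 := KP1_sub0 x a w b n; have h2 := KP1_sub0 x b w a n.
have h3 := KP1_sub0 w a x b n; have h4 := KP1_sub0 w b x a n.
rewrite -[RHS](KP2_skew x w a b n) -[RHS]subr0 -{1}h1 -[RHS]addr0 -{1}h2.
rewrite -[RHS]addr0 -{1}h3 -[RHS]subr0 -{1}h4 !(trilinE tf); zmod.
Qed.

End HalfDerivation.

Section HalfDerivation2.
Variables (k : comUnitRingType) (U W : lmodType k).
Variables (f : U -> W -> U -> U) (g : W -> U -> W -> W).
Hypotheses (tf : trilinear f) (tg : trilinear g).
Hypotheses (kp1 : KP1 f g) (kp2 : KP2 f g).

(** The difference of the two sides is a signed sum of eight instances of KP1, two of KP2 and the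
    two skew identities above; [sub0] and [sub1] insert these zeros with their signs. *)
Lemma Rhalf_derivation p1 m1 p2 m2 p3 m3 p4 m4 p5 m5 :
  let R p m p' m' q n := Rhalf f p m p' m' q n in
  let S p m p' m' q n := Rhalf g m p m' p' n q in
  R p1 m1 p2 m2 (R p3 m3 p4 m4 p5 m5) (S p3 m3 p4 m4 p5 m5) -
  R p3 m3 p4 m4 (R p1 m1 p2 m2 p5 m5) (S p1 m1 p2 m2 p5 m5) =
  R (R p1 m1 p2 m2 p3 m3) (S p1 m1 p2 m2 p3 m3) p4 m4 p5 m5 +
  R p3 m3 (R p1 m1 p2 m2 p4 m4) (S p1 m1 p2 m2 p4 m4) p5 m5.
Proof.
move=> R S; apply/eqP; rewrite -subr_eq0; apply/eqP.
have e1 := KP1_sub0 kp1 p1 m2 p3 m4 p5; have e2 := KP1_sub0 kp1 p2 m1 p3 m4 p5.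
have e3 := KP1_sub0 kp1 p1 m2 p4 m3 p5; have e4 := KP1_sub0 kp1 p2 m1 p4 m3 p5.
have e5 := KP1_sub0 kp1 p1 m2 p3 m5 p4; have e6 := KP1_sub0 kp1 p1 m2 p4 m5 p3.
have e7 := KP1_sub0 kp1 p2 m1 p3 m5 p4; have e8 := KP1_sub0 kp1 p2 m1 p4 m5 p3.
have e9 := KP2_sub0 kp2 p1 p2 m4 p3 m5; have e10 := KP2_sub0 kp2 p1 p2 m3 p4 m5.
have e11 := KP2_skew tf kp2 p1 p2 m3 m4 p5.
have e12 := KP2_skew_swap tf kp1 kp2 p3 p4 m1 m2 p5.
have sub0 (x y z : U) : x = 0 -> y = z -> y = x + z by move=> -> ->; rewrite add0r.
have sub1 (x y z : U) : x = 0 -> y = z -> y = - x + z by move=> -> ->; rewrite oppr0 add0r.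
symmetry.
refine (etrans (sub0 _ _ _ e1 (sub1 _ _ _ e2 (sub1 _ _ _ e3 (sub0 _ _ _ e4
  (sub0 _ _ _ e5 (sub1 _ _ _ e6 (sub1 _ _ _ e7 (sub0 _ _ _ e8
  (sub1 _ _ _ e9 (sub0 _ _ _ e10 (sub0 _ _ _ e11 (sub1 _ _ _ e12 (erefl 0))))))))))))) _).
rewrite /R /S /Rhalf !(trilinE tf, trilinE tg).
zmod.
Qed.
End HalfDerivation2.

(** * The Lie triple system of a Kantor pair and its standard embedding *)

Section Inner.
Variables (k : comUnitRingType) (K : kantor_pair k).
Notation T := (Kpos K * Kneg K)%type.
Notation f := (@prodpos k K).
Notation g := (@prodneg k K).
Let tf := @prodpos_trilinear k K.
Let tg := @prodneg_trilinear k K.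
Implicit Types (s t u v : T).

(** A Lie triple product: [Rop_alt], [Rop_cyc] and [Rop_derivation] are its axioms, and [kbr] is the
    bracket of its standard embedding. *)
Definition Rop s t u : T :=
  (Rhalf f s.1 s.2 t.1 t.2 u.1 u.2, Rhalf g s.2 s.1 t.2 t.1 u.2 u.1).

Lemma Rop_linl (a : k) s s' t u : Rop (a *: s + s') t u = a *: Rop s t u + Rop s' t u.
Proof.
congr pair; rewrite /= /Rhalf /= !(trilin_l tf, trilin_m tf, trilin_r tf,
  trilin_l tg, trilin_m tg, trilin_r tg) !scalerDr !scalerN; zmod.
Qed.

Lemma Rop_linr (a : k) s t t' u : Rop s (a *: t + t') u = a *: Rop s t u + Rop s t' u.
Proof.
congr pair; rewrite /= /Rhalf /= !(trilin_l tf, trilin_m tf, trilin_r tf,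
  trilin_l tg, trilin_m tg, trilin_r tg) !scalerDr !scalerN; zmod.
Qed.

Lemma Rop_lin (a : k) s t u u' : Rop s t (a *: u + u') = a *: Rop s t u + Rop s t u'.
Proof.
congr pair; rewrite /= /Rhalf /= !(trilin_l tf, trilin_m tf, trilin_r tf,
  trilin_l tg, trilin_m tg, trilin_r tg) !scalerDr !scalerN; zmod.
Qed.

Lemma Rop_alt s u : Rop s s u = 0.
Proof. by congr pair; rewrite /Rhalf; zmod. Qed.

Lemma Rop_cyc s t u : Rop s t u + Rop t u s + Rop u s t = 0.
Proof. by congr pair; rewrite /= /Rhalf; zmod. Qed.

Lemma Rop_derivation s t u v w : Rop s t (Rop u v w) - Rop u v (Rop s t w) =
  Rop (Rop s t u) v w + Rop u (Rop s t v) w.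
Proof.
congr pair; apply: Rhalf_derivation => //.
- exact: KP1_pos.
- exact: KP2_pos.
- exact: KP1_neg.
- exact: KP2_neg.
Qed.

(** Bare functions are used: linearity and the derivation property pass from the generators
    [Rop s t] to their span by [inn_ind]. *)
Definition inn_pred : {pred (T -> T)} :=
  fun D => `[< @span k (T -> T) (fun E => exists s t, E = Rop s t) D >].

Lemma inn_submod : submod_closed inn_pred.
Proof.
split; first by apply/asboolP; apply: span_zero.
by move=> a u v /asboolP hu /asboolP hv; apply/asboolP; exact: span_lin.
Qed.

HB.instance Definition _ :=
  GRing.isSubmodClosed.Build k (T -> T) inn_pred inn_submod.

Record inn := Inn { inn_val :> T -> T; inn_valP : inn_val \in inn_pred }.
HB.instance Definition _ := [isSub for inn_val].
HB.instance Definition _ := [Choice of inn by <:].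
HB.instance Definition _ := [SubChoice_isSubLmodule of inn by <:].
Implicit Types (D E F : inn).

Lemma inn_ext D E : (forall u, D u = E u) -> D = E.
Proof. by move=> DE; apply/val_inj/funext. Qed.

Lemma inn_ind (N : (T -> T) -> Prop) D : @subm k (T -> T) N ->
  (forall s t, N (Rop s t)) -> N D.
Proof.
by move=> sN NR; have /asboolP := inn_valP D; apply: span_min => // _ [s [t ->]].
Qed.

Lemma inn_lin (a : k) D u v : D (a *: u + v) = a *: D u + D v.
Proof.
move: (a) u v; refine (@inn_ind (fun D : T -> T => forall a u v, D (a *: u + v) = a *: D u + D v) D _ _).
  split=> [b u v|c F G hF hG b u v]; first by rewrite scaler0 addr0.
  change (c *: F (b *: u + v) + G (b *: u + v)
    = b *: (c *: F u + G u) + (c *: F v + G v)).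
  by rewrite hF hG !scalerDr !scalerA mulrC; zmod.
by move=> s t b u v; apply: Rop_lin.
Qed.

Lemma inn_D D u v : D (u + v) = D u + D v.
Proof. by rewrite -[u]scale1r inn_lin !scale1r. Qed.
Lemma inn_0 D : D 0 = 0.
Proof. by apply: (addrI (D 0)); rewrite -inn_D !addr0. Qed.
Lemma inn_N D u : D (- u) = - D u.
Proof. by apply/eqP; rewrite -addr_eq0 -inn_D addNr inn_0. Qed.

Lemma inn_derivation D s t u : D (Rop s t u) - Rop s t (D u) =
  Rop (D s) t u + Rop s (D t) u.
Proof.
move: s t u; refine (@inn_ind (fun D : T -> T => forall s t u, D (Rop s t u) - Rop s t (D u) =
  Rop (D s) t u + Rop s (D t) u) D _ _); last first.
  by move=> s t u v w; apply: Rop_derivation.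
have R0 s t : Rop s t 0 = 0.
  by have := Rop_lin (-1) s t 0 0; rewrite scaler0 addr0 scaleN1r addNr.
have R0l s u : Rop 0 s u = 0.
  by have := Rop_linl (-1) 0 0 s u; rewrite scaler0 addr0 scaleN1r addNr.
have R0r s u : Rop s 0 u = 0.
  by have := Rop_linr (-1) s 0 0 u; rewrite scaler0 addr0 scaleN1r addNr.
split=> [s t u|c F G hF hG s t u].
  by change (0 - Rop s t 0 = Rop 0 t u + Rop s 0 u); rewrite R0 R0l R0r; rewrite subrr addr0.
change (c *: F (Rop s t u) + G (Rop s t u) - Rop s t (c *: F u + G u)
   = Rop (c *: F s + G s) t u + Rop s (c *: F t + G t) u).
rewrite Rop_lin Rop_linl Rop_linr.
transitivity (c *: (F (Rop s t u) - Rop s t (F u)) + (G (Rop s t u) - Rop s t (G u))).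
  by rewrite scalerBr; zmod.
by rewrite hF hG scalerDr; zmod.
Qed.

Lemma comm_subproof D E : (fun u => D (E u) - E (D u)) \in inn_pred.
Proof.
rewrite [_ \in _]/in_mem /=.
apply: (@inn_ind (fun E : T -> T => (fun u => D (E u) - E (D u)) \in inn_pred) E).
  split=> [|c F G hF hG].
    rewrite (_ : (fun _ => _) = 0); first exact: rpred0.
    by apply/funext => u; change (D 0 - 0 = 0 :> T); rewrite inn_0 subr0.
  rewrite (_ : (fun _ => _) = c *: (fun u => D (F u) - F (D u)) + (fun u => D (G u) - G (D u))).
    by apply: rpredD => //; apply: rpredZ.
  apply/funext => u.
  change (D (c *: F u + G u) - (c *: F (D u) + G (D u))
    = c *: (D (F u) - F (D u)) + (D (G u) - G (D u))).
  by rewrite inn_lin scalerBr; zmod.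
move=> s t; rewrite (_ : (fun _ => _) = Rop (D s) t + Rop s (D t)).
  by apply: rpredD; apply/asboolP; apply: mem_span; do 2!eexists.
by apply/funext => u; apply: inn_derivation.
Qed.

Definition comm D E : inn := Inn (comm_subproof D E).

Lemma rop_subproof s t : Rop s t \in inn_pred.
Proof. by apply/asboolP; apply: mem_span; exists s, t. Qed.

Definition rop s t : inn := Inn (rop_subproof s t).

(* [L = inn + K], where [inn] is spanned by the derivations [Rop s t]. *)
Definition kbr (x y : (inn * T)%type) : (inn * T)%type :=
  (comm x.1 y.1 + rop x.2 y.2, x.1 y.2 - y.1 x.2).

Lemma kbr_linearl (a : k) x y z : kbr (a *: x + y) z = a *: kbr x z + kbr y z.
Proof.
case: x y z => [D s] [E t] [F r]; congr pair; last first.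
  change (a *: D r + E r - F (a *: s + t) = a *: (D r - F s) + (E r - F t)).
  by rewrite inn_lin scalerBr; zmod.
apply: inn_ext => u.
change (a *: D (F u) + E (F u) - F (a *: D u + E u) + Rop (a *: s + t) r u
  = a *: (D (F u) - F (D u) + Rop s r u) + (E (F u) - F (E u) + Rop t r u)).
by rewrite inn_lin Rop_linl !scalerDr scalerN; zmod.
Qed.

Lemma kbr_linearr (a : k) x y z : kbr x (a *: y + z) = a *: kbr x y + kbr x z.
Proof.
case: x y z => [F r] [D s] [E t]; congr pair; last first.
  change (F (a *: s + t) - (a *: D r + E r) = a *: (F s - D r) + (F t - E r)).
  by rewrite inn_lin scalerBr; zmod.
apply: inn_ext => u.
change (F (a *: D u + E u) - (a *: D (F u) + E (F u)) + Rop r (a *: s + t) u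
  = a *: (F (D u) - D (F u) + Rop r s u) + (F (E u) - E (F u) + Rop r t u)).
by rewrite inn_lin Rop_linr !scalerDr scalerN; zmod.
Qed.

Lemma kbr_alt x : kbr x x = 0.
Proof.
case: x => D s; congr pair; last exact: subrr.
apply: inn_ext => u; change (D (D u) - D (D u) + Rop s s u = 0).
by rewrite subrr Rop_alt addr0.
Qed.

Lemma Rop_anti s t u : Rop s t u = - Rop t s u.
Proof. by congr pair; rewrite /= /Rhalf; zmod. Qed.

Lemma Rop_linBl s s' t u : Rop (s - s') t u = Rop s t u - Rop s' t u.
Proof. by congr pair; rewrite /= /Rhalf /= !(trilinE tf, trilinE tg); zmod. Qed.

(** The component in [T] reduces to [Rop_cyc], the one in [inn] to three instances of
    [inn_derivation]. *)
Lemma kbr_jacobi x y z : kbr (kbr x y) z = kbr x (kbr y z) - kbr y (kbr x z).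
Proof.
case: x y z => [D s] [E t] [F r]; congr pair; last first.
  change (D (E r) - E (D r) + Rop s t r - F (D t - E s)
    = D (E r - F t) - (E (F s) - F (E s) + Rop t r s)
      - (E (D r - F s) - (D (F t) - F (D t) + Rop s r t))).
  have <- : - Rop t r s + Rop s r t = Rop s t r.
    by rewrite (Rop_anti s r t) -[LHS]addr0 -(Rop_cyc s t r); zmod.
  by rewrite !inn_D !inn_N; zmod.
apply: inn_ext => u.
change (D (E (F u)) - E (D (F u)) + Rop s t (F u)
    - F (D (E u) - E (D u) + Rop s t u) + Rop (D t - E s) r u
  = D (E (F u) - F (E u) + Rop t r u) - (E (F (D u)) - F (E (D u)) + Rop t r (D u))
    + Rop s (E r - F t) u
    - (E (D (F u) - F (D u) + Rop s r u)
       - (D (F (E u)) - F (D (E u)) + Rop s r (E u)) + Rop t (D r - F s) u)).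
rewrite (Rop_anti s (_ - _)) (Rop_anti t (_ - _)) !Rop_linBl !inn_D !inn_N.
have h1 := inn_derivation F s t u; have h2 := inn_derivation D t r u.
have h3 := inn_derivation E s r u.
apply/eqP; rewrite -subr_eq0; apply/eqP.
transitivity (- (F (Rop s t u) - Rop s t (F u)) - (D (Rop t r u) - Rop t r (D u))
  + (E (Rop s r u) - Rop s r (E u)) + (Rop (D t) r u - Rop (E s) r u
   + Rop (E r) s u - Rop (F t) s u - Rop (D r) t u + Rop (F s) t u)); first by zmod.
rewrite h1 h2 h3 (Rop_anti s (F t)) (Rop_anti t (D r)) (Rop_anti s (E r)); zmod.
Qed.

End Inner.

Lemma fin_generated_lspan (k : comUnitRingType) (U : lmodType k) :
  fin_generated U -> exists s : seq U, forall u, lspan (fun v => v = 0) s u.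
Proof.
case=> n [e gen]; exists [seq e i | i : 'I_n] => u; have [c ->] := gen u.
have sN := lspan_subm [seq e i | i : 'I_n] (subm_zero U).
apply: (big_ind (lspan (fun v => v = 0) [seq e i | i : 'I_n])).
- exact: subm0 sN.
- by move=> v w; apply: submD.
move=> i _; apply: (submZ _ sN); apply: lspan_mem; first exact: subm_zero.
by apply/mapP; exists i => //; rewrite mem_enum.
Qed.

(* Nakayama: if [a T = T] then [1 - a b] kills [T] for some [b]. *)
Lemma nakayama (k : comUnitRingType) (T : lmodType k) (s : seq T) (a : k) :
  (forall t, lspan (fun v => v = 0) s t) -> (forall t : T, exists t', t = a *: t') ->
  exists b, forall t : T, (a * b) *: t = t.
Proof.
move=> gen aT; suff [b hb] : exists b, forall t : T, (1 - a * b) *: t = 0.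
  by exists b => t; have /eqP := hb t; rewrite scalerBl scale1r subr_eq0 => /eqP.
have : exists b, forall t : T, lspan (fun v => v = 0) s ((1 - a * b) *: t) by exists 0.
elim: s {gen} => [//|e s IHs] [b hb]; apply: IHs.
have sS := lspan_subm s (subm_zero T).
have [t0 e0] := aT e; have [c hc] := hb t0.
(* Chosen so that 1 - a b' = (1 - a (b + c)) (1 - a b). The right factor maps into the span of [e]
   and [s]; the left one then sends [e] into the span of [s], because [e = a *: t0]. *)
exists (b + (b + c) - a * (b * (b + c))) => t; have [c' hc'] := hb t.
have -> : 1 - a * (b + (b + c) - a * (b * (b + c)))
    = (1 - a * (b + c)) * (1 - a * b).
  by ring.
rewrite -scalerA -[X in _ *: X](subrK (c' *: e)) scalerDr.
apply: (submD sS); first exact: submZ.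
rewrite scalerA mulrC -scalerA; apply: (submZ _ sS).
have := submZ a sS hc; rewrite scalerBr !scalerA; congr (lspan _ s _).
have -> : (a * (1 - a * b)) *: t0 = (1 - a * b) *: e by rewrite e0 scalerA mulrC.
rewrite -scalerBl mulrDr opprD addrA.
by congr (_ *: _).
Qed.

(** * Finite generation, scalars and grading of the Lie algebra *)

Section Construction.
Variables (k : comUnitRingType) (K : kantor_pair k).
Notation T := (Kpos K * Kneg K)%type.
Notation f := (@prodpos k K).
Notation g := (@prodneg k K).
Let tf := @prodpos_trilinear k K.
Let tg := @prodneg_trilinear k K.

Definition kantor_alg : lieAlg k :=
  LieAlg (@kbr_linearl k K) (@kbr_linearr k K) (@kbr_alt k K) (@kbr_jacobi k K).
Notation L := kantor_alg.

Definition inT (t : T) : L := (0, t).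
Definition inD (D : inn K) : L := (D, 0).
Definition posT (v : L) : Prop := exists p, v = inT (p, 0).
Definition negT (v : L) : Prop := exists m, v = inT (0, m).

Lemma inT_lin (a : k) s t : inT (a *: s + t) = a *: inT s + inT t.
Proof. by congr pair; rewrite /= scaler0 addr0. Qed.

Lemma inT_br s t : inT s ∙ inT t = inD (rop s t).
Proof.
congr pair; last exact: subrr.
by apply: inn_ext => u; change (0 - 0 + Rop s t u = Rop s t u); rewrite subrr add0r.
Qed.

Lemma inner_br D t : inD D ∙ inT t = inT (D t).
Proof.
congr pair; last by change (D t - 0 = D t); rewrite subr0.
apply: inn_ext => u; change (D 0 - 0 + Rop 0 t u = 0).
rewrite inn_0 subrr add0r.
by have := Rop_linl (-1) 0 0 t u; rewrite scaler0 addr0 scaleN1r addNr.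
Qed.

Lemma inT_triple s t u : (inT s ∙ inT t) ∙ inT u = inT (Rop s t u).
Proof. by rewrite inT_br inner_br. Qed.

Lemma RopE s t u : Rop s t u =
  (f s.1 t.2 u.1 - f t.1 s.2 u.1 + (f s.1 u.2 t.1 - f t.1 u.2 s.1),
   g s.2 t.1 u.2 - g t.2 s.1 u.2 + (g s.2 u.1 t.2 - g t.2 u.1 s.2)).
Proof. by []. Qed.

Let zE := (trilin0l tf, trilin0m tf, trilin0r tf, trilin0l tg, trilin0m tg,
  trilin0r tg, subr0, sub0r, addr0, add0r, oppr0).

Lemma pos_triple p m q : (inT (p, 0) ∙ inT (0, m)) ∙ inT (q, 0) = inT (f p m q, 0).
Proof. by rewrite inT_triple RopE /= !zE. Qed.

Lemma neg_triple p m n : (inT (0, m) ∙ inT (p, 0)) ∙ inT (0, n) = inT (0, g m p n).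
Proof. by rewrite inT_triple RopE /= !zE. Qed.

Lemma inD_lin (a : k) D E : inD (a *: D + E) = a *: inD D + inD E.
Proof. by congr pair; rewrite /= scaler0 addr0. Qed.

Lemma inDT (v : L) : v = inD v.1 + inT v.2.
Proof. by case: v => D t; congr pair; rewrite /= ?addr0 ?add0r. Qed.

Lemma subm_inD (N : L -> Prop) (h : T -> inn K) : @subm k L N ->
  (forall (a : k) x y, h (a *: x + y) = a *: h x + h y) ->
  @subm k T (fun t => N (inD (h t))).
Proof.
move=> sN hl; split=> [|a x y hx hy]; last by rewrite hl inD_lin; apply: sN.2.
have := hl (-1) 0 0; rewrite scaler0 addr0 scaleN1r addNr => ->.
exact: subm0 sN.
Qed.

Lemma pair_generated : exists s : seq T, forall t, lspan (fun u => u = 0) s t.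
Proof.
have [sp hp] := fin_generated_lspan (Kpos_fin_generated K).
have [sm hm] := fin_generated_lspan (Kneg_fin_generated K).
pose s : seq T := [seq (p, 0) | p <- sp] ++ [seq (0, m) | m <- sm].
have sS := lspan_subm s (subm_zero T).
exists s => -[p m]; have -> : (p, m) = (p, 0) + (0, m) :> T.
  by congr pair; rewrite /= ?addr0 ?add0r.
apply: (submD sS).
  refine (lspan_min (N' := fun p => lspan (fun u => u = 0) s ((p, 0) : T)) _ _ _ (hp p)).
  - split=> [|a u v hu hv]; first exact: subm0 sS.
    have -> : (a *: u + v, 0) = a *: (u, 0) + (v, 0) :> T.
      by congr pair; rewrite /= scaler0 addr0.
    exact: sS.2.
  - by move=> u ->; exact: subm0 sS.
  - move=> e se; apply: lspan_mem; first exact: subm_zero.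
    by rewrite mem_cat (map_f (fun p => (p, 0) : T)).
refine (lspan_min (N' := fun m => lspan (fun u => u = 0) s ((0, m) : T)) _ _ _ (hm m)).
- split=> [|a u v hu hv]; first exact: subm0 sS.
  have -> : (0, a *: u + v) = a *: (0, u) + (0, v) :> T.
    by congr pair; rewrite /= scaler0 addr0.
  exact: sS.2.
- by move=> u ->; exact: subm0 sS.
- move=> e se; apply: lspan_mem; first exact: subm_zero.
  by rewrite mem_cat orbC (map_f (fun p => (0, p) : T)).
Qed.

Lemma kantor_alg_generated : exists es : seq L, forall v, lspan (fun u => u = 0) es v.
Proof.
have [s hs] := pair_generated.
pose es : seq L := [seq inT t | t <- s] ++ [seq inD (rop t u) | t <- s, u <- s].
have sS : @subm k L _ := lspan_subm es (subm_zero L).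
exists es => v; rewrite (inDT v); apply: (submD sS); last first.
  refine (lspan_min (N' := fun t => lspan (fun u => u = 0) es (inT t)) _ _ _ (hs v.2)).
  - split=> [|a u w hu hw]; first exact: subm0 sS.
    by rewrite inT_lin; exact: sS.2.
  - by move=> u ->; exact: subm0 sS.
  - move=> e se; apply: lspan_mem; first exact: subm_zero.
    by rewrite mem_cat (map_f inT).
pose N (F : T -> T) := exists D : inn K, inn_val D = F /\ lspan (fun u => u = 0) es (inD D).
have NS : @subm k (T -> T) N.
  split=> [|a _ _ [D [<- hD]] [E [<- hE]]].
    by exists 0; split=> //; exact: subm0 sS.
  by exists (a *: D + E); split=> //; rewrite inD_lin; exact: sS.2.
suff [D [/val_inj <- //]] : N v.1.
apply: inn_ind => // t u; exists (rop t u); split=> //.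
have sl y : @subm k T (fun x => lspan (fun w => w = 0) es (inD (rop x y))).
  by apply: subm_inD => // a x x'; apply: inn_ext => w; apply: Rop_linl.
have sr x : @subm k T (fun y => lspan (fun w => w = 0) es (inD (rop x y))).
  by apply: subm_inD => // a y y'; apply: inn_ext => w; apply: Rop_linr.
refine (lspan_min (sl u) _ _ (hs t)); first by move=> _ ->; exact: subm0 (sl u).
move=> {}t st; refine (lspan_min (sr t) _ _ (hs u)).
  by move=> _ ->; exact: subm0 (sr t).
move=> {}u su; apply: lspan_mem; first exact: subm_zero.
by rewrite mem_cat orbC allpairs_f.
Qed.

Hypothesis hK : kantor_simple K.

(** The multiples of [a] form an ideal of the pair. If it is 0, then [a] acts as 0; if it is
    everything, [nakayama] inverts [a] on the pair, hence pointwise on [inn]. *)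
Lemma kantor_alg_field_like : @field_like k L.
Proof.
move=> a; pose Ip : set (Kpos K) := fun p => exists q, p = a *: q.
pose Im : set (Kneg K) := fun m => exists n, m = a *: n.
have [|[h1 h2]|[h1 h2]] := hK.2 Ip Im.
- split.
  + apply/submod_closedE; split=> [|b _ _ [p ->] [q ->]]; first by exists 0; rewrite scaler0.
    by exists (b *: p + q); rewrite scalerDr !scalerA mulrC.
  + apply/submod_closedE; split=> [|b _ _ [p ->] [q ->]]; first by exists 0; rewrite scaler0.
    by exists (b *: p + q); rewrite scalerDr !scalerA mulrC.
  + split=> x y z [w ->]; eexists; rewrite -[a *: w]addr0.
    * by rewrite (trilin_l tf) (trilin0l tf) addr0.
    * by rewrite (trilin_m tf) (trilin0m tf) addr0.
    * by rewrite (trilin_r tf) (trilin0r tf) addr0.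
  + split=> x y z [w ->]; eexists; rewrite -[a *: w]addr0.
    * by rewrite (trilin_l tg) (trilin0l tg) addr0.
    * by rewrite (trilin_m tg) (trilin0m tg) addr0.
    * by rewrite (trilin_r tg) (trilin0r tg) addr0.
- left; have aT (t : T) : a *: t = 0.
    case: t => p m; congr pair => /=.
      by have : Ip (a *: p) by [exists p]; rewrite h1.
    by have : Im (a *: m) by [exists m]; rewrite h2.
  by case=> D t; congr pair; [apply: inn_ext => u | ]; apply: aT.
right; have [s hs] := pair_generated.
have [|b hb] := nakayama (a := a) hs.
  case=> p m; have [q ->] : Ip p by rewrite h1.
  have [n ->] : Im m by rewrite h2.
  by exists (q, n).
by exists b; case=> D t; congr pair; [apply: inn_ext => u | ]; apply: hb.
Qed.

Lemma kantor_alg_kantor_lie : @kantor_lie k L posT negT.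
Proof.
have sp : @subm k L posT.
  split=> [|a _ _ [p ->] [q ->]]; first by exists 0.
  by exists (a *: p + q); rewrite -inT_lin; congr (inT (_, _)); rewrite /= scaler0 addr0.
have sm : @subm k L negT.
  split=> [|a _ _ [p ->] [q ->]]; first by exists 0.
  by exists (a *: p + q); rewrite -inT_lin; congr (inT (_, _)); rewrite /= scaler0 addr0.
split=> //.
- by move=> u [p ->] [m [-> _]].
- by move=> _ _ _ [p ->] [q ->] [r ->]; rewrite inT_triple RopE /= !zE.
- by move=> _ _ _ [p ->] [q ->] [r ->]; rewrite inT_triple RopE /= !zE.
- by move=> _ _ _ [p ->] [q ->] [r ->]; rewrite inT_triple RopE /= !zE; eexists.
- by move=> _ _ _ [p ->] [q ->] [r ->]; rewrite inT_triple RopE /= !zE; eexists.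
- by move=> _ _ _ [p ->] [q ->] [r ->]; rewrite pos_triple; eexists.
- by move=> _ _ _ [p ->] [q ->] [r ->]; rewrite neg_triple; eexists.
- move=> X Y d hX hY dXY dp dm.
  have [D dE] : exists D, d = inD D.
    apply: (brspan_ind (N := fun d : L => exists D, d = inD D) _ _ dXY).
      split=> [|a _ _ [D ->] [E ->]]; first by exists 0.
      by exists (a *: D + E); congr pair; rewrite /= scaler0 addr0.
    have XT Z u : Z = posT \/ Z = negT -> Z u -> exists t, u = inT t.
      by case=> -> [v ->]; eexists.
    move=> x y /(XT _ _ hX)[s ->] /(XT _ _ hY)[t ->].
    by exists (rop s t); apply: inT_br.
  rewrite dE in dp dm *; congr pair; apply: inn_ext => -[p m].
  have -> : (p, m) = (p, 0) + (0, m) :> T by congr pair; rewrite /= ?addr0 ?add0r.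
  have /(congr1 snd)/= hp : inT (D (p, 0)) = 0 by rewrite -inner_br; apply: dp; exists p.
  have /(congr1 snd)/= hm : inT (D (0, m)) = 0 by rewrite -inner_br; apply: dm; exists m.
  by rewrite inn_D hp hm addr0.
- move=> Ip Im sIp sIm Ipp Imm [c1 c2 c3] [c4 c5 c6].
  pose Jp : set (Kpos K) := fun p => Ip (inT (p, 0)).
  pose Jm : set (Kneg K) := fun m => Im (inT (0, m)).
  have pT p : posT (inT (p, 0)) by exists p.
  have mT m : negT (inT (0, m)) by exists m.
  have [|[h1 h2]|[h1 h2]] := hK.2 Jp Jm.
  + split.
    * apply/submod_closedE; split=> [|a p q hp hq]; first exact: subm0 sIp.
      have := sIp.2 a _ _ hp hq; rewrite -inT_lin; congr (Ip (inT (_, _))).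
      by rewrite /= scaler0 addr0.
    * apply/submod_closedE; split=> [|a p q hp hq]; first exact: subm0 sIm.
      have := sIm.2 a _ _ hp hq; rewrite -inT_lin; congr (Im (inT (_, _))).
      by rewrite /= scaler0 addr0.
    * by split=> x y z h; rewrite /Jp -pos_triple; [apply: c1 | apply: c3 | apply: c2].
    * by split=> x y z h; rewrite /Jm -neg_triple; [apply: c4 | apply: c6 | apply: c5].
  + left; split=> u h.
      have [p e] := Ipp u h; rewrite e in h *.
      by have : Jp p by []; rewrite h1 => ->.
    have [p e] := Imm u h; rewrite e in h *.
    by have : Jm p by []; rewrite h2 => ->.
  + right; split=> _ [p ->].
      by have : Jp p by rewrite h1.
    by have : Jm p by rewrite h2.
case: hK.1 => -[x [y [z nz]]]; [left | right].
  exists (inT (x, 0)), (inT (0, y)), (inT (z, 0)).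
  by split; [exists x | exists y | exists z | rewrite pos_triple => -[]].
exists (inT (0, x)), (inT (y, 0)), (inT (0, z)).
by split; [exists x | exists y | exists z | rewrite neg_triple => -[]].
Qed.

End Construction.

Theorem corollary4p12 (k : comUnitRingType)
    (h2 : (2%:R : k) \is a GRing.unit) (h3 : (3%:R : k) \is a GRing.unit)
    (K : kantor_pair k) (hK : kantor_simple K) :
  kantor_nondegenerate K.
Proof.
have H := kantor_alg_kantor_lie hK; have fL := kantor_alg_field_like hK.
have [es gen] := kantor_alg_generated K.
split=> x x0.
  have [] // : inT (x, 0) = 0 :> kantor_alg K.
  apply: (kantor_lie_nondegenerate h2 h3 H fL gen); first by exists x.
  (* ad(x)^2 b is minus the triple product {x, b, x}. *)
  by move=> _ [b ->]; rewrite brC pos_triple x0; exact: oppr0.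
have [] // : inT (0, x) = 0 :> kantor_alg K.
apply: (kantor_lie_nondegenerate h2 h3 (kantor_lie_swap H) fL gen); first by exists x.
by move=> _ [b ->]; rewrite brC neg_triple x0; exact: oppr0.
Qed.
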